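(* Let $k$ be an algebraically closed field of characteristic $p\ge 0$. Let $X\subset \mathbf{P}^n_k$ be a general smooth complete intersection of multidegree $(d_1,\dots,d_c)$ with $$2\le d_1\le \cdots \le d_c,\qquad c\ge 2,\qquad n-c\ge 1.$$ Assume $(d_1,\dots,d_c)\neq (2,2)$. Then $X$ admits no nontrivial linear automorphism of finite order prime to $p$, where in characteristic $0$ ''order prime to $p$'' means every finite order.
   Context: A complete intersection of multidegree $(d_1,\dots,d_c)$ in $\mathbf{P}^n_k$ is a closed subscheme of codimension $c$ whose homogeneous ideal is generated by forms $F_1,\dots,F_c$ with $\deg F_i=d_i$. A linear automorphism of $X$ is an automorphism of $X$ induced by a projective linear transformation $h$ of $\mathbf{P}^n$ with $h(X)=X$. ''General'' means: let $T^\circ$ be the (irreducible) parameter space of smooth complete intersections in $\mathbf{P}^n_k$ of the given multidegree; there is a nonempty Zariski open subset of $T^\circ$ such that the assertion holds for every $X$ in it. Equivalently, the assertion holds for $X=V(F_1,\dots,F_c)$ for all $(F_1,\dots,F_c)$ in a nonempty Zariski open subset of the affine space of $c$-tuples of forms of degrees $d_1,\dots,d_c$ in $n+1$ variables. *)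

(* Defs.v *)
From mathcomp Require Import all_boot all_order all_algebra.
From mathcomp.multinomials Require Export mpoly.

Set Implicit Arguments.
Unset Strict Implicit.
Unset Printing Implicit Defensive.

Import GRing.Theory.
Local Open Scope ring_scope.

Definition has_char (k : nzRingType) (p : nat) : Prop :=
  (p = 0%N /\ [pchar k] =i pred0) \/ p \in [pchar k].

(* The disjunct p = 0 is needed: coprime m 0 would force m = 1. *)
Definition prime_to (p m : nat) : Prop := p = 0%N \/ coprime m p.

(* A subset of P^n(k) is given by the nonzero vectors representing its
   points. *)
Definition pset (k : fieldType) (n : nat) := 'cV[k]_n.+1 -> Prop.

Definition zeros (k : fieldType) (n c : nat) (F : 'I_c -> {mpoly k[n.+1]}) :
    pset k n :=
  fun x => x != 0 /\ forall i, (F i).@[fun j => x j 0] = 0.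

(* Every nonzero representative of a point is tested, so for closed X over an
   infinite field this is the homogeneous ideal of X: f belongs to it iff each
   homogeneous component of f vanishes on X. *)
Definition ideal_of (k : fieldType) (n : nat) (X : pset k n)
    (f : {mpoly k[n.+1]}) : Prop :=
  forall x, X x -> f.@[fun j => x j 0] = 0.

Definition generated_by (k : fieldType) (n c : nat)
    (F : 'I_c -> {mpoly k[n.+1]}) (f : {mpoly k[n.+1]}) : Prop :=
  exists g : 'I_c -> {mpoly k[n.+1]}, f = \sum_(i < c) g i * F i.

(* Algebraic independence over k of the classes of the y_i in the homogeneous
   coordinate ring k[x_0, ..., x_n] / I(X). *)
Definition alg_indep_on (k : fieldType) (n : nat) (X : pset k n) (r : nat)
    (y : r.-tuple {mpoly k[n.+1]}) : Prop :=
  forall P : {mpoly k[r]}, ideal_of X (P \mPo y) -> P = 0.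

(* dim X = e, as the transcendence degree of the homogeneous coordinate ring
   (the ring of the affine cone, of dimension dim X + 1) minus one. *)
Definition has_dim (k : fieldType) (n : nat) (X : pset k n) (e : nat) : Prop :=
  (exists y : e.+1.-tuple {mpoly k[n.+1]}, alg_indep_on X y) /\
  (forall y : e.+2.-tuple {mpoly k[n.+1]}, ~ alg_indep_on X y).

Definition has_codim (k : fieldType) (n : nat) (X : pset k n) (c : nat) : Prop :=
  exists2 e : nat, has_dim X e & (e + c = n)%N.

Definition forms (k : fieldType) (n c : nat) (d : c.-tuple nat)
    (F : 'I_c -> {mpoly k[n.+1]}) : Prop :=
  forall i, F i \is (tnth d i).-homog.

Definition complete_intersection (k : fieldType) (n c : nat) (d : c.-tuple nat)
    (F : 'I_c -> {mpoly k[n.+1]}) : Prop :=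
  [/\ forms d F,
      has_codim (zeros F) c
    & forall f, ideal_of (zeros F) f <-> generated_by F f].

Definition jacobian (k : fieldType) (n c : nat) (F : 'I_c -> {mpoly k[n.+1]})
    (x : 'cV[k]_n.+1) : 'M[k]_(c, n.+1) :=
  \matrix_(i < c, j < n.+1) ((F i)^`M(j)).@[fun l => x l 0].

(* A smooth subscheme is reduced, so over an algebraically closed field it is
   determined by its k-points, its homogeneous ideal is the ideal of forms
   vanishing at them, and its automorphisms are determined by their action on
   them.  Smoothness: the generators of the ideal have a Jacobian matrix of rank
   codim X at every point. *)
Definition smooth_ci (k : fieldType) (n c : nat) (d : c.-tuple nat)
    (F : 'I_c -> {mpoly k[n.+1]}) : Prop :=
  complete_intersection d F /\
  forall x, zeros F x -> \rank (jacobian F x) = c.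

(* One coordinate for each pair of an index i < c and a monomial of degree d_i;
   the monomials in n+1 variables of degree < d_i + 1 form a finite type. *)
Definition coord (n c : nat) (d : c.-tuple nat) : finType :=
  {i : 'I_c & {m : 'X_{1..n.+1 < (tnth d i).+1} | mdeg m == tnth d i}}.

Definition coefs (k : fieldType) (n c : nat) (d : c.-tuple nat)
    (F : 'I_c -> {mpoly k[n.+1]}) (j : 'I_#|coord n d|) : k :=
  let im := enum_val j in (F (tag im))@_(val (tagged im)).

(* U is the complement, among c-tuples of forms, of the common zero locus of a
   set S of polynomials in the coefficients. *)
Definition zariski_open (k : fieldType) (n c : nat) (d : c.-tuple nat)
    (U : ('I_c -> {mpoly k[n.+1]}) -> Prop) : Prop :=
  exists S : {mpoly k[#|coord n d|]} -> Prop,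
    forall F, forms d F ->
      (U F <-> exists2 P, S P & P.@[coefs (d := d) F] != 0).

(* Since h is invertible, the equivalence says h(X) = X. *)
Definition lin_aut (k : fieldType) (n : nat) (X : pset k n)
    (h : 'M[k]_n.+1) : Prop :=
  h \in unitmx /\ forall x, X (h *m x) <-> X x.

(* h x and x are the same point of P^n for every x in X; h itself need not be
   scalar. *)
Definition trivial_on (k : fieldType) (n : nat) (X : pset k n)
    (h : 'M[k]_n.+1) : Prop :=
  forall x, X x -> exists a : k, h *m x = a *: x.

Definition aut_order (k : fieldType) (n : nat) (X : pset k n)
    (h : 'M[k]_n.+1) (m : nat) : Prop :=
  [/\ (0 < m)%N, trivial_on X (h ^+ m)
    & forall l : nat, (0 < l < m)%N -> ~ trivial_on X (h ^+ l)].

(* Main.v *)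
Require Import Defs.
From mathcomp Require Import all_boot all_order all_algebra.
From mathcomp Require Import perm separable zify ring.
From mathcomp.multinomials Require Import mpoly.
Import Defs.

Set Implicit Arguments.
Unset Strict Implicit.
Unset Printing Implicit Defensive.

Import GRing.Theory.
Local Open Scope ring_scope.

(** A property of the general complete intersection has to hold outside a thin
    set of coefficient vectors, one on which a nonzero polynomial vanishes. So
    the theorem amounts to two facts: the general tuple (F_1, ..., F_c) is a
    complete intersection, and the complete intersections that are singular, or
    that have an automorphism of the excluded kind, form a thin set.

    Thinness always comes from a count of parameters: the image of a polynomial
    map from a space of smaller dimension is thin, since more polynomials than
    variables are algebraically dependent ([thin_image]). The families to be
    excluded have a common shape ([typed]): forms with coefficients in a set T
    of coordinates, to which some multiples of one another, listed in A, are
    added, followed by a linear substitution that agrees with the identity off a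
    set E of entries. When E and A together are smaller than the complement of
    T, the family is thin, and there are finitely many such families
    ([thin_small_type]). A singular point leads to one of them
    ([singular_small_type]).

    That the general tuple is a complete intersection ([generic_complete_intersection])
    is seen by comparison with F_i = z_i ^ d_i, where z_1, ..., z_c are the first
    c variables. For general F the monomials whose exponent at z_i is less than
    d_i still form a basis of the quotient ring over the polynomial ring in the
    other variables; this is an open condition, because it can be checked in
    bounded degree. If moreover the trace form of one fibre is nondegenerate,
    every polynomial vanishing on X has normal form 0, hence lies in the ideal
    (F), and the dimension of X is that of the space of parameters. The trace
    form is nondegenerate for suitable products of linear forms, whose fibre is
    a grid of distinct points ([det_trform_split]).

    Now let h be an automorphism of X with h ^ m trivial on X and m nonzero in k. A
    matrix acting trivially on X is scalar ([trivial_on_scalar]), so h is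
    diagonalizable; let f_0, ..., f_n be its eigenvalues, not all equal. A basis
    of eigenvectors can be chosen to contain the identity matrix in the blocks of
    equal eigenvalues, so that it depends on D parameters only, where D is the
    number of pairs (i, j) with f_i <> f_j ([power_eigenbasis]). In this basis
    the ideal of X is stable under x_i |-> f_i x_i, and the equations of lowest
    degree e can be replaced by eigenvectors of weights chi_a
    ([lowest_block]), at the cost of one parameter for each pair (a, b) with
    chi_a <> chi_b. An eigenvector of weight chi_a contains no monomial of another
    weight. The monomials of degree e lost in this way outnumber the parameters
    if e >= 3, if there are at least three equations of degree 2, and if there
    are two, except when both have weight chi and all f_i ^ 2 are equal to chi
    ([block_cubic], [block_many], [block_pencil]).

    There remain the case of one quadric and this exceptional pencil. Since the
    multidegree is not (2, 2), there is an equation of a further degree, and in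
    the next degree one equation can be replaced, modulo multiples of the others,
    by a semi-invariant P of some weight psi ([semi_invariant_generator]). Multiples
    of the quadrics that have weight psi can be absorbed in P, and for a pencil the
    multiples of the second quadric need only cofactors that are reduced modulo
    the leading monomial of the first. The monomials lost in P then compensate for
    the parameters of the multiples ([quadric_and_form], [involution_pencil]). *)

(** * Polynomial functions over an infinite field *)

Lemma uniq_seq_of_size (k : closedFieldType) (N : nat) :
  exists2 s : seq k, uniq s & size s = N.
Proof.
elim: N => [|N [s us sz]]; first by exists [::].
have /closed_nonrootP[x nx] : (\prod_(a <- s) ('X - a%:P) : {poly k}) != 0.
  exact/monic_neq0/monic_prod_XsubC.
by exists (x :: s); rewrite /= ?sz // us andbT -root_prod_XsubC.
Qed.

(** The weights are the entries of the inverse of a Vandermonde matrix. *)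
Lemma power_dual_weights (k : fieldType) (s : seq k) (N : nat) :
    uniq s -> (N <= size s)%N ->
  exists w : nat -> nat -> k, forall a b, (a < N)%N -> (b < N)%N ->
    \sum_(l < N) w a l * s`_l ^+ b = (a == b)%:R.
Proof.
case: N => [|N] us sz; first by exists (fun _ _ => 0).
pose v : 'rV[k]_N.+1 := \row_l s`_l.
have uV : Vandermonde N.+1 v \in unitmx.
  rewrite unitmxE det_Vandermonde unitfE; apply/prodf_neq0 => i _.
  apply/prodf_neq0 => j ltij; rewrite !mxE subr_eq0 nth_uniq //.
  - by rewrite neq_ltn ltij orbT.
  - exact: leq_trans (ltn_ord _) sz.
  - exact: leq_trans (ltn_ord _) sz.
pose W := invmx (Vandermonde N.+1 v).
exists (fun a l => W (inord l) (inord a)) => a b lta ltb.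
have := congr1 (fun M : 'M_N.+1 => M (inord b) (inord a)) (mulmxV uV).
rewrite !mxE -val_eqE /= !inordK // eq_sym => <-.
by apply: eq_bigr => l _; rewrite inord_val !mxE inordK // mulrC.
Qed.

(** Tensoring the dual weights of the one-variable grids isolates each
    coefficient of a polynomial from its values on the product grid. *)
Lemma grid_coef_eq0 (k : fieldType) (I X : finType) (s : seq k)
    (D : I -> nat) (e : X -> I -> nat) (c : X -> k) :
    uniq s -> (forall i, (D i <= size s)%N) ->
    (forall x i, (e x i < D i)%N) ->
    (forall x y, (forall i, e x i = e y i) -> x = y) ->
    (forall g : I -> nat, (forall i, (g i < D i)%N) ->
      \sum_x c x * \prod_i s`_(g i) ^+ e x i = 0) ->
  forall x, c x = 0.
Proof.
move=> us sz ltD einj H x0.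
have [w wP] : exists w : I -> nat -> nat -> k, forall i a b,
    (a < D i)%N -> (b < D i)%N ->
    \sum_(l < D i) w i a l * s`_l ^+ b = (a == b)%:R.
  have /fin_all_exists : forall i, exists w : nat -> nat -> k, forall a b,
    (a < D i)%N -> (b < D i)%N ->
    \sum_(l < D i) w a l * s`_l ^+ b = (a == b)%:R.
    by move=> i; apply: power_dual_weights.
  by [].
pose N := size s.
pose Q (i : I) := [pred l : 'I_N | (l < D i)%N].
have E : forall x, \sum_(g in family Q)
      \prod_i (w i (e x0 i) (g i) * s`_(g i) ^+ e x i) = (x == x0)%:R.
  move=> x; rewrite -(bigA_distr_big_dep _ (fun i (l : 'I_N) =>
    w i (e x0 i) l * s`_l ^+ e x i)).
  under eq_bigr => i _.
    rewrite -(big_ord_widen_cond N xpredT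
      (fun l => w i (e x0 i) l * s`_l ^+ e x i)) ?sz //.
    rewrite wP ?ltD //; over.
  case: eqP => [->|ne]; first by rewrite big1 // => i _; rewrite eqxx.
  have [i nei] : exists i, e x0 i != e x i.
    have [/existsP//|] := boolP [exists i, e x0 i != e x i].
    rewrite negb_exists => /forallP h; case: ne.
    by apply: einj => i; apply/esym/eqP; rewrite -[_ == _]negbK.
  by rewrite (bigD1 i) //= (negbTE nei) mul0r.
have : \sum_(g in family Q) (\prod_i w i (e x0 i) (g i)) *
    (\sum_x c x * \prod_i s`_(g i) ^+ e x i) = 0.
  apply: big1 => g /familyP gQ.
  suff -> : \sum_x c x * \prod_i s`_(g i) ^+ e x i = 0 by rewrite mulr0.
  by apply: (H (fun i => g i)) => i; have := gQ i; rewrite inE.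
under eq_bigr => g _ do rewrite big_distrr /=.
rewrite exchange_big /=.
under eq_bigr => x _.
  under eq_bigr => g _ do rewrite mulrCA -big_split /=.
  rewrite -big_distrr /= E; over.
by rewrite (bigD1 x0) //= eqxx mulr1 big1 ?addr0 // => x /negbTE ->; rewrite mulr0.
Qed.

Lemma meval_bounded (R : comNzRingType) (n b : nat) (p : {mpoly R[n]}) v :
  (msize p <= b)%N ->
  p.@[v] = \sum_(m : 'X_{1..n < b}) p@_m * \prod_i v i ^+ (m : 'X_{1..n}) i.
Proof.
move=> le; rewrite {1}(mpolywE le) raddf_sum /=.
by apply: eq_bigr => m _; rewrite mevalZ mevalX.
Qed.

Lemma mnm_le_mdeg n (m : 'X_{1..n}) i : (m i <= mdeg m)%N.
Proof. by rewrite mdegE (bigD1 i) //= leq_addr. Qed.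

Lemma mpoly_nonroot (k : closedFieldType) (n : nat) (p : {mpoly k[n]}) :
  p != 0 -> exists v, p.@[v] != 0.
Proof.
move=> p0; set N := msize p; have [s us sz] := uniq_seq_of_size k N.
case: (boolP [exists g : {ffun 'I_n -> 'I_N}, p.@[fun i => s`_(g i)] != 0]).
  by case/existsP=> g h; exists (fun i => s`_(g i)).
rewrite negb_exists => /forallP h; case/eqP: p0.
apply/mpolyP => m; rewrite mcoeff0.
have [ltm|] := ltnP (mdeg m) N; last by move/msize_mdeg_ge/memN_msupp_eq0.
apply: (@grid_coef_eq0 k 'I_n 'X_{1..n < N} s (fun=> N)
  (fun x i => (x : 'X_{1..n}) i) (fun x => p@_x) us _ _ _ _ (BMultinom ltm)).
- by move=> i; rewrite sz.
- by move=> x i; apply: leq_ltn_trans (mnm_le_mdeg _ _) (bmdeg x).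
- by move=> x y exy; apply/val_inj/mnmP.
- move=> g gN; rewrite -(meval_bounded (fun i => s`_(g i))) //.
  have := h [ffun i => Ordinal (gN i)]; rewrite negbK => /eqP h0.
  by rewrite -[RHS]h0; apply: meval_eq => i; rewrite ffunE.
Qed.

Lemma mpoly_eq0_meval (k : closedFieldType) (n : nat) (p : {mpoly k[n]}) :
  (forall v, p.@[v] = 0) -> p = 0.
Proof.
move=> h; apply/eqP/negPn/negP => /mpoly_nonroot[v].
by rewrite h eqxx.
Qed.

Lemma mpoly_eq_meval (k : closedFieldType) (n : nat) (p q : {mpoly k[n]}) :
  (forall v, p.@[v] = q.@[v]) -> p = q.
Proof.
move=> h; apply/eqP; rewrite -subr_eq0; apply/eqP/mpoly_eq0_meval => v.
by rewrite mevalB h subrr.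
Qed.

(** Polynomial functions are handled through their values: the indexing of
    variables by a finite type, and closure under composition and sums, then
    come for free. *)
Definition polyf (k : fieldType) (T : finType) (f : (T -> k) -> k) : Prop :=
  exists p : {mpoly k[#|T|]}, forall v, f v = p.@[fun i => v (enum_val i)].

Section PolyF.
Variables (k : fieldType) (T : finType).
Implicit Types f g : (T -> k) -> k.

Lemma polyf_ext f g : polyf f -> (forall v, g v = f v) -> polyf g.
Proof. by move=> [p pP] e; exists p => v; rewrite e. Qed.

Lemma polyfC (a : k) : polyf (fun _ : T -> k => a).
Proof. by exists a%:MP => v; rewrite mevalC. Qed.

Lemma polyfX (t : T) : polyf (fun v : T -> k => v t).
Proof. by exists 'X_(enum_rank t) => v; rewrite mevalXU enum_rankK. Qed.

Lemma polyfD f g : polyf f -> polyf g -> polyf (fun v => f v + g v).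
Proof. by case=> p pP [q qP]; exists (p + q) => v; rewrite mevalD pP qP. Qed.

Lemma polyfM f g : polyf f -> polyf g -> polyf (fun v => f v * g v).
Proof. by case=> p pP [q qP]; exists (p * q) => v; rewrite mevalM pP qP. Qed.

Lemma polyf_sum (I : Type) (r : seq I) (P : pred I) (F : I -> (T -> k) -> k) :
  (forall i, P i -> polyf (F i)) -> polyf (fun v => \sum_(i <- r | P i) F i v).
Proof.
move=> h; elim: r => [|i r ih].
  by apply: (polyf_ext (polyfC 0)) => v; rewrite big_nil.
case Pi: (P i); last by apply: (polyf_ext ih) => v; rewrite big_cons Pi.
by apply: (polyf_ext (polyfD (h _ Pi) ih)) => v; rewrite big_cons Pi.
Qed.

Lemma polyf_prod (I : Type) (r : seq I) (P : pred I) (F : I -> (T -> k) -> k) :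
  (forall i, P i -> polyf (F i)) -> polyf (fun v => \prod_(i <- r | P i) F i v).
Proof.
move=> h; elim: r => [|i r ih].
  by apply: (polyf_ext (polyfC 1)) => v; rewrite big_nil.
case Pi: (P i); last by apply: (polyf_ext ih) => v; rewrite big_cons Pi.
by apply: (polyf_ext (polyfM (h _ Pi) ih)) => v; rewrite big_cons Pi.
Qed.

Lemma polyf_exp f m : polyf f -> polyf (fun v => f v ^+ m).
Proof. by case=> p pP; exists (p ^+ m) => v; rewrite rmorphXn /= pP. Qed.

Lemma polyf_mpoly n (p : {mpoly k[n]}) (h : 'I_n -> (T -> k) -> k) :
  (forall i, polyf (h i)) -> polyf (fun v => p.@[fun i => h i v]).
Proof.
move=> hP; apply: (@polyf_ext (fun v =>
    \sum_(m <- msupp p) p@_m * \prod_i h i v ^+ m i)); last first.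
  by move=> v; rewrite mevalE.
apply: polyf_sum => m _; apply: polyfM; first exact: polyfC.
by apply: polyf_prod => i _; apply: polyf_exp.
Qed.

Lemma polyf_det n (M : 'I_n -> 'I_n -> (T -> k) -> k) :
  (forall i j, polyf (M i j)) -> polyf (fun v => \det (\matrix_(i, j) M i j v)).
Proof.
move=> h; apply: (@polyf_ext (fun v =>
    \sum_(s : 'S_n) (-1) ^+ s * \prod_i M i (s i) v)); last first.
  move=> v; rewrite /determinant; apply: eq_bigr => s _; congr (_ * _).
  by apply: eq_bigr => i _; rewrite mxE.
apply: polyf_sum => s _; apply: polyfM; first exact: polyfC.
by apply: polyf_prod.
Qed.

Lemma polyf_adj n (M : 'I_n -> 'I_n -> (T -> k) -> k) a b :
  (forall i j, polyf (M i j)) ->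
  polyf (fun v => (\adj (\matrix_(i, j) M i j v)) a b).
Proof.
move=> h; apply: (@polyf_ext (fun v => (-1) ^+ (b + a) *
    \det (\matrix_(i, j) M (lift b i) (lift a j) v))); last first.
  move=> v; rewrite mxE /cofactor; congr (_ * \det _).
  by apply/matrixP => i j; rewrite !mxE.
by apply: polyfM; [apply: polyfC | apply: polyf_det => i j].
Qed.

End PolyF.

Lemma polyf_comp (k : fieldType) (T T' : finType) (f : (T -> k) -> k)
    (h : T -> (T' -> k) -> k) :
  polyf f -> (forall t, polyf (h t)) -> polyf (fun v => f (fun t => h t v)).
Proof.
case=> p pP hP; apply: (polyf_ext (polyf_mpoly p (fun i => hP (enum_val i)))).
by move=> v; rewrite pP.
Qed.

Section PolyFClosed.
Variables (k : closedFieldType) (T : finType).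
Implicit Types f g : (T -> k) -> k.

Lemma polyf_nonroot2 f g u v : polyf f -> polyf g -> f u != 0 -> g v != 0 ->
  exists w, f w != 0 /\ g w != 0.
Proof.
case=> p pP [q qP]; rewrite pP qP => pu qv.
have pq0 : p * q != 0.
  by apply: mulf_neq0; [apply: contraNneq pu|apply: contraNneq qv] => ->;
     rewrite meval0.
have [w] := mpoly_nonroot pq0; rewrite mevalM mulf_eq0 negb_or => /andP[pw qw].
exists (fun t => w (enum_rank t)); rewrite pP qP.
have e : forall r : {mpoly k[#|T|]},
    r.@[fun i => w (enum_rank (enum_val i))] = r.@[w].
  by move=> r; apply: meval_eq => i; rewrite enum_valK.
by rewrite !e.
Qed.

Lemma polyf_nonroot_prod (I : eqType) (r : seq I) (F : I -> (T -> k) -> k) :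
    (forall i, i \in r -> polyf (F i)) ->
    (forall i, i \in r -> exists v, F i v != 0) ->
  exists v, \prod_(i <- r) F i v != 0.
Proof.
elim: r => [|i r ih] h1 h2; first by exists (fun=> 0); rewrite big_nil oner_neq0.
have [u Fu] := h2 i (mem_head _ _).
have ir j : j \in r -> j \in i :: r by rewrite inE orbC => ->.
have [j /ir/h1//|j /ir/h2//|v rv] := ih.
have [||w [Fw rw]] := @polyf_nonroot2 (F i) (fun v => \prod_(j <- r) F j v) u v _ _ Fu rv.
- exact: h1 (mem_head _ _).
- rewrite /polyf; have [P hP] : polyf (fun v => \prod_(j <- r) (if j \in r then F j v else 0)).
    apply: polyf_prod => j _; case jr: (j \in r); [exact/h1/ir|exact: polyfC].
  exists P => w; rewrite -hP big_seq [RHS]big_seq.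
  by apply: eq_bigr => j ->.
- by exists w; rewrite big_cons mulf_neq0.
Qed.

End PolyFClosed.

(** * Algebraic dependence by counting *)

Lemma msizeM_leS (R : idomainType) n (p q : {mpoly R[n]}) a b :
  (msize p <= a.+1)%N -> (msize q <= b.+1)%N -> (msize (p * q) <= (a + b).+1)%N.
Proof.
have [->|p0] := eqVneq p 0; first by rewrite mul0r msize0.
have [->|q0] := eqVneq q 0; first by rewrite mulr0 msize0.
by move=> hp hq; rewrite msizeM //; lia.
Qed.

Lemma msizeX_leS (R : idomainType) n (p : {mpoly R[n]}) a j :
  (msize p <= a.+1)%N -> (msize (p ^+ j) <= (a * j).+1)%N.
Proof.
move=> hp; elim: j => [|j ih]; first by rewrite expr0 msize1.
by rewrite exprS mulnS msizeM_leS.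
Qed.

Lemma msize_prod_leS (R : idomainType) n (I : Type) (r : seq I)
    (P : I -> {mpoly R[n]}) a :
  (forall i, (msize (P i) <= a.+1)%N) ->
  (msize (\prod_(i <- r) P i) <= (a * size r).+1)%N.
Proof.
move=> h; elim: r => [|i r ih]; first by rewrite big_nil msize1.
by rewrite big_cons mulnS msizeM_leS.
Qed.

Lemma row_relation (k : fieldType) (X : finType) (K : nat) (A : X -> 'rV[k]_K) :
  (K < #|X|)%N ->
  exists2 c : X -> k, (exists x, c x != 0) & \sum_x c x *: A x = 0.
Proof.
move=> ltK; pose B : 'M[k]_(#|X|, K) := \matrix_i A (enum_val i).
have : kermx B != 0.
  rewrite -mxrank_eq0 mxrank_ker subn_eq0 -ltnNge.
  exact: leq_ltn_trans (rank_leq_col _) ltK.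
case/rowV0Pn=> u /sub_kermxP uB u0.
exists (fun x => u 0 (enum_rank x)).
  have [i ui] : exists i, u 0 i != 0.
    have [/existsP//|] := boolP [exists i, u 0 i != 0].
    rewrite negb_exists => /forallP h; case/eqP: u0.
    by apply/rowP => i; rewrite mxE; apply/eqP; have := h i; rewrite negbK.
  by exists (enum_val i); rewrite enum_valK.
rewrite -[RHS]uB mulmx_sum_row (reindex (fun i : 'I_#|X| => enum_val i)) /=.
  by apply: eq_bigr => i _; rewrite enum_valK rowK.
by exists enum_rank => x _; rewrite ?enum_valK ?enum_rankK.
Qed.

(** Monomials with all exponents below B number B ^ N, while their values lie
    in a space whose dimension grows as B ^ M; for M < N a linear relation is
    forced as soon as B is large. *)
Lemma algebraic_dependence (k : fieldType) (n N M delta : nat)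
    (y : N.-tuple {mpoly k[n]}) (Z : {mpoly k[n]} -> Prop) (K : nat -> nat)
    (L : forall t, {mpoly k[n]} -> 'rV[k]_(K t)) :
    (forall t a f g, L t (a *: f + g) = a *: L t f + L t g) ->
    (forall t, (K t <= delta * t ^ M)%N) ->
    (forall t f, (msize f <= t)%N -> L t f = 0 -> Z f) ->
    (M < N)%N ->
  exists2 P : {mpoly k[N]}, P != 0 & Z (P \mPo y).
Proof.
move=> Llin Kle LZ ltMN.
pose E := (\max_(i < N) msize (tnth y i))%N.
have yE i : (msize (tnth y i) <= E.+1)%N.
  by apply: leqW; apply: (leq_bigmax (F := fun i => msize (tnth y i))).
pose B := (delta * (N * E + 1) ^ M).+1.
pose t := (N * (E * B)).+1.
pose X := {ffun 'I_N -> 'I_B}.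
have ltK : (K t < #|X|)%N.
  rewrite card_ffun !card_ord; apply: leq_ltn_trans (Kle _) _.
  have tB : (t <= B * (N * E + 1))%N by rewrite /t /B; nia.
  apply: (@leq_ltn_trans (delta * (B * (N * E + 1)) ^ M)).
    by rewrite leq_mul2l; apply/orP; right; case: (M) => // M'; rewrite leq_exp2r.
  apply: (@leq_trans (B ^ M.+1)); last by rewrite leq_pexp2l.
  by rewrite expnMn expnS mulnCA mulnC ltn_pmul2r ?expn_gt0.
pose mon (x : X) : 'X_{1..N} := [multinom (x i : nat) | i < N].
have monI : injective mon.
  move=> x x' /mnmP e; apply/ffunP => i; apply/val_inj.
  by have := e i; rewrite !mnmE.
have [c [x0 cx0] cL] := row_relation (fun x => L t ('X_[mon x] \mPo y)) ltK.
pose P := \sum_x c x *: 'X_[mon x] : {mpoly k[N]}.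
exists P.
  apply/eqP => /(congr1 (fun p => p@_(mon x0))).
  rewrite mcoeff0 raddf_sum /= (bigD1 x0) //= mcoeffZ mcoeffX eqxx mulr1.
  rewrite big1 ?addr0; first exact/eqP.
  by move=> x ne; rewrite mcoeffZ mcoeffX (inj_eq monI) (negbTE ne) mulr0.
have L0 : L t 0 = 0.
  by have := Llin t (-1) 0 0; rewrite scaler0 addr0 scaleN1r addNr.
have Lsum : forall r : seq X, L t (\sum_(x <- r) c x *: ('X_[mon x] \mPo y)) =
    \sum_(x <- r) c x *: L t ('X_[mon x] \mPo y).
  elim=> [|x r ih]; first by rewrite !big_nil.
  by rewrite !big_cons Llin ih.
apply: (LZ t); last first.
  rewrite /P raddf_sum /=; under eq_bigr => x _ do rewrite comp_mpolyZ.
  by rewrite Lsum.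
rewrite /P raddf_sum /=; apply: leq_trans (msize_sum _ _ _) _.
apply/bigmax_leqP => x _; rewrite comp_mpolyZ.
apply: leq_trans (msizeZ_le _ _) _; rewrite comp_mpolyX.
have h i : (msize (tnth y i ^+ mon x i) <= (E * B).+1)%N.
  apply: leq_trans (msizeX_leS _ (yE i)) _.
  by rewrite ltnS leq_mul2l mnmE ltnW ?orbT.
by rewrite -big_enum; apply: leq_trans (msize_prod_leS _ h) _; rewrite size_enum_ord mulnC.
Qed.

(** * Thin sets *)

Section Thin.
Variables (k : closedFieldType) (I : finType).

(** A set of points is thin when it is not Zariski dense. *)
Definition thin (B : (I -> k) -> Prop) : Prop :=
  exists f, [/\ polyf f, exists v, f v != 0 & forall v, B v -> f v = 0].

Lemma thin_sub (B B' : (I -> k) -> Prop) :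
  thin B' -> (forall v, B v -> B' v) -> thin B.
Proof. by case=> f [h1 h2 h3] s; exists f; split=> // v /s/h3. Qed.

Lemma thin_exists (T : finType) (B : T -> (I -> k) -> Prop) :
  (forall t, thin (B t)) -> thin (fun v => exists t, B t v).
Proof.
move=> /fin_all_exists[f fP]; exists (fun v => \prod_(t <- enum T) f t v); split.
- by apply: polyf_prod => t _; case: (fP t).
- by apply: polyf_nonroot_prod => t _; case: (fP t).
- move=> v [t Bt]; apply/eqP; rewrite prodf_seq_eq0; apply/hasP; exists t.
    by rewrite mem_enum.
  by case: (fP t) => _ _ /(_ v Bt) ->; rewrite eqxx.
Qed.

(** Used when B is thin under a numerical condition on the type of its members. *)
Lemma thin_and (P : Prop) (B : (I -> k) -> Prop) :
  (P -> thin B) -> decidable P -> thin (fun v => P /\ B v).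
Proof.
move=> h [p|np]; first by apply: (thin_sub (h p)) => v [].
exists (fun=> 1); split; first exact: polyfC.
  by exists (fun=> 0); rewrite oner_neq0.
by move=> v [].
Qed.

Lemma card_bmultinom_le n t : (#|{: 'X_{1..n < t}}| <= t ^ n)%N.
Proof.
case: t => [|t].
  by apply: leq_trans (leq0n _); rewrite leqn0; apply/eqP/eq_card0 => -[].
pose f (m : 'X_{1..n < t.+1}) : {ffun 'I_n -> 'I_t.+1} :=
  [ffun i => inord ((m : 'X_{1..n}) i)].
have fI : injective f.
  move=> m m' e; apply/val_inj/mnmP => i.
  have lt (w : 'X_{1..n < t.+1}) : ((w : 'X_{1..n}) i < t.+1)%N.
    exact: leq_ltn_trans (mnm_le_mdeg _ _) (bmdeg w).
  by have := congr1 (fun g : {ffun 'I_n -> 'I_t.+1} => g i : nat) e; rewrite !ffunE !inordK.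
by have := leq_card _ fI; rewrite card_ffun !card_ord.
Qed.

(** The coordinates of a point of B are more polynomials than there are
    parameters, and a relation between them is an equation for B. *)
Lemma thin_image (J : finType) (g : I -> (J -> k) -> k)
    (B : (I -> k) -> Prop) :
    (#|J| < #|I|)%N -> (forall i, polyf (g i)) ->
    (forall v, B v -> exists u, forall i, v i = g i u) ->
  thin B.
Proof.
move=> ltJI /fin_all_exists[p pP] Bg.
pose y := [tuple p (enum_val i) | i < #|I|].
pose L t (f : {mpoly k[#|J|]}) : 'rV[k]_#|{: 'X_{1..#|J| < t}}| :=
  \row_i f@_(enum_val i : 'X_{1..#|J| < t}).
have [|||P P0 PZ] := @algebraic_dependence k #|J| #|I| #|J| 1 y
  (fun f => f = 0) _ L _ _ _ ltJI.
- by move=> t a f h; apply/rowP => i; rewrite !mxE mcoeffD mcoeffZ.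
- by move=> t; rewrite mul1n card_bmultinom_le.
- move=> t f le /rowP h; apply/mpolyP => m; rewrite mcoeff0.
  have [ltm|] := ltnP (mdeg m) t.
    have := h (enum_rank (BMultinom ltm)); rewrite !mxE enum_rankK.
    exact.
  by move=> ltm; apply/memN_msupp_eq0/msize_mdeg_ge/(leq_trans le).
exists (fun v => P.@[fun i => v (enum_val i)]); split; first by exists P.
  have [v Pv] := mpoly_nonroot P0; exists (fun i => v (enum_rank i)).
  by rewrite (_ : meval _ _ = P.@[v]) //; apply: meval_eq => i; rewrite enum_valK.
move=> v /Bg[u uP].
have := congr1 (meval (fun j => u (enum_val j))) PZ.
rewrite comp_mpoly_meval meval0 => PZu; rewrite -[RHS]PZu.
by apply: meval_eq => i; rewrite tnth_mktuple uP pP.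
Qed.

End Thin.

(** * Forms, their coefficients and linear substitutions *)

Lemma dhomog_big_prod (R : comNzRingType) n (I : Type) (r : seq I)
    (P : I -> {mpoly R[n]}) (e : I -> nat) :
  (forall i, P i \is (e i).-homog) ->
  \prod_(i <- r) P i \is (\sum_(i <- r) e i).-homog.
Proof.
move=> h; apply: (big_rec2 (fun (p : {mpoly R[n]}) b => p \is b.-homog)).
  exact: dhomog1.
by move=> i a p _ hp; apply: dhomogM.
Qed.

Definition lsub (R : comNzRingType) N (A : 'M[R]_N) (p : {mpoly R[N]}) :
    {mpoly R[N]} :=
  p \mPo [tuple \sum_j A i j *: 'X_j | i < N].

Section LSub.
Variables (k : closedFieldType) (N : nat).
Implicit Types (A B : 'M[k]_N) (p q : {mpoly k[N]}) (x : 'cV[k]_N).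

Lemma lsub_meval A p x :
  (lsub A p).@[fun j => x j 0] = p.@[fun i => (A *m x) i 0].
Proof.
rewrite comp_mpoly_meval; apply: meval_eq => i; rewrite tnth_mktuple mxE.
by rewrite raddf_sum /=; apply: eq_bigr => j _; rewrite mevalZ mevalXU.
Qed.

Lemma mpoly_eq_col p q :
  (forall x : 'cV[k]_N, p.@[fun j => x j 0] = q.@[fun j => x j 0]) -> p = q.
Proof.
move=> h; apply: mpoly_eq_meval => v.
have e r : r.@[v] = r.@[fun j => (\col_j v j) j 0] :> k.
  by apply: meval_eq => j; rewrite mxE.
by rewrite e h -e.
Qed.

Lemma lsub_comp A B p : lsub A (lsub B p) = lsub (B *m A) p.
Proof. by apply: mpoly_eq_col => x; rewrite !lsub_meval mulmxA. Qed.

Lemma lsub1 p : lsub 1%:M p = p.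
Proof. by apply: mpoly_eq_col => x; rewrite lsub_meval mul1mx. Qed.

Lemma lsubD A : {morph lsub A : p q / p + q}.
Proof. by move=> p q; rewrite /lsub raddfD. Qed.

Lemma lsub0 A : lsub A 0 = 0.
Proof. by rewrite /lsub raddf0. Qed.

Lemma lsubM A : {morph lsub A : p q / p * q}.
Proof. by move=> p q; rewrite /lsub rmorphM. Qed.

Lemma lsubZ A a p : lsub A (a *: p) = a *: lsub A p.
Proof. exact: comp_mpolyZ. Qed.

Lemma lsub_sum A (I : Type) (r : seq I) (P : pred I) (F : I -> {mpoly k[N]}) :
  lsub A (\sum_(i <- r | P i) F i) = \sum_(i <- r | P i) lsub A (F i).
Proof. by rewrite /lsub raddf_sum. Qed.

Lemma lsubC A a : lsub A a%:MP = a%:MP.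
Proof. exact: comp_mpolyC. Qed.

Lemma lsub_homog A p t : p \is t.-homog -> lsub A p \is t.-homog.
Proof.
move=> hp; rewrite /lsub comp_mpolyEX big_seq; apply: rpred_sum => m mp.
rewrite dhomogZ // comp_mpolyX -(dhomog_mf hp mp) /= mdegE.
apply: dhomog_big_prod => i; rewrite tnth_mktuple -[X in (X).-homog]mul1n.
apply: dhomogMn; apply: rpred_sum => j _.
by rewrite dhomogZ // dhomogX /= mdeg1.
Qed.

End LSub.

Definition polymp (k : fieldType) (T : finType) N (P : (T -> k) -> {mpoly k[N]}) :=
  forall m, polyf (fun v => (P v)@_m).

Section PolyMP.
Variables (k : fieldType) (T : finType) (N : nat).
Implicit Types P Q : (T -> k) -> {mpoly k[N]}.

Lemma polympC (p : {mpoly k[N]}) : polymp (fun _ : T -> k => p).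
Proof. by move=> m; apply: polyfC. Qed.

Lemma polympD P Q : polymp P -> polymp Q -> polymp (fun v => P v + Q v).
Proof.
by move=> hP hQ m; apply: (polyf_ext (polyfD (hP m) (hQ m))) => v; rewrite mcoeffD.
Qed.

Lemma polympZ f P : polyf f -> polymp P -> polymp (fun v => f v *: P v).
Proof.
by move=> hf hP m; apply: (polyf_ext (polyfM hf (hP m))) => v; rewrite mcoeffZ.
Qed.

Lemma polympM P Q : polymp P -> polymp Q -> polymp (fun v => P v * Q v).
Proof.
move=> hP hQ m.
pose b := (mdeg m).+1.
apply: (@polyf_ext k T (fun v => \sum_(q : 'X_{1..N < b, b}
    | m == (q.1 + q.2)%MM) (P v)@_q.1 * (Q v)@_q.2)).
  by apply: polyf_sum => q _; apply: polyfM; [apply: hP|apply: hQ].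
by move=> v; rewrite mcoeffM.
Qed.

Lemma polymp_sum (I : Type) (r : seq I) (S : pred I)
    (F : I -> (T -> k) -> {mpoly k[N]}) :
  (forall i, polymp (F i)) -> polymp (fun v => \sum_(i <- r | S i) F i v).
Proof.
move=> h m; apply: (@polyf_ext k T (fun v => \sum_(i <- r | S i) (F i v)@_m)).
  by apply: polyf_sum => i _; apply: h.
by move=> v; rewrite raddf_sum.
Qed.

Lemma polymp_exp P j : polymp P -> polymp (fun v => P v ^+ j).
Proof.
move=> hP; elim: j => [|j ih m]; first exact: polympC.
by apply: (polyf_ext (polympM hP ih m)) => v; rewrite exprS.
Qed.

Lemma polymp_prod (I : Type) (r : seq I) (F : I -> (T -> k) -> {mpoly k[N]}) :
  (forall i, polymp (F i)) -> polymp (fun v => \prod_(i <- r) F i v).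
Proof.
move=> h; elim: r => [|i r ih] m.
  by apply: (polyf_ext (polympC 1 m)) => v; rewrite big_nil.
by apply: (polyf_ext (polympM (h i) ih m)) => v; rewrite big_cons.
Qed.

Lemma polymp_lsub (C : 'I_N -> 'I_N -> (T -> k) -> k) P b :
    (forall i j, polyf (C i j)) -> polymp P ->
    (forall v, (msize (P v) <= b)%N) ->
  polymp (fun v => lsub (\matrix_(i, j) C i j v) (P v)).
Proof.
move=> hC hP hb m.
apply: (@polyf_ext k T (fun v => (\sum_(s : 'X_{1..N < b}) (P v)@_s *:
   \prod_i (\sum_j C i j v *: 'X_j) ^+ (s : 'X_{1..N}) i)@_m)); last first.
  move=> v; congr (mcoeff m _).
  rewrite /lsub {1}(mpolywE (hb v)) raddf_sum /=.
  apply: eq_bigr => s _; rewrite comp_mpolyZ comp_mpolyX; congr (_ *: _).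
  apply: eq_bigr => i _; rewrite tnth_mktuple; congr (_ ^+ _).
  by apply: eq_bigr => j _; rewrite mxE.
move: m; apply: polymp_sum => s; apply: polympZ; first exact: hP.
apply: polymp_prod => i; apply: polymp_exp; apply: polymp_sum => j.
by apply: polympZ; [apply: hC|apply: polympC].
Qed.

End PolyMP.

Section Coords.
Variables (k : closedFieldType) (n c : nat) (d : c.-tuple nat).
Implicit Types (F G : 'I_c -> {mpoly k[n.+1]}) (s : coord n d).

Definition cmon s : 'X_{1..n.+1} := val (tagged s).

Definition cf F s : k := (F (tag s))@_(cmon s).

Lemma mdeg_cmon s : mdeg (cmon s) = tnth d (tag s).
Proof. exact/eqP/(valP (tagged s)). Qed.

Lemma coord_inj s s' : tag s = tag s' -> cmon s = cmon s' -> s = s'.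
Proof.
case: s s' => [i m] [i' m'] /= e; case: _ / e in m' *; rewrite /cmon /= => e.
by congr Tagged; apply/val_inj/val_inj.
Qed.

Lemma coord_ex i (m : 'X_{1..n.+1}) :
  mdeg m = tnth d i -> exists s : coord n d, tag s = i /\ cmon s = m.
Proof.
move=> e; have lt : (mdeg m < (tnth d i).+1)%N by rewrite e.
have e' : mdeg (BMultinom lt) == tnth d i by rewrite /= e.
by exists (Tagged (fun i => {m : 'X_{1..n.+1 < (tnth d i).+1} | mdeg m == tnth d i})
  (exist _ (BMultinom lt) e')).
Qed.

Lemma form_sum F i (m : 'X_{1..n.+1}) : forms d F ->
  (\sum_(s : coord n d | tag s == i) cf F s *: 'X_[cmon s])@_m = (F i)@_m.
Proof.
move=> hF; rewrite raddf_sum /=; under eq_bigr => s _ do rewrite mcoeffZ mcoeffX.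
have [e|ne] := eqVneq (mdeg m) (tnth d i).
  have [s [si sm]] := coord_ex e.
  rewrite (bigD1 s) /= ?si // sm eqxx mulr1 /cf si sm big1 ?addr0 //.
  move=> s' /andP[/eqP s'i ne]; case: eqP => [e'|]; last by rewrite mulr0.
  by case/eqP: ne; apply: coord_inj; rewrite ?s'i ?si ?e' ?sm.
rewrite big1 ?(dhomog_nemf_coeff (hF i)) // => s /eqP si.
case: eqP => [e|]; last by rewrite mulr0.
by case/eqP: ne; rewrite -e mdeg_cmon si.
Qed.

Lemma form_sumE F i : forms d F ->
  F i = \sum_(s : coord n d | tag s == i) cf F s *: 'X_[cmon s].
Proof. by move=> hF; apply/mpolyP => m; rewrite form_sum. Qed.

Definition form_of (v : coord n d -> k) i : {mpoly k[n.+1]} :=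
  \sum_(s : coord n d | tag s == i) v s *: 'X_[cmon s].

Lemma form_of_forms v : forms d (form_of v).
Proof.
move=> i; apply: rpred_sum => s /eqP <-.
by rewrite dhomogZ // dhomogX /= mdeg_cmon.
Qed.

Lemma cf_form_of v s : cf (form_of v) s = v s.
Proof.
rewrite /cf /form_of raddf_sum /= (bigD1 s) //= mcoeffZ mcoeffX eqxx mulr1.
rewrite big1 ?addr0 // => s' /andP[/eqP e ne]; rewrite mcoeffZ mcoeffX.
case: eqP => [e'|]; last by rewrite mulr0.
by case/eqP: ne; apply: coord_inj.
Qed.

Definition thin_forms (B : ('I_c -> {mpoly k[n.+1]}) -> Prop) : Prop :=
  thin (fun v => exists F, [/\ forms d F, B F & forall s, v s = cf F s]).

Definition dmax := (\max_(i < c) tnth d i).+1.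

Lemma lt_dmax i : (tnth d i < dmax)%N.
Proof. by rewrite ltnS (leq_bigmax (F := fun i => tnth d i)). Qed.

(** The parameters are the entries of C in E, the coefficients in T and the u a;
    a triple (i, j, m) of A stands for the multiple 'X_[m] * G j added to G i. *)
Definition typed (E : {set 'I_n.+1 * 'I_n.+1}) (T : {set coord n d})
    (A : {set 'I_c * 'I_c * 'X_{1..n.+1 < dmax}})
    (F : 'I_c -> {mpoly k[n.+1]}) : Prop :=
  exists (C : 'M[k]_n.+1) (G : 'I_c -> {mpoly k[n.+1]})
         (u : 'I_c * 'I_c * 'X_{1..n.+1 < dmax} -> k),
  [/\ forall i j, (i, j) \notin E -> C i j = (i == j)%:R,
      forms d G, forall s, s \notin T -> cf G s = 0
    & forall i, F i = lsub C (G i + \sum_(a in A | a.1.1 == i)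
        u a *: ('X_[(a.2 : 'X_{1..n.+1})] * G a.1.2))].

(** The parameters of a type are fewer than the coefficients. *)
Lemma thin_typed (E : {set 'I_n.+1 * 'I_n.+1}) (T : {set coord n d})
    (A : {set 'I_c * 'I_c * 'X_{1..n.+1 < dmax}}) :
  (#|E| + #|A| < #|~: T|)%N -> thin_forms (typed E T A).
Proof.
move=> ltET.
pose J := ({p | p \in E} + ({s | s \in T} + {a | a \in A}))%type.
pose cE i j (v : J -> k) : k :=
  if insub (i, j) is Some p then v (inl p) else (i == j)%:R.
pose cT s (v : J -> k) : k :=
  if insub s is Some s' then v (inr (inl s')) else 0.
pose cA a (v : J -> k) : k :=
  if insub a is Some a' then v (inr (inr a')) else 0.
pose Gv (v : J -> k) i : {mpoly k[n.+1]} :=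
  \sum_(s : coord n d | tag s == i) cT s v *: 'X_[cmon s].
pose Hv (v : J -> k) i := Gv v i + \sum_(a in A | a.1.1 == i)
        cA a v *: ('X_[(a.2 : 'X_{1..n.+1})] * Gv v a.1.2).
pose g s (v : J -> k) := (lsub (\matrix_(i, j) cE i j v) (Hv v (tag s)))@_(cmon s).
have cEP i j : polyf (cE i j).
  by rewrite /cE; case: (insub _) => [p|]; [apply: polyfX|apply: polyfC].
have cTP s : polyf (cT s).
  by rewrite /cT; case: (insub _) => [p|]; [apply: polyfX|apply: polyfC].
have cAP a : polyf (cA a).
  by rewrite /cA; case: (insub _) => [p|]; [apply: polyfX|apply: polyfC].
have GvP i : polymp (fun v => Gv v i).
  by apply: polymp_sum => s; apply: polympZ; [apply: cTP|apply: polympC].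
have HvP i : polymp (fun v => Hv v i).
  apply: polympD; first exact: GvP.
  apply: polymp_sum => a; apply: polympZ; first exact: cAP.
  by apply: polympM; [apply: polympC|apply: GvP].
have Gvs v i : (msize (Gv v i) <= dmax)%N.
  apply: leq_trans (msize_sum _ _ _) _; apply/bigmax_leqP => s _.
  apply: leq_trans (msizeZ_le _ _) _; rewrite msizeX mdeg_cmon; exact: lt_dmax.
have Hvs v i : (msize (Hv v i) <= (dmax + dmax).+1)%N.
  apply: leq_trans (msizeD_le _ _) _; rewrite geq_max; apply/andP; split.
    by apply: leq_trans (Gvs _ _) _; lia.
  apply: leq_trans (msize_sum _ _ _) _; apply/bigmax_leqP => a _.
  apply: leq_trans (msizeZ_le _ _) _; apply: msizeM_leS.
    by rewrite msizeX ltnS ltnW // bmdeg.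
  exact: leq_trans (Gvs _ _) _.
apply: (@thin_image k (coord n d) J g); first 1 last.
- by move=> s; apply: (polymp_lsub (b := (dmax + dmax).+1)).
- move=> v [F [hF [C [G [u [CE hG GT FE]]]] vF]].
  pose w (x : J) : k := match x with
    | inl p => C (val p).1 (val p).2
    | inr (inl s) => cf G (val s)
    | inr (inr a) => u (val a) end.
  have wG i : Gv w i = G i.
    rewrite (form_sumE i hG); apply: eq_bigr => s _; congr (_ *: _).
    by rewrite /cT; case: insubP => [s' _ <- //|/GT].
  exists w => s; rewrite vF /cf FE /g; congr (mcoeff _ (lsub _ _)).
    apply/matrixP => i j; rewrite mxE /cE.
    by case: insubP => [p _ /= e|/CE //]; rewrite e.
  rewrite /Hv wG; congr (_ + _); apply: eq_bigr => a /andP[aA _].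
  by rewrite wG /cA insubT.
- rewrite !card_sum !card_sig.
  have <- : #|T| = #|[pred x in T]| by apply: eq_card => x; rewrite inE.
  have <- : #|E| = #|[pred x in E]| by apply: eq_card => x; rewrite inE.
  have <- : #|A| = #|[pred x in A]| by apply: eq_card => x; rewrite inE.
  rewrite -[X in (_ < X)%N](cardsC T).
  by rewrite addnCA ltn_add2l.
Qed.

End Coords.

(** * Smoothness of the general complete intersection *)

(** Suited to properties of multiplicative maps, unlike the induction on
    monomials. *)
Lemma mpoly_ring_ind (R : comNzRingType) N (P : {mpoly R[N]} -> Prop) :
    (forall a, P a%:MP) -> (forall i, P 'X_i) ->
    (forall p q, P p -> P q -> P (p + q)) ->
    (forall p q, P p -> P q -> P (p * q)) ->
  forall p, P p.
Proof.
move=> PC PX PD PM; have P0 : P 0 by rewrite -mpolyC0; apply: PC.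
have P1 : P 1 by rewrite -mpolyC1; apply: PC.
elim/mpolyind => [//|s m q _ _ ih].
apply: PD => //; rewrite -mul_mpolyC; apply: (PM) => //.
rewrite mpolyXE_id; apply: (big_ind P P1 PM) => i _.
by elim: (m i) => [|e ihe]; rewrite ?expr0 // exprS; apply: PM.
Qed.

Section FormFacts.
Variables (k : closedFieldType) (N : nat).
Implicit Types (p : {mpoly k[N]}) (a : 'I_N).

Lemma meval_scale p t (s : k) v : p \is t.-homog ->
  p.@[fun j => s * v j] = s ^+ t * p.@[v].
Proof.
move=> hp; rewrite !mevalE mulr_sumr big_seq [RHS]big_seq.
apply: eq_bigr => m mp; rewrite mulrCA; congr (_ * _).
under eq_bigr => i _ do rewrite exprMn.
by rewrite big_split /= prodrXr -(dhomog_mf hp mp) /= mdegE.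
Qed.

Lemma deriv_homog p t a : p \is t.-homog -> p^`M(a) \is t.-1.-homog.
Proof.
move=> hp; apply/dhomogP => m; rewrite mcoeff_msupp mcoeff_deriv => h.
have : (m + U_(a))%MM \in msupp p.
  by rewrite mcoeff_msupp; apply: contraNneq h => ->; rewrite mul0rn.
by move/(dhomog_mf hp) => /=; rewrite mdegD mdeg1 addn1 => <-.
Qed.

Lemma meval_unit_vector p t a : p \is t.-homog ->
  p.@[fun j => (j == a)%:R] = p@_(U_(a) *+ t)%MM.
Proof.
move=> hp; set m0 := (U_(a) *+ t)%MM.
have E (m : 'X_{1..N}) : mdeg m = t ->
    \prod_i (i == a)%:R ^+ m i = (m == m0)%:R :> k.
  move=> mt; case: eqP => [->|ne].
    apply: big1 => i _; rewrite mulmnE mnm1E eq_sym.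
    by case: eqP; rewrite ?expr1n // mul0n expr0.
  have [i /andP[ia mi]] : exists i, (i != a) && (m i != 0%N).
    have [/existsP//|] := boolP [exists i, (i != a) && (m i != 0%N)].
    rewrite negb_exists => /forallP h; case: ne.
    have z i : i != a -> m i = 0%N.
      by move=> ia; have := h i; rewrite ia /= negbK => /eqP.
    apply/mnmP => i; rewrite mulmnE mnm1E eq_sym.
    case: (eqVneq i a) => [->|/z ->]; last by rewrite mul0n.
    by rewrite mul1n -mt mdegE (bigD1 a) //= big1 ?addn0 // => j /z.
  by rewrite (bigD1 i) //= (negbTE ia) expr0n (negbTE mi) mul0r.
rewrite mevalE big_seq.
rewrite (eq_bigr (fun m => p@_m * (m == m0)%:R)); last first.
  by move=> m mp; rewrite E // (dhomog_mf hp mp).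
rewrite -big_seq; case: (boolP (m0 \in msupp p)) => [m0p|m0p].
  rewrite (bigD1_seq m0) ?msupp_uniq //= eqxx mulr1 big1 ?addr0 //.
  by move=> m /negbTE ->; rewrite mulr0.
rewrite (memN_msupp_eq0 m0p) big_seq big1 // => m mp.
by case: eqP => [e|]; [rewrite -e mp in m0p|rewrite mulr0].
Qed.

Lemma lsub_deriv (M : 'M[k]_N) p a :
  (lsub M p)^`M(a) = \sum_l M l a *: lsub M p^`M(l).
Proof.
pose Q p := (lsub M p)^`M(a) = \sum_l M l a *: lsub M p^`M(l).
have QD q r : Q q -> Q r -> Q (q + r).
  rewrite /Q => hq hr; rewrite lsubD mderivD hq hr -big_split /=.
  by apply: eq_bigr => l _; rewrite mderivD lsubD scalerDr.
have QM q r : Q q -> Q r -> Q (q * r).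
  rewrite /Q => hq hr; rewrite lsubM mderivM hq hr mulr_suml mulr_sumr -big_split /=.
  by apply: eq_bigr => l _; rewrite mderivM lsubD !lsubM scalerDr scalerAl scalerAr.
have QC s : Q s%:MP.
  rewrite /Q lsubC mderivC big1 // => l _.
  by rewrite mderivC lsub0 scaler0.
have QX j : Q 'X_j.
  rewrite /Q /lsub comp_mpolyXU -tnth_nth tnth_mktuple raddf_sum /=.
  rewrite (bigD1 a) //= [RHS](bigD1 j) //=.
  rewrite [X in _ + X]big1 ?addr0 ?[X in _ = _ + X]big1 ?addr0.
  - have z (i : 'I_N) : (U_(i) - U_(i) = 0)%MM by rewrite -{1}[U_(i)%MM]add0m addmK.
    by rewrite mderivZ !mderivX !mnm1E !eqxx !scale1r !z mpolyX0 comp_mpoly1.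
  - move=> l ne; rewrite mderivX mnm1E eq_sym (negbTE ne) scale0r.
    by rewrite comp_mpoly0 scaler0.
  - by move=> l ne; rewrite mderivZ mderivX mnm1E (negbTE ne) scale0r scaler0.
exact: (mpoly_ring_ind QC QX QD QM p).
Qed.

End FormFacts.

Lemma row_kernel_of_rank_lt (k : fieldType) (m N : nat) (J : 'M[k]_(m, N)) :
  (\rank J < m)%N -> exists2 u : 'rV_m, u != 0 & u *m J = 0.
Proof.
move=> lt; have : kermx J != 0 by rewrite -mxrank_eq0 mxrank_ker subn_eq0 -ltnNge.
by case/rowV0Pn=> u /sub_kermxP uJ u0; exists u.
Qed.

Lemma rV_neq0_coord (R : nmodType) N (u : 'rV[R]_N) :
  u != 0 -> exists i, u 0 i != 0.
Proof.
move=> u0; have [/existsP//|] := boolP [exists i, u 0 i != 0].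
rewrite negb_exists => /forallP h; case/eqP: u0.
by apply/rowP => i; rewrite mxE; apply/eqP; have := h i; rewrite negbK.
Qed.

Section Smooth.
Variables (k : closedFieldType) (n c : nat) (d : c.-tuple nat).
Hypothesis hd : forall i, (1 <= tnth d i)%N.
Implicit Types (F G : 'I_c -> {mpoly k[n.+1]}).

(** The types whose members have fewer parameters than a general tuple. *)
Definition small_type (F : 'I_c -> {mpoly k[n.+1]}) : Prop :=
  exists (E : {set 'I_n.+1 * 'I_n.+1}) (T : {set Defs.coord n d})
    (A : {set 'I_c * 'I_c * 'X_{1..n.+1 < dmax d}}),
  (#|E| + #|A| < #|~: T|)%N /\ typed E T A F.

(** There are finitely many types. *)
Lemma thin_small_type : thin_forms d small_type.
Proof.
pose TT := ({set 'I_n.+1 * 'I_n.+1} * {set Defs.coord n d} *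
  {set 'I_c * 'I_c * 'X_{1..n.+1 < dmax d}})%type.
have h (t : TT) : thin (fun v : Defs.coord n d -> k =>
    (#|t.1.1| + #|t.2| < #|~: t.1.2|)%N /\
    exists F, [/\ forms d F, typed t.1.1 t.1.2 t.2 F & forall s, v s = cf F s]).
  apply: thin_and; last exact: decP idP.
  exact: thin_typed.
apply: (thin_sub (thin_exists h)) => v [F [hF [E [T [A [lt ty]]]] vF]].
by exists (E, T, A); split => //; exists F.
Qed.

(** Moving the singular point to a coordinate point, and adding multiples of
    the other equations to one of maximal degree in the relation between the
    gradients, kills one coefficient per equation and n further ones. The point
    has n parameters and the relation c - 1. *)
Lemma singular_small_type F (x : 'cV[k]_n.+1) :
  forms d F -> zeros F x -> \rank (jacobian F x) != c -> small_type F.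
Proof.
move=> hF [x0 xF] rk.
have {rk} lt : (\rank (jacobian F x) < c)%N.
  by rewrite ltn_neqAle rk rank_leq_row.
have [l l0 lJ] := row_kernel_of_rank_lt lt.
have [a xa] : exists a, x a 0 != 0.
  have [|a h] := @rV_neq0_coord _ _ x^T; first by rewrite trmx_eq0.
  by exists a; rewrite mxE in h.
have [i0 li0] := rV_neq0_coord l0.
pose y : 'cV[k]_n.+1 := \col_i (x i 0 / x a 0).
pose w : 'cV[k]_n.+1 := \col_i (if i == a then 0 else x i 0 / x a 0).
pose ea : 'rV[k]_n.+1 := delta_mx 0 a.
have eaw : ea *m w = 0.
  by apply/matrixP => i j; rewrite !ord1 -rowE !mxE eqxx.
pose C := 1%:M - w *m ea; pose D := 1%:M + w *m ea.
have DC : D *m C = 1%:M.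
  rewrite /D /C mulmxDl mul1mx mulmxBr mulmx1.
  rewrite [w *m ea *m _]mulmxA -(mulmxA w ea w) eaw mulmx0 mul0mx subr0.
  by rewrite subrK.
have Dy : D *m ea^T = y.
  rewrite /D mulmxDl mul1mx -mulmxA [ea *m _]mx11_scalar.
  have -> : (ea *m ea^T) 0 0 = 1.
    by rewrite -rowE !mxE !eqxx.
  rewrite mulmx1; apply/colP => i; rewrite !mxE eqxx /=.
  by case: eqP => [->|_]; rewrite ?addr0 ?add0r ?divff.
pose G i := lsub D (F i).
have hG : forms d G by move=> i; apply: lsub_homog.
have FG i : F i = lsub C (G i) by rewrite lsub_comp DC lsub1.
have eaE (p : {mpoly k[n.+1]}) :
    p.@[fun j => (j == a)%:R] = p.@[fun j => ea^T j 0].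
  by apply: meval_eq => j; rewrite !mxE eqxx.
have Ga i : (G i)@_(U_(a) *+ tnth d i)%MM = 0.
  rewrite -(meval_unit_vector a (hG i)) eaE /G lsub_meval Dy.
  have -> : (F i).@[fun i => y i 0] = (F i).@[fun j => (x a 0)^-1 * x j 0].
    by apply: meval_eq => j; rewrite mxE mulrC.
  by rewrite (meval_scale _ _ (hF i)) xF mulr0.
pose mu i := l 0 i * x a 0 ^+ (tnth d i).-1.
have muJ j : \sum_i mu i * ((F i)^`M(j)).@[fun i => y i 0] = 0.
  have : (l *m jacobian F x) 0 j = 0 by rewrite lJ mxE.
  rewrite mxE => h; rewrite -[RHS]h; apply: eq_bigr => i _; rewrite mxE -mulrA; congr (_ * _).
  rewrite -(meval_scale _ _ (deriv_homog j (hF i))).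
  by apply: meval_eq => s; rewrite mxE mulrC divfK.
have muG j : \sum_i mu i * (G i)@_(U_(a) *+ (tnth d i).-1 + U_(j))%MM
    *+ ((U_(a) *+ (tnth d i).-1)%MM j).+1 = 0.
  transitivity (\sum_i mu i * ((G i)^`M(j)).@[fun j => (j == a)%:R]).
    apply: eq_bigr => i _.
    by rewrite (meval_unit_vector a (deriv_homog j (hG i))) mcoeff_deriv mulrnAr.
  under eq_bigr => i _ do rewrite /G lsub_deriv raddf_sum mulr_sumr /=.
  rewrite exchange_big big1 //= => q _.
  under eq_bigr => i _ do rewrite mevalZ eaE lsub_meval Dy mulrCA.
  by rewrite -mulr_sumr muJ mulr0.
have [b mub bmax] : exists2 b, mu b != 0 &
    forall i, mu i != 0 -> (tnth d i <= tnth d b)%N.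
  have h : mu i0 != 0 by rewrite mulf_neq0 // expf_neq0.
  by case: (@arg_maxnP _ i0 (fun i => mu i != 0) (fun i => tnth d i) h) => b hb hmax; exists b.
have db : (tnth d b = (tnth d b).-1.+1)%N by rewrite prednK.
have Mlt i : (mdeg (U_(a) *+ (tnth d b - tnth d i))%MM < dmax d)%N.
  rewrite mdegMn mdeg1 mul1n; apply: leq_ltn_trans (lt_dmax d b); exact: leq_subr.
pose M i : 'X_{1..n.+1 < dmax d} := BMultinom (Mlt i).
pose Gb := \sum_i (mu i / mu b) *: ('X_[M i] * G i).
pose G' i := if i == b then Gb else G i.
pose E := [set (lift a j, a) | j : 'I_n].
pose A : {set 'I_c * 'I_c * 'X_{1..n.+1 < dmax d}} :=
  [set (b, i, M i) | i in [set~ b]].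
pose P (s : Defs.coord n d) := (cmon s == U_(a) *+ tnth d (tag s))%MM ||
  (tag s == b) && [exists j, cmon s == (U_(a) *+ (tnth d b).-1 + U_(j))%MM].
exists E, [set s | ~~ P s], A; split.
  have cE : (#|E| <= n)%N by rewrite -[X in (_ <= X)%N]card_ord leq_imset_card.
  have cA : (#|A| <= c.-1)%N.
    apply: leq_trans (leq_imset_card _ _) _.
    by rewrite cardsC1 card_ord.
  have : (c + n <= #|~: [set s | ~~ P s]|)%N.
    have /fin_all_exists[f1 f1P] : forall i, exists s : Defs.coord n d,
        tag s = i /\ cmon s = (U_(a) *+ tnth d i)%MM.
      by move=> i; apply: coord_ex; rewrite mdegMn mdeg1 mul1n.
    have /fin_all_exists[f2 f2P] : forall j : 'I_n, exists s : Defs.coord n d,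
        tag s = b /\ cmon s = (U_(a) *+ (tnth d b).-1 + U_(lift a j))%MM.
      move=> j; apply: coord_ex.
      by rewrite mdegD mdegMn !mdeg1 mul1n addn1 -db.
    pose f (z : 'I_c + 'I_n) := match z with inl i => f1 i | inr j => f2 j end.
    have fI : injective f.
      have neq i j : f1 i <> f2 j.
        move=> e; have /mnmP/(_ (lift a j)) := etrans (esym (f1P i).2) (etrans (congr1 (@cmon _ _ _) e) (f2P j).2).
        by rewrite mnmDE !mulmnE !mnm1E eqxx (negbTE (neq_lift _ _)) !mul0n.
      move=> [i|j] [i'|j'] //= e.
      - by rewrite -(f1P i).1 e (f1P i').1.
      - by case: (neq _ _ e).
      - by case: (neq _ _ (esym e)).
      - have := etrans (esym (f2P j).2) (etrans (congr1 (@cmon _ _ _) e) (f2P j').2).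
        by move/addmI/eqP; rewrite eq_mnm1 => /eqP/lift_inj ->.
    rewrite -[X in (X <= _)%N](_ : #|[set: 'I_c + 'I_n]| = _); last first.
      by rewrite cardsT card_sum !card_ord.
    rewrite -(card_imset _ fI); apply: subset_leq_card.
    apply/subsetP => _ /imsetP[[i|j] _ ->]; rewrite !inE negbK /P /=.
      by rewrite (f1P i).1 (f1P i).2 eqxx.
    by rewrite (f2P j).1 eqxx; apply/orP; right; apply/existsP; exists (lift a j);
       rewrite (f2P j).2.
  have := ltn_ord b; move: cE cA; set e := #|E|; set a' := #|A|; lia.
have G'b : Gb = G b + \sum_(i in [set~ b]) (mu i / mu b) *: ('X_[M i] * G i).
  rewrite /Gb (bigD1 b) //= divff // scale1r subnn mulm0n mpolyX0 mul1r.
  by congr (_ + _); apply: eq_bigl => i; rewrite !inE.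
have hGb : Gb \is (tnth d b).-homog.
  apply: rpred_sum => i _; have [->|mi] := eqVneq (mu i) 0.
    by rewrite mul0r scale0r dhomog0.
  rewrite dhomogZ // -[X in (X).-homog](subnK (bmax _ mi)).
  by apply: dhomogM => //; rewrite dhomogX /= mdegMn mdeg1 mul1n.
exists C, G', (fun z => - (mu z.1.2 / mu b)); split.
- move=> i j; case: (unliftP a i) => [i' ->|->] nE.
    have ja : j != a.
      by apply: contraNneq nE => ->; apply/imsetP; exists i'.
    rewrite !mxE big_ord1 !mxE (negbTE ja) /=.
    by rewrite mulr0 subr0.
  by rewrite !mxE big_ord1 !mxE eqxx mul0r subr0.
- by move=> i; rewrite /G'; case: eqP => [->|].
- move=> s; rewrite inE negbK /P /cf /G'; set m := cmon s.
  case: (eqVneq (tag s) b) => [sb|nsb] /=; last by rewrite orbF => /eqP ->.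
  rewrite sb => hs.
  have hs' : exists j, m = (U_(a) *+ (tnth d b).-1 + U_(j))%MM.
    case/orP: hs => [/eqP e|/existsP[j /eqP ->]]; last by exists j.
    by exists a; rewrite e [in LHS]db mulmSr.
  have cE i : mu i != 0 -> forall j,
      ('X_[M i] * G i)@_(U_(a) *+ (tnth d b).-1 + U_(j))%MM =
      (G i)@_(U_(a) *+ (tnth d i).-1 + U_(j))%MM.
    move=> mi j; rewrite mulrC.
    have -> : (U_(a) *+ (tnth d b).-1 + U_(j) =
               U_(a) *+ (tnth d b - tnth d i) + (U_(a) *+ (tnth d i).-1 + U_(j)))%MM.
      apply/mnmP => t; rewrite !mnmDE !mulmnE addnA -mulnDr; congr (_ * _ + _)%N.
      by have := bmax _ mi; have := hd i; lia.
    by rewrite mcoeffMX.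
  have [j mj] := hs'; rewrite mj raddf_sum /=.
  case: (eqVneq j a) => [->|ja].
    rewrite big1 // => i _; rewrite mcoeffZ.
    have [->|mi] := eqVneq (mu i) 0; first by rewrite mul0r mul0r.
    by rewrite cE // -mulmSr prednK // Ga mulr0.
  rewrite -[RHS](mulr0 (mu b)^-1) -[X in _ = _ * X](muG j) mulr_sumr.
  apply: eq_bigr => i _; rewrite mcoeffZ.
  have [->|mi] := eqVneq (mu i) 0; first by rewrite !mul0r mul0rn mulr0.
  rewrite cE // mulmnE mnm1E eq_sym (negbTE ja) mul0n mulr1n mulrA.
  by rewrite [mu i / _]mulrC.
- move=> i; rewrite FG; congr lsub; rewrite /G'.
  case: (eqVneq i b) => [->|ib]; last first.
    rewrite big1 ?addr0 // => z /andP[/imsetP[j _ ->] /eqP /= e].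
    by rewrite e eqxx in ib.
  rewrite G'b (eq_bigl (mem A)); last first.
    move=> z; rewrite andb_idr // => /imsetP[j _ ->] /=; exact: eqxx.
  rewrite big_imset /=; last by move=> j j' _ _ [].
  rewrite -addrA -big_split /= big1 ?addr0 // => j.
  by rewrite !inE => jb; rewrite (negbTE jb) -scalerDl subrr scale0r.
Qed.

End Smooth.

(** * Finite-dimensional quotients of polynomial rings *)

Lemma restricted_eigenvector (k : closedFieldType) N (W A : 'M[k]_N) :
    W != 0 -> stablemx W A ->
  exists a, (W :&: eigenspace A a)%MS != 0.
Proof.
move=> W0 WA.
have rW : (0 < \rank W)%N by rewrite lt0n mxrank_eq0.
have [a ea] : exists a, eigenvalue (restrictmx W A) a.
  have : size (char_poly (restrictmx W A)) != 1%N.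
    by rewrite size_char_poly; case: (\rank W) rW.
  by case/closed_rootP=> a; rewrite -eigenvalue_root_char; exists a.
exists a; case/eigenvalueP: ea => v vA v0.
have st : stablemx (row_base W) A by rewrite stablemx_row_base.
apply/rowV0Pn; exists (v *m row_base W); last first.
  apply: contraNneq v0 => /(congr1 (mulmxr (pinvmx (row_base W)))) /=.
  by rewrite mulmxKp ?row_base_free // mul0mx => ->.
rewrite sub_capmx (submx_trans (submxMl _ _)) ?eq_row_base //=.
rewrite -sub_eigenspace_conjmx ?row_base_free //.
by apply/eigenspaceP.
Qed.

Lemma common_eigenvector (k : closedFieldType) N (r : seq 'M[k]_N) (W : 'M[k]_N) :
    W != 0 -> {in r, forall A, stablemx W A} -> {in r &, forall A B, comm_mx A B} ->
  exists v : 'rV[k]_N, [/\ v != 0, (v <= W)%MS &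
    {in r, forall A, exists a, v *m A = a *: v}].
Proof.
elim: r W => [|A r ih] W W0 st cm.
  by case/rowV0Pn: W0 => v vW v0; exists v; split.
have [a Wa] := restricted_eigenvector W0 (st A (mem_head _ _)).
have ir B : B \in r -> B \in A :: r by rewrite inE orbC => ->.
have [||v [v0 vW vr]] := ih _ Wa.
- move=> B Br; rewrite sub_capmx; apply/andP; split.
    by apply: submx_trans (st B (ir _ Br)); apply/submxMr/capmxSl.
  apply: (submx_trans (submxMr B (capmxSr W (eigenspace A a)))).
  by apply: comm_mx_stable_eigenspace; apply: cm; rewrite ?mem_head ?ir.
- by move=> B B' Br B'r; apply: cm; apply: ir.
exists v; split => //; first exact: submx_trans vW (capmxSl _ _).
move=> B; rewrite inE => /orP[/eqP ->|]; last exact: vr.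
by exists a; apply/eigenspaceP; apply: submx_trans vW (capmxSr _ _).
Qed.

Lemma mxtrace_eq0_of_eigenvalues (k : closedFieldType) N (A : 'M[k]_N) :
  (forall a, eigenvalue A a -> a = 0) -> \tr A = 0.
Proof.
case: N A => [|N] A h; first by rewrite /mxtrace big_ord0.
have [r] := closed_field_poly_normal (char_poly A).
have /monicP -> := char_poly_monic A; rewrite scale1r => rE.
have r0 : {in r, forall z, z = 0}.
  by move=> z zr; apply: h; rewrite eigenvalue_root_char rE root_prod_XsubC.
have {}rE : char_poly A = 'X^(size r).
  rewrite rE big_seq (eq_bigr (fun=> 'X)) -?big_seq; last first.
    by move=> z /r0 ->; rewrite subr0.
  by rewrite big_const_seq count_predT -Monoid.iteropE.
have sz : size r = N.+1.
  by apply/eq_add_S; rewrite -(size_char_poly A) rE size_polyXn.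
apply: oppr_inj; rewrite -char_poly_trace // rE sz coefXn oppr0.
by rewrite ltn_eqF.
Qed.

(** M stands for the multiplication on a finite-dimensional quotient ring. *)
Section FiniteQuotient.
Variables (k : closedFieldType) (N m : nat) (M : {mpoly k[N]} -> 'M[k]_m).
Hypothesis M1 : M 1 = 1%:M.
Hypothesis ML : forall a p q, M (a *: p + q) = a *: M p + M q.
Hypothesis MM : forall p q, M (p * q) = M p *m M q.

(** A common eigenvector of the coordinate functions is one of every element
    of the algebra, and its eigenvalues are the coordinates of a point. *)
Lemma quotient_point (W : 'M[k]_m) : W != 0 -> (forall p, stablemx W (M p)) ->
  exists x : 'I_N -> k, exists v : 'rV[k]_m,
    [/\ v != 0, (v <= W)%MS & forall p, v *m M p = p.@[x] *: v].
Proof.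
move=> W0 WM.
have [||v [v0 vW vX]] := @common_eigenvector _ _ [seq M 'X_i | i : 'I_N] W W0.
- by move=> A /codomP[i ->].
- move=> A B /codomP[i ->] /codomP[j ->].
  by rewrite /comm_mx -!MM mulrC.
have /fin_all_exists[x xP] : forall i : 'I_N, exists a, v *m M 'X_i = a *: v.
  by move=> i; apply: vX; apply: codom_f.
exists x, v; split => //.
have MD p q : M (p + q) = M p + M q by have := ML 1 p q; rewrite !scale1r.
have M0 : M 0 = 0 by apply: (addIr (M 0)); rewrite -MD !add0r.
apply: mpoly_ring_ind => [a|i|p q hp hq|p q hp hq].
- rewrite mevalC -alg_mpolyC; have := ML a 1 0; rewrite M0 !addr0 => ->.
  by rewrite M1 -scalemxAr mulmx1.
- by rewrite mevalXU.
- by rewrite MD mulmxDr hp hq mevalD scalerDl.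
- by rewrite MM mulmxA hp -scalemxAl hq mevalM scalerA.
Qed.

(** The only eigenvalue of M f is 0: an eigenvector may be chosen common to the
    whole algebra, and its eigenvalue is then the value of f at a common zero of
    the kernel of M. *)
Lemma quotient_trace_eq0 f :
    (forall x, (forall g, M g = 0 -> g.@[x] = 0) -> f.@[x] = 0) ->
  \tr (M f) = 0.
Proof.
move=> fz; apply: mxtrace_eq0_of_eigenvalues => a /eigenvalueP[w wa w0].
have W0 : eigenspace (M f) a != 0.
  by apply/rowV0Pn; exists w => //; apply/eigenspaceP.
have [|x [v [v0 vW vM]]] := quotient_point W0.
  by move=> p; apply: comm_mx_stable_eigenspace; rewrite /comm_mx -!MM mulrC.
have <- : f.@[x] = a.
  move/eigenspaceP: vW; rewrite vM => /eqP; rewrite -subr_eq0 -scalerBl.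
  by rewrite scaler_eq0 (negbTE v0) orbF subr_eq0 => /eqP.
apply: fz => g Mg; have := vM g; rewrite Mg mulmx0 => /esym/eqP.
by rewrite scaler_eq0 (negbTE v0) orbF => /eqP.
Qed.

End FiniteQuotient.

(** * Normal forms modulo general equations *)

Lemma msize_homog (R : comNzRingType) N (p : {mpoly R[N]}) t :
  p \is t.-homog -> (msize p <= t.+1)%N.
Proof.
move=> hp; have [->|ne] := eqVneq p 0; first by rewrite msize0.
by rewrite -mlead_deg // (dhomog_mf hp) ?mlead_supp.
Qed.

Section LinearExtension.
Variables (k : fieldType) (N : nat) (phi : 'X_{1..N} -> {mpoly k[N]}).

Definition lext (p : {mpoly k[N]}) := \sum_(m <- msupp p) p@_m *: phi m.

Lemma lextw b p : (msize p <= b)%N ->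
  lext p = \sum_(m : 'X_{1..N < b}) p@_m *: phi m.
Proof.
move=> le; rewrite {1}/lext.
transitivity (\sum_(m : 'X_{1..N < b} | (m : 'X_{1..N}) \in msupp p) p@_m *: phi m);
  last first.
  rewrite [RHS](bigID (fun m : 'X_{1..N < b} => (m : 'X_{1..N}) \in msupp p)) /=.
  by rewrite [X in _ = _ + X]big1 ?addr0 // => m /memN_msupp_eq0 ->; rewrite scale0r.
rewrite -(big_map (@bmnm N b) (fun m => m \in msupp p) (fun m => p@_m *: phi m)).
rewrite -big_filter; apply: perm_big; apply: uniq_perm.
- exact: msupp_uniq.
- by rewrite filter_uniq // map_inj_uniq ?index_enum_uniq //; apply: val_inj.
move=> m; rewrite mem_filter; case mp: (m \in msupp p) => //=.
apply/esym/mapP; exists (BMultinom (leq_trans (msize_mdeg_lt mp) le)) => //.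
exact: mem_index_enum.
Qed.

Lemma lextL a p q : lext (a *: p + q) = a *: lext p + lext q.
Proof.
pose b := maxn (msize p) (msize q).
have hp : (msize p <= b)%N by rewrite leq_maxl.
have hq : (msize q <= b)%N by rewrite leq_maxr.
have hs : (msize (a *: p + q) <= b)%N.
  apply: leq_trans (msizeD_le _ _) _; rewrite geq_max hq andbT.
  exact: leq_trans (msizeZ_le _ _) hp.
rewrite (lextw hp) (lextw hq) (lextw hs) scaler_sumr -big_split /=.
by apply: eq_bigr => m _; rewrite mcoeffD mcoeffZ scalerDl scalerA.
Qed.

Lemma lextX m : lext 'X_[m] = phi m.
Proof. by rewrite /lext msuppX big_seq1 mcoeffX eqxx scale1r. Qed.

Lemma lext0 : lext 0 = 0.
Proof. by rewrite /lext msupp0 big_nil. Qed.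

Lemma lextD p q : lext (p + q) = lext p + lext q.
Proof. by have := lextL 1 p q; rewrite !scale1r. Qed.

Lemma lextZ a p : lext (a *: p) = a *: lext p.
Proof. by have := lextL a p 0; rewrite lext0 !addr0. Qed.

Lemma lext_sum (I : Type) (r : seq I) (P : pred I) (G : I -> {mpoly k[N]}) :
  lext (\sum_(i <- r | P i) G i) = \sum_(i <- r | P i) lext (G i).
Proof. by apply: (big_morph lext lextD lext0). Qed.

Lemma lext_eq (g : {mpoly k[N]} -> {mpoly k[N]}) p :
    (forall a p q, g (a *: p + q) = a *: g p + g q) ->
    {in msupp p, forall m, g 'X_[m] = phi m} ->
  g p = lext p.
Proof.
move=> gL gX.
have g0 : g 0 = 0 by have := gL (-1) 0 0; rewrite !scaleN1r !addNr.
have gs (r : seq 'X_{1..N}) : {subset r <= msupp p} ->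
    g (\sum_(m <- r) p@_m *: 'X_[m]) = \sum_(m <- r) p@_m *: phi m.
  elim: r => [|m r ih] sub; first by rewrite !big_nil.
  rewrite !big_cons gL gX ?sub ?mem_head // ih // => x xr.
  by rewrite sub // inE xr orbT.
by rewrite {1}(mpolyE p) gs.
Qed.

Definition lextmx b : 'M[k]_#|{: 'X_{1..N < b}}| :=
  \matrix_(i, j) (phi (enum_val i : 'X_{1..N < b}))@_(enum_val j : 'X_{1..N < b}).

Definition coefrow b (p : {mpoly k[N]}) : 'rV[k]_#|{: 'X_{1..N < b}}| :=
  \row_j p@_(enum_val j : 'X_{1..N < b}).

Lemma lextmxE b p : (msize p <= b)%N ->
  coefrow b p *m lextmx b = coefrow b (lext p).
Proof.
move=> le; apply/rowP => j; rewrite !mxE (lextw le) raddf_sum /=.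
rewrite [RHS](reindex (fun i : 'I_#|{: 'X_{1..N < b}}| => enum_val i)) /=.
  by apply: eq_bigr => i _; rewrite !mxE mcoeffZ.
by exists enum_rank => x _; rewrite ?enum_valK ?enum_rankK.
Qed.

Lemma coefrow_inj b p q : (msize p <= b)%N -> (msize q <= b)%N ->
  coefrow b p = coefrow b q -> p = q.
Proof.
move=> hp hq /rowP e; apply/mpolyP => m.
have [lt|ge] := ltnP (mdeg m) b.
  by have := e (enum_rank (BMultinom lt)); rewrite !mxE enum_rankK.
by rewrite !memN_msupp_eq0 // msize_mdeg_ge // (leq_trans _ ge).
Qed.

Hypothesis phiH : forall m, phi m \is (mdeg m).-homog.

Lemma lext_pihomog t p : lext (pihomog mdeg t p) = pihomog mdeg t (lext p).
Proof.
rewrite pihomogE lext_sum [in RHS]/lext raddf_sum /= big_mkcond /=; apply: eq_bigr => m _.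
rewrite linearZ /=; case: eqP => [<-|/eqP ne].
  by rewrite lextZ lextX pihomog_dE.
by rewrite (pihomog_ne0 _ (phiH m)) ?scaler0 // eq_sym.
Qed.

Lemma msize_lext p : (msize (lext p) <= msize p)%N.
Proof.
apply: leq_trans (msize_sum _ _ _) _; apply/bigmax_leqP_seq => m mp _.
apply: leq_trans (msizeZ_le _ _) _.
by apply: leq_trans (msize_homog (phiH m)) (msize_mdeg_lt mp).
Qed.

(** In each degree the extension is an endomorphism of a finite-dimensional
    space, so that surjectivity forces injectivity. *)
Lemma lextmx_unit b : (forall m, exists p, lext p = 'X_[m]) ->
  lextmx b \in unitmx.
Proof.
move=> surj.
have /fin_all_exists[q qP] (i : 'I_#|{: 'X_{1..N < b}}|) :
    exists q, (msize q <= b)%N /\ lext q = 'X_[enum_val i : 'X_{1..N < b}].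
  set m := (enum_val i : 'X_{1..N < b}); have [p pm] := surj m.
  exists (pihomog mdeg (mdeg m) p); split; last first.
    by rewrite lext_pihomog pm pihomog_dE // dhomogX.
  by apply: leq_trans (msize_homog (pihomogP _ _ _)) (bmdeg _).
pose C := \matrix_i coefrow b (q i).
suff /mulmx1_unit[] : C *m lextmx b = 1%:M by [].
apply/row_matrixP => i; rewrite row_mul rowK (lextmxE (qP i).1) (qP i).2.
apply/rowP => j; rewrite !mxE mcoeffX.
by rewrite -bmeqP (inj_eq enum_val_inj).
Qed.

Lemma lext_inj_of_unit p q : (forall b, lextmx b \in unitmx) ->
  lext p = lext q -> p = q.
Proof.
move=> u e; pose b := maxn (msize p) (msize q).
apply: (@coefrow_inj b); rewrite ?leq_maxl ?leq_maxr //.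
apply: (can_inj (mulmxK (u b))).
by rewrite !lextmxE ?leq_maxl ?leq_maxr // e.
Qed.

Definition lext_inv b p : {mpoly k[N]} :=
  \sum_j (coefrow b p *m invmx (lextmx b)) 0 j *: 'X_[(enum_val j : 'X_{1..N < b})].

Lemma lext_invK b p : lextmx b \in unitmx -> (msize p <= b)%N ->
  (msize (lext_inv b p) <= b)%N /\ lext (lext_inv b p) = p.
Proof.
move=> u le; have hp : (msize (lext_inv b p) <= b)%N.
  apply: leq_trans (msize_sum _ _ _) _; apply/bigmax_leqP => j _.
  by apply: leq_trans (msizeZ_le _ _) _; rewrite msizeX bmdeg.
split=> //; apply: (@coefrow_inj b) => //; first exact: leq_trans (msize_lext _) hp.
rewrite -lextmxE // -[RHS](mulmxKV u); congr (_ *m _).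
apply/rowP => j; rewrite mxE raddf_sum /= (bigD1 j) //= mcoeffZ mcoeffX eqxx mulr1.
rewrite big1 ?addr0 // => i ne; rewrite mcoeffZ mcoeffX -bmeqP.
by rewrite (inj_eq enum_val_inj) (negbTE ne) mulr0.
Qed.

End LinearExtension.

Section NormalForm.
Variables (k : closedFieldType) (n c : nat) (d : c.-tuple nat).
Hypothesis hcn : (c <= n)%N.
Implicit Types (m : 'X_{1..n.+1}) (f g r : {mpoly k[n.+1]}).

(** The other n - c + 1 variables will be parameters, over which the coordinate
    ring is free. *)
Definition zi (i : 'I_c) : 'I_n.+1 := widen_ord (leqW hcn) i.

Lemma zi_inj : injective zi.
Proof. by move=> i j /(congr1 val) /= /val_inj. Qed.

Definition nrm (j : nat) m := [forall i : 'I_c, (i < j)%N ==> (m (zi i) < tnth d i)%N].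

Lemma nrmP j m :
  reflect (forall i : 'I_c, (i < j)%N -> (m (zi i) < tnth d i)%N) (nrm j m).
Proof.
apply: (iffP forallP) => h i; first by move/implyP: (h i).
by apply/implyP; apply: h.
Qed.

Definition dz i : 'X_{1..n.+1} := (U_(zi i) *+ tnth d i)%MM.

Lemma dz_zi i l : dz i (zi l) = if i == l then tnth d i else 0%N.
Proof.
by rewrite /dz mulmnE mnm1E (inj_eq zi_inj); case: eqP; rewrite ?mul1n ?mul0n.
Qed.

Lemma mdeg_dz i : mdeg (dz i) = tnth d i.
Proof. by rewrite mdegMn mdeg1 mul1n. Qed.

Lemma dz_le i m : (tnth d i <= m (zi i))%N -> (m - dz i + dz i = m)%MM.
Proof.
move=> le; apply: submK; apply/mnm_lepP => l; rewrite mulmnE mnm1E.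
by case: eqP => [<-|_]; rewrite ?mul1n ?mul0n.
Qed.

Definition lead (j : nat) m : option 'I_c :=
  [pick i : 'I_c | [&& (i < j)%N, (tnth d i <= m (zi i))%N & nrm i m]].

Lemma lead_none j m : (j <= c)%N -> lead j m = None -> nrm j m.
Proof.
move=> jc; rewrite /lead; case: pickP => // h _.
have H l : (l <= j)%N -> nrm l m.
  elim: l => [|l ih] lj; first by apply/nrmP.
  apply/nrmP => i; rewrite ltnS leq_eqVlt => /orP[/eqP il|].
    have := h i; rewrite il lj ih ?(ltnW lj) // andbT /= leqNgt.
    by move/negbT; rewrite negbK.
  by move/nrmP: (ih (ltnW lj)); apply.
exact: H.
Qed.

Lemma lead_nrm j m : nrm j m -> lead j m = None.
Proof.
move=> /nrmP h; rewrite /lead; case: pickP => // i /and3P[ij le _].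
by have := h i ij; rewrite ltnNge le.
Qed.

Lemma nrm_add_dz (i : 'I_c) l m : (l <= i)%N -> nrm l (m + dz i)%MM = nrm l m.
Proof.
move=> li; have e (t : 'I_c) : (t < l)%N -> (m + dz i)%MM (zi t) = m (zi t).
  move=> tl; rewrite mnmDE dz_zi; case: eqP => [e|]; last by rewrite addn0.
  by move: tl; rewrite -e ltnNge li.
by apply/nrmP/nrmP => h t tl; have := h t tl; rewrite e.
Qed.

Lemma lead_some j (i : 'I_c) m : (i < j)%N -> nrm i m -> lead j (m + dz i)%MM = Some i.
Proof.
move=> ij im; rewrite /lead; case: pickP => [l /and3P[lj le nl]|/(_ i)]; last first.
  by rewrite ij nrm_add_dz // im mnmDE dz_zi eqxx leq_addl.
congr Some; apply/val_inj/eqP; rewrite eqn_leq; apply/andP; split; rewrite leqNgt.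
  apply/negP => il; have /nrmP/(_ _ il) := nl.
  by rewrite mnmDE dz_zi eqxx ltnNge leq_addl.
apply/negP => li; move/nrmP: im => /(_ _ li).
rewrite ltnNge; move: le; rewrite mnmDE dz_zi.
by case: eqP => [e|_]; [rewrite e ltnn in li|rewrite addn0 => ->].
Qed.

Definition nrmp j r := {in msupp r, forall m, nrm j m}.

Lemma nrmp0 j : nrmp j 0.
Proof. by move=> m; rewrite msupp0. Qed.

Lemma nrmpD j f g : nrmp j f -> nrmp j g -> nrmp j (f + g).
Proof. by move=> hf hg m /msuppD_le; rewrite mem_cat => /orP[/hf|/hg]. Qed.

Lemma nrmpZ j a f : nrmp j f -> nrmp j (a *: f).
Proof. by move=> hf m /msuppZ_le/hf. Qed.

Lemma nrmpX j m : nrm j m -> nrmp j 'X_[m].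
Proof. by move=> h m'; rewrite msuppX inE => /eqP ->. Qed.

Variable F : 'I_c -> {mpoly k[n.+1]}.
Hypothesis FH : forms d F.

(** A comparison map: for F_i = z_i ^ d_i it is the identity, so that its linear
    extension is bijective for general F, while its values on the monomials that
    are not normal lie in the ideal. *)
Definition phi j m : {mpoly k[n.+1]} :=
  if lead j m is Some i then F i * 'X_[m - dz i] else 'X_[m].

Lemma phi_homog j m : phi j m \is (mdeg m).-homog.
Proof.
rewrite /phi /lead; case: pickP => [i /and3P[_ le _]|_]; last by rewrite dhomogX.
rewrite -{2}(dz_le le) mdegD mdeg_dz addnC; apply: dhomogM; first exact: FH.
by rewrite dhomogX.
Qed.

Definition inI j f := exists g : 'I_c -> {mpoly k[n.+1]}, f = \sum_(i < c | (i < j)%N) F i * g i.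

Definition rep j f := exists2 r, nrmp j r & inI j (f - r).

Lemma inID j f g : inI j f -> inI j g -> inI j (f + g).
Proof.
move=> [a ->] [b ->]; exists (fun i => a i + b i); rewrite -big_split /=.
by apply: eq_bigr => i _; rewrite mulrDr.
Qed.

Lemma inIM j f g : inI j f -> inI j (f * g).
Proof.
move=> [a ->]; exists (fun i => a i * g); rewrite mulr_suml.
by apply: eq_bigr => i _; rewrite mulrA.
Qed.

Lemma inI0 j : inI j 0.
Proof. by exists (fun=> 0); rewrite big1 // => i _; rewrite mulr0. Qed.

Lemma inIF j (i : 'I_c) : (i < j)%N -> inI j (F i).
Proof.
move=> ij; exists (fun l => (l == i)%:R); rewrite (bigD1 i) //= eqxx mulr1.
by rewrite big1 ?addr0 // => l /andP[_ /negbTE ->]; rewrite mulr0.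
Qed.

Lemma repD j f g : rep j f -> rep j g -> rep j (f + g).
Proof.
move=> [r hr If] [s hs Ig]; exists (r + s); first exact: nrmpD.
by rewrite opprD addrACA; apply: inID.
Qed.

Lemma repZ j a f : rep j f -> rep j (a *: f).
Proof.
move=> [r hr If]; exists (a *: r); first exact: nrmpZ.
by rewrite -scalerBr -mul_mpolyC mulrC; apply: inIM.
Qed.

Lemma repI j f : inI j f -> rep j f.
Proof. by move=> h; exists 0; [apply: nrmp0|rewrite subr0]. Qed.

Lemma rep0 j : rep j 0. Proof. exact/repI/inI0. Qed.

Lemma rep_nrm j m : nrm j m -> rep j 'X_[m].
Proof. by move=> h; exists 'X_[m]; [apply: nrmpX|rewrite subrr; apply: inI0]. Qed.

Lemma rep_sum j (I : eqType) (r : seq I) (G : I -> {mpoly k[n.+1]}) :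
  {in r, forall i, rep j (G i)} -> rep j (\sum_(i <- r) G i).
Proof.
elim: r => [|i r ih] h; first by rewrite big_nil; apply: rep0.
rewrite big_cons; apply: repD; first exact/h/mem_head.
by apply: ih => l lr; apply: h; rewrite inE lr orbT.
Qed.

Lemma rep_poly j f : {in msupp f, forall m, rep j 'X_[m]} -> rep j f.
Proof. by move=> h; rewrite (mpolyE f); apply: rep_sum => m /h; apply: repZ. Qed.

Definition zfree j m := forall i : 'I_c, (i < j)%N -> m (zi i) = 0%N.

Lemma rep_mulX j m f : zfree j m -> rep j f -> rep j ('X_[m] * f).
Proof.
move=> zm [r hr If]; exists ('X_[m] * r); last first.
  by rewrite -mulrBr mulrC; apply: inIM.
move=> s; rewrite mulrC (perm_mem (msuppMX _ _)) => /mapP[t /hr/nrmP ht ->].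
by apply/nrmP => i ij; rewrite mnmDE zm ?add0n //; apply: ht.
Qed.

Definition zpart j m : 'X_{1..n.+1} :=
  [multinom if [exists i : 'I_c, (i < j)%N && (zi i == l)] then m l else 0%N | l < n.+1].

Lemma zpart_zi j (i : 'I_c) m : (i < j)%N -> zpart j m (zi i) = m (zi i).
Proof.
by move=> ij; rewrite mnmE; case: existsP => // -[]; exists i; rewrite ij eqxx.
Qed.

Lemma zpart_le j m l : (zpart j m l <= m l)%N.
Proof. by rewrite mnmE; case: ifP. Qed.

Lemma zpartK j m : (m - zpart j m + zpart j m = m)%MM.
Proof. by apply: submK; apply/mnm_lepP => l; apply: zpart_le. Qed.

Lemma zfree_rest j m : zfree j (m - zpart j m)%MM.
Proof. by move=> i ij; rewrite mnmBE zpart_zi // subnn. Qed.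

Lemma rep_of_zpart j m : rep j 'X_[zpart j m] -> rep j 'X_[m].
Proof.
by rewrite -{2}(zpartK j m) mpolyXD => h; apply: rep_mulX => //; apply: zfree_rest.
Qed.

Lemma mdeg_zpart j m : mdeg (zpart j m) = (\sum_(i < c | (i < j)%N) m (zi i))%N.
Proof.
rewrite mdegE (bigID (fun l => [exists i : 'I_c, (i < j)%N && (zi i == l)])) /=.
rewrite addnC big1 ?add0n; last by move=> l /negbTE h; rewrite mnmE h.
under eq_bigr => l h do rewrite mnmE h.
transitivity (\sum_(l in zi @: [set i : 'I_c | (i < j)%N]) m l)%N.
  apply: eq_bigl => l; apply/existsP/idP.
    by case=> i /andP[ij /eqP <-]; apply/imsetP; exists i; rewrite ?inE.
  by case/imsetP=> i; rewrite inE => ij ->; exists i; rewrite ij eqxx.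
rewrite big_imset /=; first by apply: eq_bigl => i; rewrite inE.
by move=> i l _ _; apply: zi_inj.
Qed.

Definition dsum := (\sum_(i < c) tnth d i)%N.

(** It is enough to reduce the monomials of bounded degree: a normal monomial
    in the z_i, i < j, has degree at most dsum, hence times a variable at most
    dsum + 1. *)
Lemma rep_all j T : (dsum < T)%N ->
    (forall m, (mdeg m < T)%N -> rep j 'X_[m]) ->
  forall f, rep j f.
Proof.
move=> ltT base f; apply: rep_poly => m _; apply: rep_of_zpart.
move: {2}(mdeg _) (leqnn (mdeg (zpart j m))) => N.
elim: N m => [|N ih] m le.
  by apply: base; apply: leq_ltn_trans le (leq_ltn_trans (leq0n _) ltT).
have [/base//|geT] := ltnP (mdeg (zpart j m)) T.
have [i ij mi] : exists2 i : 'I_c, (i < j)%N & (0 < m (zi i))%N.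
  have [/existsP[i /andP[]]|] := boolP [exists i : 'I_c, (i < j)%N && (0 < m (zi i))%N].
    by exists i.
  rewrite negb_exists => /forallP h.
  move: geT; rewrite mdeg_zpart big1 ?leqn0.
    by move=> /eqP T0; rewrite T0 in ltT.
  by move=> i ij; have := h i; rewrite ij /= -eqn0Ngt => /eqP.
pose m' := (zpart j m - U_(zi i))%MM.
have mE : (zpart j m = U_(zi i) + m')%MM.
  by rewrite addmC submK // lep1mP zpart_zi // -lt0n.
have zz : zpart j m' = m'.
  by apply/mnmP => l; rewrite mnmE; case: ifP => // h; rewrite mnmBE mnmE h.
have [r hr Ir] : rep j 'X_[m'].
  rewrite -zz; apply: ih; rewrite zz -ltnS; apply: leq_trans le.
  by rewrite mE mdegD mdeg1.
rewrite mE mpolyXD -(subrK r 'X_[m']) mulrDr; apply: repD.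
  by apply: repI; rewrite mulrC; apply: inIM.
rewrite mulrC; apply: rep_poly => s.
rewrite (perm_mem (msuppMX _ _)) => /mapP[t /hr/nrmP ht ->].
apply/rep_of_zpart/base; apply: leq_ltn_trans ltT.
rewrite mdeg_zpart /dsum (bigD1 i) //= [X in (_ <= X)%N](bigD1 i) //=.
apply: leq_add; first by rewrite mnmDE mnm1E eqxx; have := ht i ij; lia.
apply: (@leq_trans (\sum_(l < c | (l < j)%N && (l != i)) tnth d l)).
  apply: leq_sum => l /andP[lj li].
  by rewrite mnmDE mnm1E (inj_eq zi_inj) eq_sym (negbTE li) add0n ltnW // ht.
by rewrite [X in (_ <= X)%N](bigID (fun l : 'I_c => (l < j)%N)) /=
  (eq_bigl (fun l : 'I_c => (l != i) && (l < j)%N)) ?leq_addr // => l; rewrite andbC.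
Qed.

(** By induction on j: the cofactor of each equation may be reduced modulo the
    preceding equations. *)
Lemma inI_normal (Hrep : forall j, (j <= c)%N -> forall f, rep j f) j f :
    (j <= c)%N -> inI j f ->
  exists2 q : 'I_c -> {mpoly k[n.+1]}, (forall i : 'I_c, nrmp i (q i))
    & f = \sum_(i < c | (i < j)%N) F i * q i.
Proof.
elim: j f => [|j ih] f jc [g ->].
  by exists (fun=> 0) => [i|]; [apply: nrmp0|rewrite !big_pred0].
pose j' := Ordinal jc.
have [r hr [h hE]] := Hrep j (ltnW jc) (g j').
have split (G : 'I_c -> {mpoly k[n.+1]}) : \sum_(i < c | (i < j.+1)%N) G i =
    G j' + \sum_(i < c | (i < j)%N) G i.
  rewrite (bigD1 j') ?leqnn //=; congr (_ + _); apply: eq_bigl => i.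
  by rewrite ltnS [in RHS]ltn_neqAle andbC -val_eqE.
have [||q hq qE] := ih (\sum_(i < c | (i < j)%N) F i * (g i + F j' * h i)).
- exact: ltnW.
- by exists (fun i => g i + F j' * h i).
exists (fun i => if i == j' then r else q i) => [i|].
  by case: eqP => [->|].
have gE : g j' = \sum_(i < c | (i < j)%N) F i * h i + r by rewrite -hE subrK.
rewrite !split eqxx gE mulrDr -addrA addrCA; congr (_ + _).
transitivity (\sum_(i < c | (i < j)%N) F i * q i); last first.
  by apply: eq_bigr => i ij; case: eqP => // e; rewrite e /= ltnn in ij.
rewrite -qE mulr_sumr -big_split /=; apply: eq_bigr => i _.
by ring.
Qed.

Definition Phi j b : 'M_#|{: 'X_{1..n.+1 < b}}| := lextmx (phi j) b.

Lemma phi_rep j m : (j <= c)%N -> rep j (phi j m).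
Proof.
move=> jc; rewrite /phi; case e: (lead j m) => [i|]; last first.
  by apply: rep_nrm; apply: lead_none.
apply/repI/inIM/inIF; move: e; rewrite /lead; case: pickP => // l /and3P[lj _ _].
by case=> <-.
Qed.

Lemma rep_of_unit j T : (j <= c)%N -> (dsum < T)%N -> Phi j T \in unitmx ->
  forall f, rep j f.
Proof.
move=> jc ltT u; apply: (rep_all ltT) => m lt.
have [|_ <-] := lext_invK (phi_homog j) (p := 'X_[m]) u; first by rewrite msizeX.
by apply: rep_sum => s _; apply: repZ; apply: phi_rep.
Qed.

(** Under finitely many open conditions, normal monomials form a basis of the
    quotient over the ring of parameters. *)
Variable T : nat.
Hypothesis ltT : (dsum < T)%N.
Hypothesis gen : forall j, (j <= c)%N -> Phi j T \in unitmx.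

Let Psi := lext (phi c).

Lemma Psi_nrm r : nrmp c r -> Psi r = r.
Proof.
move=> hr; rewrite /Psi -(lext_eq (g := id)) // => m /hr h.
by rewrite /phi lead_nrm.
Qed.

Lemma Psi_dz (i : 'I_c) q : nrmp i q -> Psi (q * 'X_[dz i]) = F i * q.
Proof.
move=> hq; rewrite (mpolyE q) mulr_suml /Psi lext_sum mulr_sumr.
rewrite big_seq [RHS]big_seq; apply: eq_bigr => m /hq h.
by rewrite -scalerAl -mpolyXD lextZ lextX /phi lead_some // addmK -scalerAr.
Qed.

(** The map turns the normal form for the powers z_i ^ d_i into the one for F. *)
Lemma Psi_rep (q : 'I_c -> {mpoly k[n.+1]}) r : (forall i : 'I_c, nrmp i (q i)) -> nrmp c r ->
  Psi (\sum_i q i * 'X_[dz i] + r) = \sum_i F i * q i + r.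
Proof.
move=> hq hr; rewrite /Psi lextD lext_sum -/Psi Psi_nrm //.
by congr (_ + _); apply: eq_bigr => i _; apply: Psi_dz.
Qed.

Lemma rep_normal f : exists (q : 'I_c -> {mpoly k[n.+1]}) r, [/\ forall i : 'I_c, nrmp i (q i), nrmp c r
  & f = \sum_i F i * q i + r].
Proof.
have Hrep j : (j <= c)%N -> forall f, rep j f.
  by move=> jc; apply: (rep_of_unit jc ltT); apply: gen.
have [r hr /(inI_normal Hrep (leqnn c))[q hq qE]] := Hrep c (leqnn c) f.
exists q, r; split => //; rewrite -[LHS](subrK r) qE; congr (_ + _).
by apply: eq_bigl => i; rewrite ltn_ord.
Qed.

Lemma Psi_surj f : exists p, Psi p = f.
Proof.
have [q [r [hq hr ->]]] := rep_normal f.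
by exists (\sum_i q i * 'X_[dz i] + r); apply: Psi_rep.
Qed.

Lemma Phi_unit b : Phi c b \in unitmx.
Proof. by apply: (lextmx_unit (phi_homog c)) => m; apply: Psi_surj. Qed.

Lemma Psi_inj p q : Psi p = Psi q -> p = q.
Proof. exact/lext_inj_of_unit/Phi_unit. Qed.

Definition Psi_inv f := lext_inv (phi c) (msize f) f.

Definition nproj f := \sum_(m <- msupp f | nrm c m) f@_m *: 'X_[m].

Definition nf f := nproj (Psi_inv f).

Lemma nproj_coef f m : (nproj f)@_m = if nrm c m then f@_m else 0.
Proof.
rewrite /nproj raddf_sum /=; under eq_bigr => s _ do rewrite mcoeffZ mcoeffX.
rewrite big_mkcond /=.
have [hm|hm] := boolP (m \in msupp f); last first.
  rewrite (memN_msupp_eq0 hm) if_same big_seq big1 // => s sf.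
  by case: ifP => // _; case: eqP => [e|]; [rewrite -e sf in hm|rewrite mulr0].
rewrite (bigD1_seq m) ?msupp_uniq //= eqxx mulr1 big1 ?addr0 // => s /negbTE sm.
by rewrite sm mulr0 if_same.
Qed.

Lemma nproj_nrmp f : nrmp c (nproj f).
Proof.
by move=> m; rewrite mcoeff_msupp nproj_coef; case: ifP => // _; rewrite eqxx.
Qed.

Lemma nf_nrmp f : nrmp c (nf f). Proof. exact: nproj_nrmp. Qed.

Lemma Psi_invK f : Psi (Psi_inv f) = f.
Proof. exact: (lext_invK (phi_homog c) (Phi_unit _) (leqnn _)).2. Qed.

(** Injectivity of the comparison map makes the normal form unique. *)
Lemma nf_unique f (q : 'I_c -> {mpoly k[n.+1]}) r : (forall i : 'I_c, nrmp i (q i)) -> nrmp c r ->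
  f = \sum_i F i * q i + r -> nf f = r.
Proof.
move=> hq hr fE; have -> : nf f = nproj (\sum_i q i * 'X_[dz i] + r).
  by congr nproj; apply: Psi_inj; rewrite Psi_invK Psi_rep.
apply/mpolyP => m; rewrite nproj_coef; case: ifP => [hm|/negbT hm]; last first.
  by rewrite memN_msupp_eq0 //; apply: contra hm => /hr.
rewrite mcoeffD raddf_sum /= big1 ?add0r // => i _.
rewrite memN_msupp_eq0 // (perm_mem (msuppMX _ _)); apply/mapP => -[t _ te].
by move/nrmP: hm => /(_ i (ltn_ord i)); rewrite te mnmDE dz_zi eqxx ltnNge leq_addr.
Qed.

Lemma nrmp_eq_of_ideal r s : nrmp c r -> nrmp c s -> generated_by F (r - s) -> r = s.
Proof.
move=> hr hs [g gE].
have Hrep j : (j <= c)%N -> forall f, rep j f.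
  by move=> jc; apply: (rep_of_unit jc ltT); apply: gen.
have [q hq qE] : exists2 q : 'I_c -> {mpoly k[n.+1]}, (forall i : 'I_c, nrmp i (q i))
    & r - s = \sum_(i < c | (i < c)%N) F i * q i.
  apply: inI_normal => //; exists g; rewrite gE.
  by apply: eq_big => i; rewrite ?ltn_ord // mulrC.
rewrite (eq_bigl xpredT) in qE; last by move=> i; rewrite ltn_ord.
rewrite -(@nf_unique r (fun=> 0) r) //; first by apply: (nf_unique hq hs); rewrite -qE subrK.
  by move=> i; apply: nrmp0.
by rewrite big1 ?add0r // => i _; rewrite mulr0.
Qed.

Lemma nf_ideal f : generated_by F (f - nf f).
Proof.
have [q [r [hq hr fE]]] := rep_normal f.
rewrite (nf_unique hq hr fE) fE addrK; exists q.
by apply: eq_bigr => i _; rewrite mulrC.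
Qed.

Lemma nfP f r : nrmp c r -> generated_by F (f - r) -> nf f = r.
Proof.
move=> hr Ir; apply: nrmp_eq_of_ideal => //; first exact: nf_nrmp.
have [g gE] := nf_ideal f; have [h hE] := Ir.
exists (fun i => h i - g i).
rewrite (_ : nf f - r = (f - r) - (f - nf f)); last by ring.
rewrite gE hE -sumrB; apply: eq_bigr => i _; by rewrite mulrBl.
Qed.

(** The coefficients of a normal form are rational functions of those of the
    equations, with a denominator that depends only on the degree. *)
Lemma nf_coef b l m (lb : (mdeg l < b)%N) (mb : (mdeg m < b)%N) : nrm c m ->
  (nf 'X_[l])@_m =
    invmx (Phi c b) (enum_rank (BMultinom lb)) (enum_rank (BMultinom mb)).
Proof.
move=> hm; rewrite /nf nproj_coef hm.
have [|hp pl] := lext_invK (phi_homog c) (p := 'X_[l]) (Phi_unit b); first by rewrite msizeX.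
set p := lext_inv _ _ _ in hp pl.
have -> : Psi_inv 'X_[l] = p by apply: Psi_inj; rewrite Psi_invK.
have := lextmxE (phi c) hp; rewrite pl => /(canRL (mulmxK (Phi_unit b))).
move/(congr1 (fun M : 'rV_ _ => M 0 (enum_rank (BMultinom mb)))).
rewrite !mxE enum_rankK => ->.
rewrite (bigD1 (enum_rank (BMultinom lb))) //= mxE enum_rankK mcoeffX eqxx mul1r.
rewrite big1 ?addr0 // => i ne; rewrite mxE mcoeffX.
case: eqP => [e|]; last by rewrite mul0r.
by case/eqP: ne; apply: enum_val_inj; rewrite enum_rankK; apply: val_inj.
Qed.

End NormalForm.

(** * Complete intersections from the trace form *)

Section CompleteIntersection.
Variables (k : closedFieldType) (n c : nat) (d : c.-tuple nat).
Hypothesis hcn : (c <= n)%N.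
Hypothesis hd : forall i, (1 <= tnth d i)%N.
Variable F : 'I_c -> {mpoly k[n.+1]}.
Hypothesis FH : forms d F.
Variable T : nat.
Hypothesis ltT : (dsum d < T)%N.
Hypothesis gen : forall j, (j <= c)%N -> Phi d hcn F j T \in unitmx.

Local Notation S := {mpoly k[n.+1]}.
Local Notation nrm := (nrm d hcn).
Local Notation nrmp := (nrmp d hcn).
Local Notation nf := (nf d hcn F).
Local Notation zpart := (zpart hcn).

Lemma generated_byD f g : generated_by F f -> generated_by F g -> generated_by F (f + g).
Proof.
move=> [a ->] [b ->]; exists (fun i => a i + b i).
by rewrite -big_split; apply: eq_bigr => i _; rewrite mulrDl.
Qed.

Lemma generated_byM f g : generated_by F f -> generated_by F (g * f).
Proof.
move=> [a ->]; exists (fun i => g * a i).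
by rewrite mulr_sumr; apply: eq_bigr => i _; rewrite mulrA.
Qed.

Lemma generated_by_gen i : generated_by F (F i).
Proof.
exists (fun l => (l == i)%:R); rewrite (bigD1 i) //= eqxx mul1r.
by rewrite big1 ?addr0 // => l /negbTE ->; rewrite mul0r.
Qed.

Let nfP' := nfP FH ltT gen.
Let nf_ideal' := nf_ideal FH ltT gen.

Lemma nfL a f g : nf (a *: f + g) = a *: nf f + nf g.
Proof.
apply: nfP'; first by apply: nrmpD; [apply: nrmpZ|]; apply: nf_nrmp.
rewrite (_ : _ - _ = a%:MP * (f - nf f) + (g - nf g)); last first.
  by rewrite mul_mpolyC scalerBr opprD addrACA.
by apply: generated_byD; [apply: generated_byM|]; apply: nf_ideal'.
Qed.

Lemma nf_ideal0 f : generated_by F f -> nf f = 0.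
Proof. by move=> h; apply: nfP'; [apply: nrmp0|rewrite subr0]. Qed.

Lemma nf_eq0 f : nf f = 0 -> generated_by F f.
Proof. by move=> h; have := nf_ideal' f; rewrite h subr0. Qed.

Lemma nf_mul f g : nf (f * nf g) = nf (f * g).
Proof.
apply/esym/nfP'; first exact: nf_nrmp.
rewrite (_ : _ - _ = f * (g - nf g) + (f * nf g - nf (f * nf g))); last by ring.
by apply: generated_byD; [apply: generated_byM|]; apply: nf_ideal'.
Qed.

Lemma nf_id r : nrmp c r -> nf r = r.
Proof.
by move=> h; apply: nfP' => //; exists (fun=> 0); rewrite subrr big1 // => i _; rewrite mul0r.
Qed.

Lemma nf_mulx (l : 'I_n.+1) f : (c <= l)%N -> nf ('X_l * f) = 'X_l * nf f.
Proof.
move=> cl; rewrite -nf_mul; apply: nf_id => m.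
rewrite mulrC (perm_mem (msuppMX _ _)) => /mapP[t /(nf_nrmp) /nrmP ht ->].
apply/nrmP => i ic; rewrite mnmDE mnm1E -val_eqE /=.
by rewrite gtn_eqF ?add0n ?ht // (leq_trans _ cl).
Qed.

Definition spec (a : 'I_n.+1 -> k) (f : S) : S :=
  f \mPo [tuple if (l < c)%N then 'X_l else (a l)%:MP | l < n.+1].

Lemma spec_meval a f v :
  (spec a f).@[v] = f.@[fun l : 'I_n.+1 => if (l < c)%N then v l else a l].
Proof.
rewrite comp_mpoly_meval; apply: meval_eq => l; rewrite tnth_mktuple.
by case: ifP => _; rewrite ?mevalXU ?mevalC.
Qed.

Lemma specL a b f g : spec a (b *: f + g) = b *: spec a f + spec a g.
Proof. by rewrite /spec raddfD /= comp_mpolyZ. Qed.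

Lemma specZ a b f : spec a (b *: f) = b *: spec a f.
Proof. exact: comp_mpolyZ. Qed.

Lemma spec_sum a (I : Type) (r : seq I) (P : pred I) (G : I -> S) :
  spec a (\sum_(i <- r | P i) G i) = \sum_(i <- r | P i) spec a (G i).
Proof. by rewrite /spec raddf_sum. Qed.

Lemma specM a f g : spec a (f * g) = spec a f * spec a g.
Proof. by rewrite /spec rmorphM. Qed.

Lemma specXU a l : spec a 'X_l = if (l < c)%N then 'X_l else (a l)%:MP.
Proof. by rewrite /spec comp_mpolyXU -tnth_nth tnth_mktuple. Qed.

Lemma specC a b : spec a b%:MP = b%:MP.
Proof. exact: comp_mpolyC. Qed.

Lemma zpart_lt m (l : 'I_n.+1) : (l < c)%N -> zpart c m l = m l.
Proof.
move=> lc; have := @zpart_zi n c hcn c (Ordinal lc) m lc.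
by rewrite (_ : zi hcn (Ordinal lc) = l) //; apply: val_inj.
Qed.

Lemma zpart_ge m (l : 'I_n.+1) : (c <= l)%N -> zpart c m l = 0%N.
Proof.
move=> cl; rewrite mnmE; case: existsP => // -[i /andP[_ /eqP e]].
by have := ltn_ord i; rewrite ltnNge (leq_trans cl) // -e.
Qed.

Lemma specX a m : spec a 'X_[m] =
  (\prod_(l < n.+1 | (c <= l)%N) a l ^+ m l) *: 'X_[zpart c m].
Proof.
rewrite /spec comp_mpolyX mpolyXE_id (bigID (fun l : 'I_n.+1 => (c <= l)%N)) /=.
rewrite [X in _ = _ *: X](bigID (fun l : 'I_n.+1 => (c <= l)%N)) /=.
rewrite [X in _ = _ *: (X * _)]big1 ?mul1r; last first.
  by move=> l cl; rewrite zpart_ge.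
rewrite -mul_mpolyC rmorph_prod /=; congr (_ * _).
  by apply: eq_bigr => l cl; rewrite tnth_mktuple ltnNge cl rmorphXn.
apply: eq_bigr => l; rewrite -ltnNge => lc.
by rewrite tnth_mktuple lc zpart_lt.
Qed.

(** The class of f in the coordinate ring of the fibre over the parameter a. *)
Definition red a f := spec a (nf f).

Lemma redL a b f g : red a (b *: f + g) = b *: red a f + red a g.
Proof. by rewrite /red nfL specL. Qed.

Lemma red0 a : red a 0 = 0.
Proof. by have := redL a (-1) 0 0; rewrite !scaleN1r !addNr. Qed.

Lemma redD a f g : red a (f + g) = red a f + red a g.
Proof. by have := redL a 1 f g; rewrite !scale1r. Qed.

Lemma redZ a b f : red a (b *: f) = b *: red a f.
Proof. by have := redL a b f 0; rewrite red0 !addr0. Qed.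

Lemma redB a f g : red a (f - g) = red a f - red a g.
Proof. by rewrite redD -scaleN1r redZ scaleN1r. Qed.

Lemma red_param a g (l : 'I_n.+1) : (c <= l)%N -> red a (g * ('X_l - (a l)%:MP)) = 0.
Proof.
move=> cl; rewrite mulrBr redB mulrC [g * _]mulrC mul_mpolyC redZ /red nf_mulx //.
by rewrite specM specXU ltnNge cl /= mul_mpolyC subrr.
Qed.

Lemma red_mul_spec a f g : red a (g * spec a f) = red a (g * f).
Proof.
apply/esym/eqP; rewrite -subr_eq0 -redB -mulrBr; apply/eqP.
elim/mpoly_ring_ind: f g => [b|l|p q hp hq|p q hp hq] g.
- by rewrite specC subrr mulr0 red0.
- rewrite specXU; case: ltnP => [lc|cl]; first by rewrite subrr mulr0 red0.
  exact: red_param.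
- rewrite (_ : spec a (p + q) = spec a p + spec a q); last first.
    by rewrite /spec raddfD.
  by rewrite opprD addrACA mulrDr redD hp hq addr0.
- rewrite specM (_ : g * (p * q - spec a p * spec a q) =
    (g * p) * (q - spec a q) + (g * spec a q) * (p - spec a p)); last by ring.
  by rewrite redD hq hp addr0.
Qed.

Lemma red_mul_red a f g : red a (g * red a f) = red a (g * f).
Proof. by rewrite {2}/red red_mul_spec /red nf_mul. Qed.

Definition nz := {m : 'X_{1..n.+1 < (dsum d).+1} | nrm c m && (zpart c m == m)}.

Definition nzm (i : 'I_#|{: nz}|) : 'X_{1..n.+1} := val (enum_val i).

Lemma nzm_inj : injective nzm.
Proof. by move=> i j /val_inj/val_inj/enum_val_inj. Qed.

Lemma nzm_ex m : nrm c m -> zpart c m = m -> exists i, nzm i = m.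
Proof.
move=> hm zm; have lt : (mdeg m < (dsum d).+1)%N.
  rewrite ltnS -zm mdeg_zpart; apply: leq_trans (_ : \sum_(i < c | (i < c)%N) tnth d i <= _)%N.
    by apply: leq_sum => i ic; rewrite ltnW //; move/nrmP: hm; apply.
  by rewrite /dsum [X in (_ <= X)%N](bigID (fun i : 'I_c => (i < c)%N)) leq_addr.
have p : nrm c (BMultinom lt) && (zpart c (BMultinom lt) == BMultinom lt :> 'X_{1..n.+1}).
  by rewrite /= hm zm eqxx.
exists (enum_rank (exist _ (BMultinom lt) p : nz)).
by rewrite /nzm enum_rankK.
Qed.

Lemma nzmP i : nrm c (nzm i) /\ zpart c (nzm i) = nzm i.
Proof. by have /andP[h /eqP e] := valP (enum_val i). Qed.

Lemma red_supp a f m : m \in msupp (red a f) -> exists i, nzm i = m.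
Proof.
rewrite /red (mpolyE (nf f)) /spec raddf_sum => /msupp_sum_le/flattenP[s].
case/mapP=> t; rewrite mem_filter /= => tf -> {s}.
rewrite comp_mpolyZ -/(spec a _) specX => /msuppZ_le/msuppZ_le.
rewrite msuppX inE => /eqP ->; apply: nzm_ex.
  have /nrmP ht := nf_nrmp tf.
  by apply/nrmP => i ic; apply: leq_ltn_trans (zpart_le _ _ _ _) (ht i ic).
apply/mnmP => l; case: (ltnP l c) => lc; first by rewrite zpart_lt.
by rewrite !zpart_ge.
Qed.

Lemma red_expand a f : red a f = \sum_i (red a f)@_(nzm i) *: 'X_[nzm i].
Proof.
apply/mpolyP => m; rewrite [RHS]raddf_sum /=.
under eq_bigr => i _ do rewrite mcoeffZ mcoeffX.
have [[i <-]|h] : (exists i, nzm i = m) \/ (red a f)@_m = 0.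
- have [/red_supp|/memN_msupp_eq0] := boolP (m \in msupp (red a f)); first by left.
  by right.
- rewrite (bigD1 i) //= eqxx mulr1 big1 ?addr0 // => j ne.
  by rewrite (inj_eq nzm_inj) (negbTE ne) mulr0.
- by rewrite h big1 // => i _; case: eqP => [->|]; rewrite ?h ?mul0r ?mulr0.
Qed.

(** Multiplication on the fibre over the parameter a, in the basis of normal
    monomials. *)
Definition mulmat a g : 'M[k]_#|{: nz}| :=
  \matrix_(i, j) (red a (g * 'X_[nzm i]))@_(nzm j).

Definition redrow a f : 'rV[k]_#|{: nz}| := \row_j (red a f)@_(nzm j).

Lemma redrow_mul a f g : redrow a (g * f) = redrow a f *m mulmat a g.
Proof.
apply/rowP => j; rewrite !mxE -red_mul_red {1}(red_expand a f) mulr_sumr.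
rewrite (big_morph _ (redD a) (red0 a)) raddf_sum /=; apply: eq_bigr => i _.
by rewrite !mxE -scalerAr redZ mcoeffZ.
Qed.

Lemma mulmat1 a : mulmat a 1 = 1%:M.
Proof.
apply/matrixP => i j; rewrite !mxE mul1r /red nf_id; last exact/nrmpX/(nzmP i).1.
rewrite specX (nzmP i).2 mcoeffZ mcoeffX (inj_eq nzm_inj) big1 ?mul1r // => l cl.
by rewrite -(nzmP i).2 zpart_ge.
Qed.

Lemma mulmatL a b p q : mulmat a (b *: p + q) = b *: mulmat a p + mulmat a q.
Proof.
by apply/matrixP => i j; rewrite !mxE mulrDl -scalerAl redL mcoeffD mcoeffZ.
Qed.

Lemma mulmatM a p q : mulmat a (p * q) = mulmat a p *m mulmat a q.
Proof.
rewrite mulrC; apply/row_matrixP => i; rewrite row_mul.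
have e g : row i (mulmat a g) = redrow a (g * 'X_[nzm i]).
  by apply/rowP => j; rewrite !mxE.
by rewrite !e -mulrA redrow_mul.
Qed.

Lemma mulmat_red a f g : mulmat a (red a f * g) = mulmat a (f * g).
Proof.
apply/matrixP => i j; rewrite !mxE; congr mcoeff.
by rewrite -mulrA mulrC red_mul_red mulrC mulrA.
Qed.

Lemma mulmat_ker_zero a x : (forall g, mulmat a g = 0 -> g.@[x] = 0) ->
  (forall l : 'I_n.+1, (c <= l)%N -> x l = a l) /\ forall i, (F i).@[x] = 0.
Proof.
move=> h; split=> [l cl|i].
  have : ('X_l - (a l)%:MP).@[x] = 0.
    apply: h; apply/matrixP => i j; rewrite !mxE mulrC red_param //.
    by rewrite mcoeff0.
  by rewrite mevalB mevalXU mevalC => /eqP; rewrite subr_eq0 => /eqP.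
apply: h; apply/matrixP => s j; rewrite !mxE /red nf_ideal0; last first.
  by rewrite mulrC; apply/generated_byM/generated_by_gen.
by rewrite /spec raddf0 mcoeff0.
Qed.

(** A common eigenvector of the multiplications on the fibre, which is not 0
    because 1 is a normal monomial. *)
Lemma point_over a : exists x : 'I_n.+1 -> k,
  (forall l : 'I_n.+1, (c <= l)%N -> x l = a l) /\ forall i, (F i).@[x] = 0.
Proof.
have [i0 _] : exists i, nzm i = 0%MM.
  apply: nzm_ex; first by apply/nrmP => i _; rewrite mnm0E.
  by apply/mnmP => l; rewrite mnmE !mnm0E if_same.
have W0 : (1%:M : 'M[k]_#|{: nz}|) != 0.
  apply/eqP => /matrixP/(_ i0 i0); rewrite !mxE eqxx => /eqP.
  by rewrite oner_eq0.
have WM p : stablemx 1%:M (mulmat a p) by apply: submx1.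
have [x [v [v0 _ vM]]] := quotient_point (mulmat1 a) (mulmatL a) (mulmatM a) W0 WM.
exists x; apply: mulmat_ker_zero => g Mg; have := vM g; rewrite Mg mulmx0 => /esym/eqP.
by rewrite scaler_eq0 (negbTE v0) orbF => /eqP.
Qed.

(** The form (f, g) |-> trace of f g on the fibre, nondegenerate when the fibre
    is reduced. *)
Definition trform a : 'M[k]_#|{: nz}| :=
  \matrix_(i, j) \tr (mulmat a ('X_[nzm i] * 'X_[nzm j])).

Lemma polymp_spec f : polymp (fun a : 'I_n.+1 -> k => spec a f).
Proof.
move=> m; apply: (@polyf_ext _ _ (fun a => (\sum_(s <- msupp f) f@_s *:
   \prod_(l < n.+1) (if (l < c)%N then 'X_l else (a l)%:MP) ^+ s l)@_m)); last first.
  move=> a; rewrite /spec comp_mpolyEX; congr (mcoeff m _); apply: eq_bigr => s _.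
  rewrite comp_mpolyX; congr (_ *: _); apply: eq_bigr => l _.
  by rewrite tnth_mktuple.
move: m; apply: polymp_sum => s; apply: polympZ; first exact: polyfC.
apply: polymp_prod => l; apply: polymp_exp; case: (l < c)%N; first exact: polympC.
move=> m; apply: (polyf_ext (polyfM (polyfX k l) (polyfC _ (m == 0%MM)%:R))) => a.
by rewrite mcoeffC.
Qed.

Lemma polyf_det_trform : polyf (fun a => \det (trform a)).
Proof.
apply: polyf_det => i j; apply: polyf_sum => s _.
have := polymp_spec (nf ('X_[nzm i] * 'X_[nzm j] * 'X_[nzm s])) (nzm s).
by move/polyf_ext; apply => a; rewrite mxE.
Qed.

(** All multiples of f vanish on the fibre, so f is orthogonal to everything for
    the trace form. *)
Lemma red_of_ideal f a : ideal_of (zeros F) f -> a ord_max != 0 ->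
  \det (trform a) != 0 -> red a f = 0.
Proof.
move=> If am dT.
have tr0 g : \tr (mulmat a (f * g)) = 0.
  apply: (quotient_trace_eq0 (mulmat1 a) (mulmatL a) (mulmatM a)) => x.
  case/mulmat_ker_zero=> xa xF.
  have e (p : S) : p.@[fun j => (\col_j x j) j 0] = p.@[x].
    by apply: meval_eq => j; rewrite mxE.
  rewrite mevalM -e If ?mul0r //; split=> [|i]; last by rewrite e.
  apply/eqP => /matrixP/(_ ord_max 0); rewrite !mxE xa //.
  exact/eqP.
have : redrow a f *m trform a = 0.
  apply/rowP => j; rewrite !mxE -[RHS](tr0 'X_[nzm j]) -mulmat_red.
  rewrite [in RHS](red_expand a f) mulr_suml.
  have h : forall s : seq 'I_#|{: nz}|, \tr (mulmat a (\sum_(i <- s)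
      (red a f)@_(nzm i) *: 'X_[nzm i] * 'X_[nzm j])) =
      \sum_(i <- s) (red a f)@_(nzm i) * \tr (mulmat a ('X_[nzm i] * 'X_[nzm j])).
    elim=> [|i s ih]; last by rewrite !big_cons -scalerAl mulmatL linearD linearZ /= ih.
    rewrite !big_nil (_ : mulmat a 0 = 0) ?linear0 //.
    by apply/matrixP => s t; rewrite !mxE mul0r red0 mcoeff0.
  by rewrite h; apply: eq_bigr => i _; rewrite !mxE.
have uT : trform a \in unitmx by rewrite unitmxE unitfE.
move/(congr1 (mulmx^~ (invmx (trform a)))); rewrite mulmxK // mul0mx => /rowP h.
by rewrite red_expand big1 // => i _; have := h i; rewrite !mxE => ->; rewrite scale0r.
Qed.

Hypothesis trf : exists a, \det (trform a) != 0.

(** The normal form of an element of the ideal of X vanishes on all fibres with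
    nondegenerate trace form, and these are dense. *)
Lemma ideal_zeros f : ideal_of (zeros F) f <-> generated_by F f.
Proof.
split=> [If|[g ->] x [_ xF]]; last first.
  by rewrite raddf_sum /= big1 // => i _; rewrite mevalM xF mulr0.
apply: nf_eq0; apply/eqP/negPn/negP => /mpoly_nonroot[v fv].
have [a Ta] := trf.
have [w [fw Tw]] : exists w, (nf f).@[w] * w ord_max != 0 /\ \det (trform w) != 0.
  have hf : polyf (fun w : 'I_n.+1 -> k => (nf f).@[w]).
    by apply: polyf_mpoly => i; apply: polyfX.
  have h1 : (fun=> 1 : k) (ord_max : 'I_n.+1) != 0 by rewrite oner_neq0.
  have [u [fu mu]] := polyf_nonroot2 (u := v) (v := fun=> 1) hf (polyfX k ord_max) fv h1.
  apply: (polyf_nonroot2 (u := u) (v := a)) => //.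
  - by apply: polyfM => //; apply: polyfX.
  - exact: polyf_det_trform.
  - by rewrite mulf_neq0.
move: fw; rewrite mulf_eq0 negb_or => /andP[fw mw].
have := red_of_ideal If mw Tw; rewrite /red => /(congr1 (meval w)).
rewrite spec_meval meval0 => h; case/eqP: fw; rewrite -[RHS]h.
by apply: meval_eq => l; rewrite if_same.
Qed.

Lemma msize_nf f : (msize (nf f) <= msize f)%N.
Proof.
apply: leq_trans (msize_sum _ _ _) _; apply/bigmax_leqP_seq => m mp _.
apply: leq_trans (msizeZ_le _ _) _; rewrite msizeX.
apply: leq_trans (msize_mdeg_lt mp) _.
apply: leq_trans (msize_sum _ _ _) _; apply/bigmax_leqP => j _.
by apply: leq_trans (msizeZ_le _ _) _; rewrite msizeX bmdeg.
Qed.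

Lemma card_normal_le t :
  (#|{: {m : 'X_{1..n.+1 < t} | nrm c m}}| <= (dsum d).+1 ^ c * t ^ (n - c).+1)%N.
Proof.
case: t => [|t].
  by apply: leq_trans (leq0n _); rewrite leqn0; apply/eqP/eq_card0 => -[[]].
pose f (m : {m : 'X_{1..n.+1 < t.+1} | nrm c m}) :
    {ffun 'I_c -> 'I_(dsum d).+1} * {ffun 'I_(n - c).+1 -> 'I_t.+1} :=
  ([ffun i : 'I_c => inord ((val m : 'X_{1..n.+1}) (zi hcn i))],
   [ffun l : 'I_(n - c).+1 => inord ((val m : 'X_{1..n.+1}) (inord (c + l)))]).
have fI : injective f.
  move=> m m' [/ffunP e1 /ffunP e2]; apply/val_inj/val_inj/mnmP => l.
  case: (ltnP l c) => lc.
    have lt (w : {m : 'X_{1..n.+1 < t.+1} | nrm c m}) :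
        ((val w : 'X_{1..n.+1}) (zi hcn (Ordinal lc)) < (dsum d).+1)%N.
      have /nrmP/(_ (Ordinal lc) lc) := valP w; move/ltn_trans; apply.
      by rewrite ltnS /dsum (bigD1 (Ordinal lc)) //= leq_addr.
    have := congr1 (@nat_of_ord _) (e1 (Ordinal lc)); rewrite !ffunE !inordK ?lt //.
    by rewrite (_ : zi hcn (Ordinal lc) = l) //; apply: val_inj.
  have lt (w : {m : 'X_{1..n.+1 < t.+1} | nrm c m}) l' :
      ((val w : 'X_{1..n.+1}) l' < t.+1)%N.
    exact: leq_ltn_trans (mnm_le_mdeg _ _) (bmdeg _).
  have hl : (l - c < (n - c).+1)%N by have := ltn_ord l; lia.
  have := congr1 (@nat_of_ord _) (e2 (Ordinal hl)); rewrite !ffunE !inordK ?lt //=.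
  by rewrite subnKC // inord_val.
by have := leq_card _ fI; rewrite card_prod !card_ffun !card_ord.
Qed.

(** The parameters are algebraically independent on X, there being a point of X
    over each of their values; more elements are dependent because the normal
    monomials of degree less than t number at most a multiple of t ^ (n - c + 1). *)
Lemma codim_zeros : has_codim (zeros F) c.
Proof.
exists (n - c)%N; last by rewrite subnK.
split.
  exists [tuple 'X_(inord (c + l)) | l < (n - c).+1] => P IP.
  apply/eqP/negPn/negP => /mpoly_nonroot[v Pv].
  have h1 : (fun=> 1 : k) (ord_max : 'I_(n - c).+1) != 0 by rewrite oner_neq0.
  have [w [Pw mw]] := polyf_nonroot2 (u := v) (v := fun=> 1)
    (polyf_mpoly P (fun i => polyfX k i)) (polyfX k ord_max) Pv h1.
  have [x [xa xF]] := point_over (fun l : 'I_n.+1 => w (inord (l - c))).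
  have e (p : S) : p.@[fun j => (\col_j x j) j 0] = p.@[x].
    by apply: meval_eq => j; rewrite mxE.
  have wE (l : 'I_(n - c).+1) : x (inord (c + l)) = w l.
    have lt : (c + l < n.+1)%N by have := ltn_ord l; lia.
    rewrite xa inordK ?leq_addr // addKn; congr w.
    by apply: val_inj; rewrite /= inordK.
  case/eqP: Pw; rewrite -(IP (\col_j x j)).
    rewrite e comp_mpoly_meval; apply: meval_eq => l.
    by rewrite tnth_mktuple mevalXU wE.
  split=> [|i]; last by rewrite e.
  apply/eqP => /matrixP/(_ (inord (c + (n - c))) 0); rewrite !mxE.
  have := wE ord_max; rewrite /= => ->; exact/eqP.
move=> y ay.
pose L t f : 'rV[k]_#|{: {m : 'X_{1..n.+1 < t} | nrm c m}}| :=
  \row_j (nf f)@_(val (enum_val j : {m : 'X_{1..n.+1 < t} | nrm c m})).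
have [||||P P0 PZ] := @algebraic_dependence k n.+1 (n - c).+2 (n - c).+1
  ((dsum d).+1 ^ c) y (fun f => nf f = 0) _ L.
- by move=> t a f g; apply/rowP => j; rewrite !mxE nfL mcoeffD mcoeffZ.
- by move=> t; apply: card_normal_le.
- move=> t f le /rowP h; apply/mpolyP => m; rewrite mcoeff0.
  have [hm|hm] := boolP (nrm c m); last first.
    by rewrite memN_msupp_eq0 //; apply: contra hm => /nf_nrmp.
  have [lt|ge] := ltnP (mdeg m) t.
    have := h (enum_rank (exist (fun m : 'X_{1..n.+1 < t} => nrm c m) (BMultinom lt) hm)).
    by rewrite !mxE enum_rankK.
  apply/memN_msupp_eq0/msize_mdeg_ge; apply: leq_trans ge.
  exact: leq_trans (msize_nf f) le.
- exact: ltnSn.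
case/eqP: P0; apply: ay; apply/ideal_zeros; exact: nf_eq0.
Qed.

Lemma complete_intersection_of_trform : complete_intersection d F.
Proof. by split; [exact: FH|exact: codim_zeros|exact: ideal_zeros]. Qed.

End CompleteIntersection.

(** * The general complete intersection *)

Section Generic.
Variables (k : closedFieldType) (n c : nat) (d : c.-tuple nat).

(** Polynomials in the coefficients replace the open sets, so that the
    intersection of two of them is a product. *)
Definition generic (Q : ('I_c -> {mpoly k[n.+1]}) -> Prop) : Prop :=
  exists f : (Defs.coord n d -> k) -> k, [/\ polyf f, exists v, f v != 0
    & forall F, forms d F -> f (fun s => cf F s) != 0 -> Q F].

Lemma generic_and Q Q' : generic Q -> generic Q' -> generic (fun F => Q F /\ Q' F).
Proof.
move=> [f [fP [u fu] fQ]] [g [gP [v gv] gQ]].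
exists (fun v => f v * g v); split; first exact: polyfM.
  have [w [fw gw]] := polyf_nonroot2 fP gP fu gv.
  by exists w; rewrite mulf_neq0.
move=> F hF; rewrite mulf_eq0 negb_or => /andP[h1 h2].
by split; [apply: fQ|apply: gQ].
Qed.

Lemma generic_not_thin B : thin_forms d B -> generic (fun F => ~ B F).
Proof.
move=> [f [fP fv fB]]; exists f; split => // F hF /eqP h hB; apply: h.
by apply: fB; exists F.
Qed.

End Generic.

Section GenericCI.
Variables (k : closedFieldType) (n c : nat) (d : c.-tuple nat).
Hypothesis hcn : (c <= n)%N.
Hypothesis hd : forall i, (1 <= tnth d i)%N.

Local Notation coordT := (Defs.coord n d).
Local Notation nzm := (@nzm n c d hcn).
Let T := (3 * dsum d).+1.

Let ltT : (dsum d < T)%N. Proof. by rewrite /T; lia. Qed.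

Definition PhiD j (v : coordT -> k) := \det (Phi d hcn (form_of v) j T).

Lemma polymp_form_of i : polymp (fun v : coordT -> k => form_of v i).
Proof. by apply: polymp_sum => s; apply: polympZ; [apply: polyfX|apply: polympC]. Qed.

Lemma polymp_phi j m : polymp (fun v : coordT -> k => phi d hcn (form_of v) j m).
Proof.
rewrite /phi; case: (lead _ _ _ _) => [i|]; last exact: polympC.
by apply: polympM; [apply: polymp_form_of|apply: polympC].
Qed.

Lemma polyf_PhiD j : polyf (PhiD j).
Proof. by apply: polyf_det => a b; apply: polymp_phi. Qed.

Definition bidx m : 'I_#|{: 'X_{1..n.+1 < T}}| :=
  enum_rank (insubd (BMultinom (bm0_proof n.+1 (3 * dsum d))) m : 'X_{1..n.+1 < T}).

Lemma bidxE m (lt : (mdeg m < T)%N) : bidx m = enum_rank (BMultinom lt).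
Proof. by congr enum_rank; apply: val_inj; rewrite insubdK. Qed.

(** The trace form over a fixed fibre, cleared of its denominator. *)
Definition trformN (a : 'I_n.+1 -> k) (v : coordT -> k) : 'M[k]_#|{: nz d hcn}| :=
  \matrix_(i, j) \sum_s \sum_(m : 'X_{1..n.+1 < T})
    ((nrm d hcn c m && (zpart hcn c m == nzm s))%:R *
     \prod_(l < n.+1 | (c <= l)%N) a l ^+ (m : 'X_{1..n.+1}) l) *
    (\adj (Phi d hcn (form_of v) c T)) (bidx (nzm i + nzm j + nzm s)%MM) (enum_rank m).

Lemma polyf_trformN a : polyf (fun v => \det (trformN a v)).
Proof.
apply: polyf_det => i j; apply: polyf_sum => s _; apply: polyf_sum => m _.
apply: polyfM; first exact: polyfC.
by apply: polyf_adj => p q; apply: polymp_phi.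
Qed.

Lemma mdeg_nzm (i : 'I_#|{: nz d hcn}|) : (mdeg (nzm i) <= dsum d)%N.
Proof. by rewrite -ltnS bmdeg. Qed.

Lemma trformNE a v (FH := form_of_forms v) :
    (forall j, (j <= c)%N -> Phi d hcn (form_of v) j T \in unitmx) ->
  trformN a v = PhiD c v *: trform d hcn (form_of v) a.
Proof.
move=> gen; have u := gen c (leqnn c); apply/matrixP => i j; rewrite !mxE.
rewrite /mxtrace mulr_sumr; apply: eq_bigr => s _; rewrite mxE -!mpolyXD.
set l := (_ + _ + _)%MM.
have lt : (mdeg l < T)%N.
  rewrite /l !mdegD /T; have := mdeg_nzm i; have := mdeg_nzm j; have := mdeg_nzm s.
  lia.
have hs : (msize (nf d hcn (form_of v) 'X_[l]) <= T)%N.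
  by apply: leq_trans (msize_nf _ _ _ _) _; rewrite msizeX.
rewrite /red {1}(mpolywE hs) spec_sum raddf_sum mulr_sumr /=.
apply: eq_bigr => m _.
rewrite specZ specX !mcoeffZ mcoeffX (bidxE lt).
have [hm|hm] := boolP (nrm d hcn c m); last first.
  rewrite mul0r mul0r memN_msupp_eq0 ?mul0r ?mulr0 //.
  by apply: contra hm => /nf_nrmp.
have mb : (mdeg m < T)%N := bmdeg m.
rewrite (nf_coef FH ltT gen lt mb hm) /invmx u [in RHS]mxE.
have -> : enum_rank (BMultinom mb) = enum_rank m.
  by congr enum_rank; apply: val_inj.
rewrite -/(PhiD c v).
have D0 : PhiD c v != 0 by rewrite -unitfE -unitmxE.
rewrite andTb; set x := \adj _ _ _; set y := _%:R; set z := \prod_(_ < _ | _) _.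
by field.
Qed.

(** For products of linear forms in z_i and the last variable the fibre is a grid
    of points, on which the normal monomials are independent. *)
Section Split.
Variables (L : seq k) (t : k).
Hypothesis uL : uniq L.
Hypothesis sL : forall i, (tnth d i <= size L)%N.

Definition splitF (i : 'I_c) : {mpoly k[n.+1]} :=
  \prod_(l < tnth d i) ('X_(zi hcn i) - (t * L`_l) *: 'X_ord_max).

Lemma splitF_forms : forms d splitF.
Proof.
move=> i; rewrite /splitF -[X in (X).-homog]card_ord -sum1_card.
apply: dhomog_big_prod => l; rewrite rpredB ?dhomogZ // dhomogX /= mdeg1 //.
Qed.

Definition apex (l : 'I_n.+1) : k := (l == ord_max)%:R.

Hypothesis t0 : t != 0.
Hypothesis gen : forall j, (j <= c)%N -> Phi d hcn splitF j T \in unitmx.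

Definition gpt (j : 'I_#|{: nz d hcn}|) (l : 'I_n.+1) : k :=
  if (l < c)%N then t * L`_(nzm j l) else apex l.

Definition vdm : 'M[k]_#|{: nz d hcn}| := \matrix_(i, j) ('X_[nzm i]).@[gpt j].

Lemma splitF_gpt i j : (splitF i).@[gpt j] = 0.
Proof.
have lt : (nzm j (zi hcn i) < tnth d i)%N.
  by have /nrmP := (nzmP j).1; apply.
rewrite /splitF rmorph_prod /= (bigD1 (Ordinal lt)) //= mevalB mevalZ !mevalXU.
rewrite /gpt /= ltn_ord [(n < c)%N]ltnNge hcn /apex eqxx mulr1.
by rewrite subrr mul0r.
Qed.

(** The grid is large enough to separate the normal monomials. *)
Lemma vdm_unit : vdm \in unitmx.
Proof.
rewrite -row_free_unit -kermx_eq0; apply/rowV0P => u /sub_kermxP uB.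
apply/rowP => i0; rewrite [RHS]mxE; move: i0.
apply: (@grid_coef_eq0 k 'I_c _ [seq t * x | x <- L] (fun i => tnth d i)
  (fun i l => nzm i (zi hcn l)) (fun i => u 0 i)).
- by rewrite map_inj_uniq //; apply: mulfI.
- by move=> i; rewrite size_map.
- by move=> x i; have /nrmP := (nzmP x).1; apply.
- move=> x y e; apply: nzm_inj; rewrite -(nzmP x).2 -(nzmP y).2.
  apply/mnmP => l; case: (ltnP l c) => lc; last by rewrite !zpart_ge.
  rewrite !zpart_lt //; have := e (Ordinal lc).
  by rewrite (_ : zi hcn (Ordinal lc) = l) //; apply: val_inj.
move=> g gd.
pose m : 'X_{1..n.+1} := [multinom if insub (l : nat) is Some i then g (i : 'I_c) else 0%N | l < n.+1].
have mz (i : 'I_c) : m (zi hcn i) = g i.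
  rewrite mnmE /=; case: insubP => [i' _ e|]; last by rewrite ltn_ord.
  by congr g; apply: val_inj.
have [j jm] : exists j, nzm j = m.
  apply: nzm_ex; first by apply/nrmP => i _; rewrite mz.
  apply/mnmP => l; case: (ltnP l c) => lc; first by rewrite zpart_lt.
  by rewrite zpart_ge // mnmE; case: insubP => // i il; rewrite ltnNge lc in il.
have := congr1 (fun M : 'rV_ _ => M 0 j) uB; rewrite !mxE => h; rewrite -[RHS]h.
apply: eq_bigr => i _; rewrite mxE mevalX; congr (_ * _).
rewrite [RHS](bigID (fun l : 'I_n.+1 => (l < c)%N)) /= [X in _ = _ * X]big1 ?mulr1; last first.
  by move=> l; rewrite -leqNgt => cl; rewrite -(nzmP i).2 zpart_ge.
rewrite (eq_bigl (mem (zi hcn @: setT))); last first.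
  move=> l; apply/idP/imsetP => [lc|[s _ ->]]; last exact: (ltn_ord s).
  by exists (Ordinal lc) => //; apply: val_inj.
rewrite big_imset /=; last by move=> x y _ _; apply: zi_inj.
rewrite [RHS]big_mkcond /=; apply: eq_bigr => s _; rewrite inE.
congr (_ ^+ _); rewrite /gpt /= ltn_ord jm mz (nth_map 0) //.
exact: leq_trans (gd s) (sL s).
Qed.

Lemma mulmat_vdm g : mulmat d hcn splitF apex g *m vdm =
  vdm *m diag_mx (\row_j g.@[gpt j]).
Proof.
apply/matrixP => i j; rewrite mul_mx_diag !mxE.
have FH := splitF_forms.
transitivity ((red d hcn splitF apex (g * 'X_[nzm i])).@[gpt j]).
  rewrite [in RHS]red_expand [RHS]raddf_sum /=; apply: eq_bigr => s _.
  by rewrite !mxE mevalZ.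
rewrite /red spec_meval.
have e f : f.@[fun l : 'I_n.+1 => if (l < c)%N then gpt j l else apex l] = f.@[gpt j].
  by apply: meval_eq => l; rewrite /gpt; case: (l < c)%N.
rewrite e [RHS]mulrC -mevalM; have [h hE] := nf_ideal FH ltT gen (g * 'X_[nzm i]).
apply/eqP; rewrite eq_sym -subr_eq0 -mevalB hE raddf_sum /= big1 // => s _.
by rewrite mevalM splitF_gpt mulr0.
Qed.

(** On a fibre that is a grid of distinct points, the trace of g is the sum of
    the values of g at these points. *)
Lemma det_trform_split : \det (trform d hcn splitF apex) != 0.
Proof.
have -> : trform d hcn splitF apex = vdm *m vdm^T.
  apply/matrixP => i j; rewrite !mxE.
  have -> : mulmat d hcn splitF apex ('X_[nzm i] * 'X_[nzm j]) =
      vdm *m diag_mx (\row_t ('X_[nzm i] * 'X_[nzm j]).@[gpt t]) *m invmx vdm.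
    by rewrite -mulmat_vdm mulmxK // vdm_unit.
  rewrite mxtrace_mulC mulmxA mulVmx ?vdm_unit // mul1mx mxtrace_diag.
  by apply: eq_bigr => s _; rewrite !mxE mevalM.
by rewrite det_mulmx det_tr mulf_neq0 // -unitfE -unitmxE vdm_unit.
Qed.

End Split.

Lemma phi_ext (F F' : 'I_c -> {mpoly k[n.+1]}) j m : (forall i, F i = F' i) -> phi d hcn F j m = phi d hcn F' j m.
Proof. by move=> e; rewrite /phi; case: (lead _ _ _ _) => // i; rewrite e. Qed.

Lemma Phi_ext (F F' : 'I_c -> {mpoly k[n.+1]}) j b : (forall i, F i = F' i) -> Phi d hcn F j b = Phi d hcn F' j b.
Proof. by move=> e; apply/matrixP => x y; rewrite !mxE (phi_ext _ _ e). Qed.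

Lemma trform_ext (F F' : 'I_c -> {mpoly k[n.+1]}) a : (forall i, F i = F' i) ->
    forms d F -> forms d F' ->
    (forall j, (j <= c)%N -> Phi d hcn F j T \in unitmx) ->
  trform d hcn F a = trform d hcn F' a.
Proof.
move=> e FH FH' gen.
have gen' j : (j <= c)%N -> Phi d hcn F' j T \in unitmx.
  by move=> jc; rewrite -(Phi_ext _ _ e) gen.
have nfE f : nf d hcn F f = nf d hcn F' f.
  apply: (nfP FH ltT gen); first exact: nf_nrmp.
  have [g gE] := nf_ideal FH' ltT gen' f.
  by exists g; rewrite gE; apply: eq_bigr => i _; rewrite e.
apply/matrixP => i j; rewrite [LHS]mxE [RHS]mxE; apply: eq_bigr => p _.
by rewrite [LHS]mxE [RHS]mxE /red nfE.
Qed.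

Lemma Phi_power L j : Phi d hcn (splitF L 0) j T = 1%:M.
Proof.
have e i : splitF L 0 i = 'X_[dz d hcn i].
  rewrite /splitF; under eq_bigr => l _ do rewrite mul0r scale0r subr0.
  by rewrite prodr_const card_ord mpolyXn.
apply/matrixP => x y; rewrite !mxE.
have -> : phi d hcn (splitF L 0) j (enum_val x : 'X_{1..n.+1 < T}) =
    'X_[(enum_val x : 'X_{1..n.+1 < T})].
  rewrite /phi /lead; case: pickP => // i /and3P[_ le _].
  by rewrite e -mpolyXD addmC dz_le.
by rewrite mcoeffX -bmeqP (inj_eq enum_val_inj).
Qed.

(** The conditions hold for products of linear forms in z_i and t times the last
    variable, for all but finitely many t, because the matrices Phi are the
    identity at t = 0. *)
Lemma generic_complete_intersection :
  generic (n := n) d (fun F : 'I_c -> {mpoly k[n.+1]} => complete_intersection d F).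
Proof.
pose a := apex.
exists (fun v => (\prod_(j <- iota 0 c.+1) PhiD j v) * \det (trformN a v)).
have PP : polyf (fun v => \prod_(j <- iota 0 c.+1) PhiD j v).
  by apply: polyf_prod => j _; apply: polyf_PhiD.
split.
- by apply: polyfM => //; apply: polyf_trformN.
- have [L uL sL] := uniq_seq_of_size k (dmax d).
  have sL' i : (tnth d i <= size L)%N by rewrite sL ltnW // lt_dmax.
  pose V (t : k) : coordT -> k := fun s => cf (splitF L t) s.
  have VE t i : form_of (V t) i = splitF L t i.
    by rewrite [RHS](form_sumE i (splitF_forms _ _)).
  have hV s : polyf (fun x : unit -> k => V (x tt) s).
    move: (cmon s); rewrite /V /cf.
    suff : polymp (fun x : unit -> k => splitF L (x tt) (tag s)) by move=> h m; apply: h.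
    apply: polymp_prod => l m.
    apply: (polyf_ext (polyfD (polyfC _ ('X_(zi hcn (tag s)))@_m)
      (polyfM (polyfX k tt) (polyfC _ (- L`_l * ('X_ord_max)@_m))))) => x.
    by rewrite mcoeffB mcoeffZ mulNr mulrN mulrA.
  pose W j (x : unit -> k) := if (j <= c)%N then PhiD j (V (x tt)) else x tt.
  have WP j : polyf (W j).
    rewrite /W; case: (j <= c)%N; last exact: polyfX.
    exact: (polyf_comp (polyf_PhiD j) hV).
  have W0 j : exists x, W j x != 0.
    rewrite /W; case: (j <= c)%N; last by exists (fun=> 1); rewrite oner_neq0.
    exists (fun=> 0); rewrite /PhiD (Phi_ext _ _ (VE 0)) Phi_power det1.
    exact: oner_neq0.
  have [x hx] := @polyf_nonroot_prod k unit nat (iota 0 c.+2) W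
    (fun j _ => WP j) (fun j _ => W0 j).
  set t := x tt in hx *.
  have h j : (j <= c.+1)%N -> (if (j <= c)%N then PhiD j (V t) else t) != 0.
    move=> jc; move: hx; apply: contraNneq => j0; rewrite prodf_seq_eq0.
    apply/hasP; exists j; first by rewrite mem_iota.
    by apply/eqP.
  have t0 : t != 0 by have := h c.+1 (leqnn _); rewrite ltnn.
  have D0 j : (j <= c)%N -> PhiD j (V t) != 0.
    by move=> jc; have := h j (leqW jc); rewrite jc.
  have gen1 j : (j <= c)%N -> Phi d hcn (form_of (V t)) j T \in unitmx.
    by move=> jc; rewrite unitmxE unitfE D0.
  have gen2 j : (j <= c)%N -> Phi d hcn (splitF L t) j T \in unitmx.
    by move=> jc; rewrite -(Phi_ext _ _ (VE t)) gen1.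
  exists (V t); apply: mulf_neq0.
    rewrite prodf_seq_neq0; apply/allP => j; rewrite mem_iota => /andP[_ jc].
    by apply: D0; rewrite -ltnS.
  rewrite trformNE // detZ mulf_neq0 ?expf_neq0 ?D0 //.
  have := det_trform_split uL sL' t0 gen2.
  have FH := splitF_forms L t.
  by rewrite -(trform_ext a (VE t)) //; apply: form_of_forms.
- move=> F hF; rewrite mulf_eq0 negb_or prodf_seq_neq0 => /andP[/allP D0 T0].
  set v := fun s => cf F s in D0 T0.
  have FE i : form_of v i = F i by rewrite [RHS](form_sumE i hF).
  have gen1 j : (j <= c)%N -> Phi d hcn (form_of v) j T \in unitmx.
    move=> jc; rewrite unitmxE unitfE; have := D0 j; rewrite mem_iota /=.
    by rewrite add0n ltnS jc => /(_ isT).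
  have gen2 j : (j <= c)%N -> Phi d hcn F j T \in unitmx.
    by move=> jc; rewrite -(Phi_ext _ _ FE) gen1.
  apply: (complete_intersection_of_trform hd hF ltT gen2).
  exists a; move: T0; rewrite trformNE // detZ mulf_eq0 negb_or => /andP[_].
  by rewrite (trform_ext a FE) //; apply: form_of_forms.
Qed.

End GenericCI.

(** * Homogeneous relations *)

Section Relations.
Variables (k : closedFieldType) (n c : nat) (d : c.-tuple nat).
Variable F : 'I_c -> {mpoly k[n.+1]}.

Lemma pihomogM t e (g f : {mpoly k[n.+1]}) : f \is e.-homog ->
  pihomog mdeg t (g * f) = if (e <= t)%N then pihomog mdeg (t - e) g * f else 0.
Proof.
move=> hf; pose K := maxn (msize g) t.+1.
have gK : (msize g <= K)%N by rewrite leq_maxl.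
rewrite {1}(pihomog_partitionE gK) mulr_suml raddf_sum /=.
have E (s : 'I_K) : pihomog mdeg t (pihomog mdeg s g * f) =
    if (s + e)%N == t then pihomog mdeg s g * f else 0.
  have h : pihomog mdeg s g * f \is (s + e).-homog.
    by apply: dhomogM => //; apply: pihomogP.
  by case: eqP => [<-|/eqP ne]; [rewrite pihomog_dE|rewrite (pihomog_ne0 ne)].
rewrite (eq_bigr _ (fun s _ => E s)); case: leqP => [le|lt]; last first.
  by rewrite big1 // => s _; case: eqP => // st; lia.
have lt : (t - e < K)%N by rewrite /K; lia.
rewrite (bigD1 (Ordinal lt)) //= subnK // eqxx big1 ?addr0 // => s ne.
case: eqP => // st; case/eqP: ne; apply: val_inj => /=; lia.
Qed.

(** Keep the homogeneous components of the cofactors of the right degree. *)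
Lemma generated_homog f t : forms d F -> f \is t.-homog -> generated_by F f ->
  exists g : 'I_c -> {mpoly k[n.+1]}, f = \sum_i g i * F i /\
    forall i, ((tnth d i <= t)%N -> g i \is (t - tnth d i).-homog) /\
              ((t < tnth d i)%N -> g i = 0).
Proof.
move=> hF hf [g gE].
exists (fun i => if (tnth d i <= t)%N then pihomog mdeg (t - tnth d i) (g i) else 0).
split; last by move=> i; case: leqP => // _; split=> // _; apply: pihomogP.
rewrite -(pihomog_dE hf) gE raddf_sum /=; apply: eq_bigr => i _.
by rewrite (pihomogM _ _ (hF i)); case: leqP; rewrite ?mul0r.
Qed.

Lemma dhomog0_const (p : {mpoly k[n.+1]}) : p \is 0.-homog -> p = (p@_0%MM)%:MP.
Proof. by move=> hp; apply: msize1_polyC; apply: msize_homog hp. Qed.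

(** Differentiating a relation between the equations at a point of the smooth
    scheme X gives a relation between the gradients. *)
Lemma smooth_const_relation (g : 'I_c -> {mpoly k[n.+1]}) j a :
  smooth_ci d F -> \sum_i g i * F i = 0 -> g j = a%:MP -> a = 0.
Proof.
move=> [[hF hdim hI] smooth] rel gj; apply/eqP/negPn/negP => a0.
have [e [[y ay] _] _] := hdim.
have : (1 : {mpoly k[e.+1]}) = 0; last by move/eqP; rewrite oner_eq0.
apply: ay => x Xx; case/eqP: a0.
have rf : row_free (jacobian F x) by rewrite /row_free smooth.
pose u : 'rV[k]_c := \row_i (g i).@[fun l => x l 0].
have uJ : u *m jacobian F x = 0.
  apply/rowP => l; rewrite mxE [RHS]mxE.
  have /(congr1 (fun p => (p^`M(l)).@[fun l => x l 0])) := rel.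
  rewrite mderiv0 meval0 => h; rewrite -[RHS]h.
  rewrite (big_morph _ (mderivD l) (mderiv0 _ l)) raddf_sum /=.
  apply: eq_bigr => i _; rewrite !mxE mderivM mevalD !mevalM.
  by have [_ ->] := Xx; rewrite mulr0 add0r.
have u0 : u = 0 by apply/eqP; rewrite -(mulmx_free_eq0 u rf) uJ.
have : u 0 j = 0 by rewrite u0 mxE.
by rewrite mxE gj mevalC.
Qed.

(** * Linear maps acting trivially *)

Definition lin (v : 'rV[k]_n.+1) : {mpoly k[n.+1]} := \sum_j v 0 j *: 'X_j.

Lemma lin_meval v (x : 'cV[k]_n.+1) : (lin v).@[fun j => x j 0] = (v *m x) 0 0.
Proof.
rewrite raddf_sum mxE /=; apply: eq_bigr => j _.
by rewrite mevalZ mevalXU.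
Qed.

Lemma lin_homog v : lin v \is 1.-homog.
Proof. by apply: rpred_sum => j _; rewrite dhomogZ // dhomogX /= mdeg1. Qed.

Lemma not_scalar_row (g : 'M[k]_n.+1) : (forall a, g <> a%:M) ->
  exists u : 'rV[k]_n.+1, ~~ (u *m g <= u)%MS.
Proof.
move=> ns; pose e_ i : 'rV[k]_n.+1 := delta_mx 0 i.
have [/existsP[i hi]|h1] := boolP [exists i, ~~ (e_ i *m g <= e_ i)%MS].
  by exists (e_ i).
have gd i : exists a, e_ i *m g = a *: e_ i.
  move: h1; rewrite negb_exists => /forallP/(_ i); rewrite negbK.
  by case/sub_rVP=> a ->; exists a.
have ge i l : g i l = (i == l)%:R * g i i.
  have [a ha] := gd i; have e t : g i t = a * (i == t)%:R.
    have := congr1 (fun M : 'rV_n.+1 => M 0 t) ha.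
    by rewrite -rowE !mxE eqxx /= eq_sym.
  by rewrite !e eqxx mulr1 mulrC.
have [i hi] : exists i, g i i != g 0 0.
  have [/existsP//|] := boolP [exists i, g i i != g 0 0].
  rewrite negb_exists => /forallP h; case: (ns (g 0 0)).
  apply/matrixP => i l; rewrite mxE ge; have := h i; rewrite negbK => /eqP ->.
  by rewrite mulr_natl.
have i0 : i != 0 by apply: contraNneq hi => ->.
exists (e_ 0 + e_ i); apply/negP => /sub_rVP[a].
rewrite mulmxDl -!rowE => /rowP e.
have gi0 : g i 0 = 0 by rewrite ge (negbTE i0) mul0r.
have g0i : g 0 i = 0 by rewrite ge eq_sym (negbTE i0) mul0r.
have := e 0; have := e i.
rewrite !mxE !eqxx (eq_sym 0 i) (negbTE i0) gi0 g0i.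
rewrite addr0 !add0r addr0 mulr1 => <- e0; case/eqP: hi.
by rewrite e0.
Qed.

Lemma mulmx_col m p q (A : 'M[k]_(m, p)) (B : 'M[k]_(p, q)) j :
  A *m col j B = col j (A *m B).
Proof. by rewrite !colE mulmxA. Qed.

(** If g is not scalar, pick u with u g not proportional to u; the quadrics
    (u g)(x) v(x) - (v g)(x) u(x), v modulo u, vanish on X and span a space of
    dimension n, whereas X lies on at most c < n independent quadrics. *)
Lemma trivial_on_scalar (g : 'M[k]_n.+1) :
    (forall i, (2 <= tnth d i)%N) -> (c < n)%N -> complete_intersection d F ->
    trivial_on (zeros F) g ->
  exists a, g = a%:M.
Proof.
move=> hd2 cn [hF _ hI] tg.
have [/eqP e|ns] := boolP (g == (g 0 0)%:M); first by exists (g 0 0).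
have [|u ug] := @not_scalar_row g.
  by move=> a ga; case/eqP: ns; rewrite ga mxE eqxx.
pose q (v : 'rV[k]_n.+1) := lin (u *m g) * lin v - lin (v *m g) * lin u.
have qI v : generated_by F (q v).
  apply/hI => x Xx; have [a ga] := tg x Xx.
  rewrite mevalB !mevalM !lin_meval -!mulmxA ga -!scalemxAr !mxE.
  by rewrite -mulrA [X in a * X]mulrC mulrA subrr.
have qh v : q v \is 2.-homog.
  by apply: rpredB; rewrite -[2%N]/(1 + 1)%N; apply: dhomogM; apply: lin_homog.
have /fin_all_exists[al alP] i : exists al : 'I_c -> k,
    q (delta_mx 0 i) = \sum_l al l *: F l.
  have [h [hE hh]] := generated_homog hF (qh (delta_mx 0 i)) (qI _).
  exists (fun l => (h l)@_0%MM); rewrite hE; apply: eq_bigr => l _.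
  have [h1 h2] := hh l; rewrite -mul_mpolyC; congr (_ * _).
  have [le|/h2 ->] := leqP (tnth d l) 2; last by rewrite mcoeff0.
  by apply: dhomog0_const; have := h1 le; rewrite (_ : 2 - _ = 0)%N //; have := hd2 l; lia.
pose al' := \matrix_(i, l) al i l.
have linE (v : 'rV[k]_n.+1) : v = \sum_i v 0 i *: delta_mx 0 i by exact: row_sum_delta.
have linP a v w : lin (a *: v + w) = a *: lin v + lin w.
  rewrite /lin scaler_sumr -big_split /=; apply: eq_bigr => j _.
  by rewrite !mxE scalerDl scalerA.
have qP a v w : q (a *: v + w) = a *: q v + q w.
  rewrite /q mulmxDl -scalemxAl !linP mulrDr mulrDl opprD addrACA scalerBr.
  by rewrite -!scalerAl -!scalerAr.
have q0 : q 0 = 0 by have := qP (-1) 0 0; rewrite !scaleN1r !addNr.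
have qker (v : 'rV_n.+1) : v *m al' = 0 -> q v = 0.
  move=> va; have -> : q v = \sum_i v 0 i *: q (delta_mx 0 i).
    rewrite {1}(linE v); elim: (index_enum _) => [|i r ih]; first by rewrite !big_nil.
    by rewrite !big_cons qP ih.
  under eq_bigr => i _ do rewrite alP scaler_sumr.
  rewrite exchange_big big1 //= => l _.
  have : (v *m al') 0 l = 0 by rewrite va mxE.
  rewrite mxE => h; rewrite -[RHS](scale0r (F l)) -h scaler_suml.
  by apply: eq_bigr => i _; rewrite mxE scalerA.
have [x0 [ux0 gx0]] : exists x0 : 'cV[k]_n.+1, u *m x0 = 0 /\ (u *m g *m x0) 0 0 != 0.
  have : u *m g *m cokermx u != 0 by rewrite -submxE.
  case/rV_neq0_coord=> j hj; exists (col j (cokermx u)).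
  by rewrite !mulmx_col mulmx_coker col0 mxE.
have qu v : q v = 0 -> (v <= u)%MS.
  move=> qv; have qx (x : 'cV[k]_n.+1) : (u *m g *m x) 0 0 * (v *m x) 0 0 =
      (v *m g *m x) 0 0 * (u *m x) 0 0.
    have := congr1 (meval (fun j => x j 0)) qv.
    by rewrite meval0 mevalB !mevalM !lin_meval => /eqP; rewrite subr_eq0 => /eqP.
  have kx (x : 'cV[k]_n.+1) : u *m x = 0 -> (u *m g *m x) 0 0 * (v *m x) 0 0 = 0.
    by move=> ux; rewrite qx ux [X in _ * X]mxE mulr0.
  have vx0 : (v *m x0) 0 0 = 0.
    by have /eqP := kx _ ux0; rewrite mulf_eq0 (negbTE gx0) => /eqP.
  rewrite submxE; apply/eqP/rowP => j; rewrite [RHS]mxE.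
  have -> : (v *m cokermx u) 0 j = (v *m col j (cokermx u)) 0 0.
    by rewrite mulmx_col [RHS]mxE.
  set x := col j _; have ux : u *m x = 0 by rewrite /x mulmx_col mulmx_coker col0.
  have D (w : 'rV[k]_n.+1) : (w *m (x + x0)) 0 0 = (w *m x) 0 0 + (w *m x0) 0 0.
    by rewrite mulmxDr mxE.
  have := kx (x + x0); rewrite mulmxDr ux ux0 addr0 => /(_ erefl)/eqP.
  by rewrite !D vx0 addr0 mulrDl kx // add0r mulf_eq0 (negbTE gx0) => /eqP.
have : (\rank (kermx al') <= \rank u)%N.
  apply/mxrankS/row_subP => i; apply: qu; apply: qker.
  by rewrite -row_mul mulmx_ker row0.
rewrite mxrank_ker; have := rank_leq_col al'; have := rank_leq_row u.
by move=> h1 h2 h3; lia.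
Qed.

End Relations.

(** * Normalized eigenbases *)

(** The polynomial X ^ m - mu is separable. *)
Lemma diagonalizable_of_power (k : closedFieldType) N (A : 'M[k]_N.+1) m mu :
  A ^+ m = mu%:M -> m%:R != 0 :> k -> mu != 0 -> diagonalizable A.
Proof.
move=> Am m0 mu0.
have mpos : (0 < m)%N by case: m m0 {Am} => //; rewrite eqxx.
pose p : {poly k} := 'X^m - mu%:P.
have sp : separable_poly p.
  rewrite unlock; apply/Bezout_coprimepP.
  exists (- (mu^-1)%:P, (mu * m%:R)^-1 *: 'X) => /=.
  rewrite (_ : _ + _ = 1) ?eqpxx // /p derivB derivXn derivC subr0.
  have e1 : 'X * 'X^(m.-1) = 'X^m :> {poly k} by rewrite -exprS prednK.
  have e2 : (mu * m%:R)^-1 * m%:R = mu^-1 by rewrite invfM -mulrA mulVf // mulr1.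
  have e3 : 'X^(m.-1) *+ m = (m%:R)%:P * 'X^(m.-1) :> {poly k}.
    by rewrite polyCMn polyC1 mulr_natl.
  rewrite e3 -mul_polyC.
  transitivity (- (mu^-1)%:P * ('X * 'X^(m.-1)) + (mu^-1 * mu)%:P
    + ((mu * m%:R)^-1 * m%:R)%:P * ('X * 'X^(m.-1))).
    by rewrite -e1 !polyCM; ring.
  by rewrite e2 mulVf // polyC1; ring.
have mp : p \is monic by rewrite /p monicXnsubC.
have [r] := closed_field_poly_normal p.
have /monicP -> := mp; rewrite scale1r => rE.
apply/diagonalizableP; exists r.
  by rewrite -separable_prod_XsubC -rE.
rewrite -rE; apply: mxminpoly_min.
by rewrite /p rmorphB rmorphXn /= horner_mx_X horner_mx_C Am subrr.
Qed.

(** Grouping the Leibniz expansion of a determinant according to the classes of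
    the columns chosen by each permutation yields an assignment of classes to
    the rows whose diagonal blocks are all invertible; these blocks may then be
    normalized to the identity. *)
Lemma normalize_eigenbasis (k : fieldType) N (A B : 'M[k]_N) (D : 'rV[k]_N) :
    B \in unitmx -> A *m B = B *m diag_mx D ->
  exists (f : 'I_N -> k) (C : 'M[k]_N), [/\ C \in unitmx,
    A *m C = C *m diag_mx (\row_i f i) & forall i j, f i = f j -> C i j = (i == j)%:R].
Proof.
move=> uB AB.
pose lab (j : 'I_N) := odflt j [pick j' | D 0 j' == D 0 j].
have labD j : D 0 (lab j) = D 0 j.
  by rewrite /lab; case: pickP => [j' /eqP|].
have labP j j' : (lab j == lab j') = (D 0 j == D 0 j').
  apply/eqP/eqP => [e|e]; first by rewrite -(labD j) e labD.
  rewrite /lab e; case: pickP => // /(_ j'); by rewrite eqxx.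
pose Bg (g : {ffun 'I_N -> 'I_N}) : 'M[k]_N :=
  \matrix_(i, j) if lab j == g i then B i j else 0.
have [g dg] : exists g, \det (Bg g) != 0.
  have [/existsP//|] := boolP [exists g, \det (Bg g) != 0].
  rewrite negb_exists => /forallP h.
  have : \det B != 0 by rewrite -unitfE -unitmxE.
  have -> : \det B = \sum_g \det (Bg g); last first.
    by rewrite big1 ?eqxx // => g _; apply/eqP; have := h g; rewrite negbK.
  rewrite /determinant (partition_big (fun s : 'S_N => [ffun i => lab (s i)]) predT) //=.
  apply: eq_bigr => g _; rewrite big_mkcond; apply: eq_bigr => s _ /=.
  case: eqP => [<-|ne].
    by congr (_ * _); apply: eq_bigr => i _; rewrite mxE ffunE eqxx.
  have [i hi] : exists i, lab (s i) != g i.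
    have [/existsP//|] := boolP [exists i, lab (s i) != g i].
    rewrite negb_exists => /forallP h'; case: ne; apply/ffunP => i.
    by rewrite ffunE; apply/eqP; have := h' i; rewrite negbK.
  by rewrite (bigD1 i) //= mxE (negbTE hi) mul0r mulr0.
have uBg : Bg g \in unitmx by rewrite unitmxE unitfE.
pose f i := D 0 (g i).
have gf i j : (lab j == g i) = (D 0 j == f i).
  have [j0 hj0] : exists j0, lab j0 = g i.
    have [/existsP[j0 /eqP]|] := boolP [exists j0, lab j0 == g i]; first by exists j0.
    rewrite negb_exists => /forallP h; case/eqP: dg.
    rewrite (expand_det_row _ i) big1 // => j1 _.
    by rewrite mxE (negbTE (h j1)) mul0r.
  by rewrite /f -hj0 labP labD.
have BD : diag_mx (\row_i f i) *m Bg g = Bg g *m diag_mx D.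
  apply/matrixP => i j; rewrite mul_diag_mx mul_mx_diag !mxE gf.
  by case: eqP => [->|]; rewrite ?mulr0 ?mul0r // mulrC.
have BDi : diag_mx D *m invmx (Bg g) = invmx (Bg g) *m diag_mx (\row_i f i).
  apply: (can_inj (mulKmx uBg)); rewrite mulKVmx // mulmxA -BD -mulmxA mulmxV //.
  by rewrite mulmx1.
exists f, (B *m invmx (Bg g)); split.
- by rewrite unitmx_mul uB unitmx_inv.
- by rewrite mulmxA AB -!mulmxA BDi.
move=> i j fij.
rewrite -{1}(subrK (Bg g) B) mulmxDl mulmxV // mxE [1%:M i j]mxE mxE big1 ?add0r //.
move=> l _; rewrite !mxE gf; case: eqP => [_|ne]; first by rewrite subrr mul0r.
have := congr1 (fun M : 'M_N => M l j) BDi; rewrite mul_diag_mx mul_mx_diag !mxE.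
rewrite mulrC => /eqP; rewrite -subr_eq0 -mulrBr mulf_eq0 => /orP[/eqP ->|].
  by rewrite mulr0.
by rewrite subr_eq0 -fij => /eqP /ne.
Qed.

(** The normalization leaves as parameters of the eigenbasis only the entries
    between different eigenvalues. *)
Lemma power_eigenbasis (k : closedFieldType) N (A : 'M[k]_N.+1) m mu :
    A ^+ m = mu%:M -> m%:R != 0 :> k -> mu != 0 ->
  exists (f : 'I_N.+1 -> k) (C : 'M[k]_N.+1), [/\ C \in unitmx,
    A *m C = C *m diag_mx (\row_i f i) & forall i j, f i = f j -> C i j = (i == j)%:R].
Proof.
move=> Am m0 mu0; have [P uP /(diagonalizable_forLR uP)[D AE]] :=
  diagonalizable_of_power Am m0 mu0.
apply: (@normalize_eigenbasis _ _ A (invmx P) D); first by rewrite unitmx_inv.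
have {}AE := etrans AE (conjVmx (diag_mx D) uP).
by rewrite AE -!mulmxA mulmxV // mulmx1.
Qed.

(** * Counting monomials of given weight *)

Lemma card_pairs (A B : finType) (Q : pred (A * B)) :
  #|[set p | Q p]| = (\sum_a #|[set b | Q (a, b)]|)%N.
Proof.
transitivity (\sum_a \sum_(b | Q (a, b)) 1)%N.
  rewrite pair_big_dep -sum1_card; apply: eq_bigl => -[a b].
  by rewrite inE.
apply: eq_bigr => a _; rewrite -sum1_card; apply: eq_bigl => b.
by rewrite inE.
Qed.

Lemma card_pairs_swap (A B : finType) (Q : pred (A * B)) :
  #|[set p | Q p]| = (\sum_b #|[set a | Q (a, b)]|)%N.
Proof.
rewrite -(card_pairs (fun p : B * A => Q (p.2, p.1))).
rewrite -(card_imset (f := fun p : A * B => (p.2, p.1))); last first.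
  by move=> [a b] [a' b'] [-> ->].
apply: eq_card => -[b a]; rewrite inE /=; apply/imsetP/idP.
  by case=> -[a' b']; rewrite inE /= => q [-> ->].
by move=> q; exists (a, b); rewrite ?inE.
Qed.

Section Monomials.
Variable N : nat.
Implicit Types (P Q : pred 'X_{1..N}) (m v : 'X_{1..N}) (t e : nat).

(** Stated for predicates on all monomials, so that conditions on the weight can
    be transported from one degree to another. *)
Definition mons t P : nat :=
  #|[set m : 'X_{1..N < t.+1} | (mdeg m == t) && P (m : 'X_{1..N})]|.

Lemma mons_ge t P (X : finType) (A : {set X}) (h : X -> 'X_{1..N}) :
    {in A &, injective h} -> (forall x, x \in A -> mdeg (h x) = t) ->
    (forall x, x \in A -> P (h x)) ->
  (#|A| <= mons t P)%N.
Proof.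
move=> hI ht hP.
pose h' x : 'X_{1..N < t.+1} := insubd (BMultinom (bm0_proof N t)) (h x).
have h'E x : x \in A -> h' x = h x :> 'X_{1..N}.
  by move=> xA; rewrite /h' insubdK // unfold_in /= ht.
rewrite -(card_in_imset (f := h')); last first.
  by move=> x y xA yA e; apply: hI => //; rewrite -h'E // e h'E.
apply: subset_leq_card; apply/subsetP => _ /imsetP[x xA ->].
by rewrite inE h'E // ht // eqxx hP.
Qed.

Lemma mons_sub t P Q : (forall m, mdeg m = t -> P m -> Q m) -> (mons t P <= mons t Q)%N.
Proof.
move=> h; apply: subset_leq_card; apply/subsetP => m; rewrite !inE.
by case/andP=> /eqP mt /(h _ mt) ->; rewrite mt eqxx.
Qed.

Lemma eq_mons t P Q : (forall m, mdeg m = t -> P m = Q m) -> mons t P = mons t Q.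
Proof.
by move=> h; apply/eqP; rewrite eqn_leq; apply/andP; split; apply: mons_sub => m /h ->.
Qed.

Lemma mons_split t P Q :
  mons t P = (mons t (fun m => P m && Q m) + mons t (fun m => P m && ~~ Q m))%N.
Proof.
rewrite {1}/mons -(cardsID [set m : 'X_{1..N < t.+1} | Q m]).
by congr (_ + _)%N; apply: eq_card => m; rewrite !inE; case: (Q m);
  rewrite ?andbT ?andbF.
Qed.

Lemma mons_pos t P m : mdeg m = t -> P m -> (0 < mons t P)%N.
Proof.
move=> mt Pm; rewrite -(cards1 (tt)); apply: (mons_ge (h := fun=> m)) => //.
by case; case.
Qed.

Lemma mons_shift t e v P : mdeg v = e ->
  mons (t + e) P = (mons t (fun m => P (m + v)%MM) +
    mons (t + e) (fun m => P m && ~~ (v <= m)%MM))%N.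
Proof.
move=> ve; rewrite {1}/mons -(cardsID [set m : 'X_{1..N < (t + e).+1} | (v <= m)%MM]).
congr (_ + _)%N; last first.
  by apply: eq_card => m; rewrite !inE; case: (v <= m)%MM; rewrite ?andbT ?andbF.
apply/eqP; rewrite eqn_leq; apply/andP; split.
  apply: (mons_ge (h := fun m : 'X_{1..N < (t + e).+1} => (m - v)%MM)).
  - move=> x y; rewrite !inE => /andP[_ vx] /andP[_ vy] /(congr1 (fun m => m + v)%MM).
    by rewrite !submK // => h; apply: val_inj.
  - move=> x; rewrite !inE => /andP[/andP[/eqP xt _] vx].
    by have := congr1 (@mdeg N) (submK vx); rewrite mdegD xt ve => /addIn.
  - by move=> x; rewrite !inE => /andP[/andP[_ Px] vx]; rewrite submK.
set B := (X in (_ <= #|X|)%N).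
have -> : #|B| = mons (t + e) (fun m => P m && (v <= m)%MM).
  by apply: eq_card => m; rewrite !inE andbA.
apply: (mons_ge (h := fun m : 'X_{1..N < t.+1} => (m + v)%MM)).
- by move=> x y _ _ /addIm h; apply: val_inj.
- by move=> x; rewrite inE => /andP[/eqP xt _]; rewrite mdegD xt ve.
- by move=> x; rewrite inE => /andP[_ ->]; rewrite lem_addl.
Qed.

Lemma mons_shift1 t a P :
  mons t.+1 P = (mons t (fun m => P (m + U_(a))%MM) +
    mons t.+1 (fun m => P m && (m a == 0%N)))%N.
Proof.
rewrite -[t.+1]addn1 (@mons_shift t 1 U_(a)) ?mdeg1 //; congr (_ + _)%N.
by apply: eq_mons => m _; rewrite lep1mP negbK.
Qed.

Lemma mons_shift1_le t a P : (mons t (fun m => P (m + U_(a))%MM) <= mons t.+1 P)%N.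
Proof. by rewrite (mons_shift1 t a) leq_addr. Qed.

Lemma mons1 P : mons 1 P = #|[set i : 'I_N | P U_(i)%MM]|.
Proof.
apply/eqP; rewrite eqn_leq; apply/andP; split; last first.
  apply: (mons_ge (h := fun i => U_(i)%MM)).
  - by move=> i j _ _ /eqP; rewrite eq_mnm1 => /eqP.
  - by move=> i _; rewrite mdeg1.
  - by move=> i; rewrite inE.
rewrite -(card_in_imset (f := fun i : 'I_N => insubd (BMultinom (bm0_proof N 1)) U_(i)%MM)); last first.
  move=> i j _ _ /(congr1 val); rewrite !insubdK ?unfold_in /= ?mdeg1 // => /eqP.
  by rewrite eq_mnm1 => /eqP.
apply: subset_leq_card; apply/subsetP => m; rewrite inE => /andP[/mdeg1P[i /eqP mi] Pm].
apply/imsetP; exists i; first by rewrite inE -mi.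
by apply: val_inj; rewrite insubdK ?unfold_in /= ?mdeg1.
Qed.

Lemma mons_sum t P : mons t P =
  (\sum_(m : 'X_{1..N < t.+1} | mdeg m == t) P (m : 'X_{1..N}))%N.
Proof.
rewrite /mons -sum1_card [RHS]big_mkcond [LHS]big_mkcond; apply: eq_bigr => m _.
by rewrite inE; case: (mdeg m == t) => //=; case: (P m).
Qed.

(** Double counting of pairs of a monomial and a variable dividing it: a
    monomial with a repeated variable has fewer variables than its degree. *)
Lemma mons_rec t P :
  (\sum_a mons t (fun m => P (m + U_(a))%MM) +
    mons t.+1 (fun m => P m && [exists i, 1 < m i]) <= t.+1 * mons t.+1 P)%N.
Proof.
apply: (@leq_trans (\sum_a mons t.+1 (fun m => P m && (m a != 0%N)) +
    mons t.+1 (fun m => P m && [exists i, 1 < m i])))%N.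
  rewrite leq_add2r; apply: leq_sum => a _.
  apply: (mons_ge (h := fun m : 'X_{1..N < t.+1} => (m + U_(a))%MM)).
  - by move=> x y _ _ /addIm h; apply: val_inj.
  - by move=> x; rewrite inE => /andP[/eqP xt _]; rewrite mdegD xt mdeg1 addn1.
  - by move=> x; rewrite inE => /andP[_ ->]; rewrite mnmDE mnm1E eqxx addn1.
under eq_bigr => a _ do rewrite mons_sum.
rewrite exchange_big /= !mons_sum -big_split /= big_distrr /=.
apply: leq_sum => m /eqP mt; case: (P m) => /=; last by rewrite big1.
rewrite muln1 -[in X in (_ <= X)%N]mt mdegE.
case: existsP => [[i mi]|_]; last first.
  by rewrite addn0; apply: leq_sum => a _; case: ((m : 'X_{1..N}) a).
rewrite (bigD1 i) //= [X in (_ <= X)%N](bigD1 i) //= addnAC leq_add //.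
  by case: ((m : 'X_{1..N}) i) mi => [|[]].
by apply: leq_sum => a _; case: ((m : 'X_{1..N}) a).
Qed.

Lemma mons2_ge P : (#|[set p : 'I_N * 'I_N | P (U_(p.2) + U_(p.1))%MM]| +
   #|[set i : 'I_N | P (U_(i) + U_(i))%MM]| <= 2 * mons 2 P)%N.
Proof.
apply: leq_trans (mons_rec 1 P); apply: leq_add.
  under eq_bigr => a _ do rewrite mons1.
  by rewrite card_pairs.
apply: (mons_ge (h := fun i => (U_(i) + U_(i))%MM)).
- by move=> i j _ _ /mnmP/(_ i); rewrite !mnmDE !mnm1E eqxx; case: eqP.
- by move=> i _; rewrite mdegD !mdeg1.
- move=> i; rewrite inE => ->; apply/existsP; exists i.
  by rewrite mnmDE mnm1E eqxx.
Qed.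

Lemma square_times_inj : injective (fun p : 'I_N * 'I_N => (U_(p.1) + U_(p.1) + U_(p.2))%MM).
Proof.
move=> [i a] [j b] /= /mnmP e.
have ij : i = j.
  have := e i; have := e j; rewrite !mnmDE !mnm1E !eqxx.
  case: (eqVneq i j) => [//|_].
  by case: (a == i) (b == i) (a == j) (b == j) => [] [] [] [].
have := e a; rewrite !mnmDE !mnm1E eqxx ij => /addnI.
by case: eqP => // <-.
Qed.

Lemma mons3_ge P : (#|[set p : 'I_N * ('I_N * 'I_N) | P (U_(p.2.2) + U_(p.2.1) + U_(p.1))%MM]| +
   3 * #|[set p : 'I_N * 'I_N | P (U_(p.1) + U_(p.1) + U_(p.2))%MM]| <= 6 * mons 3 P)%N.
Proof.
set s := #|[set p : 'I_N * 'I_N | _]|.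
have h1 := mons_rec 2 P.
have h2 : (s <= mons 3 (fun m => P m && [exists i, 1 < m i]))%N.
  apply: (mons_ge (h := fun p : 'I_N * 'I_N => (U_(p.1) + U_(p.1) + U_(p.2))%MM)).
  - by move=> p q _ _; apply: square_times_inj.
  - by move=> p _; rewrite !mdegD !mdeg1.
  - move=> p; rewrite inE => ->; apply/existsP; exists p.1.
    by rewrite !mnmDE mnm1E eqxx.
have h3 : (#|[set p : 'I_N * ('I_N * 'I_N) | P (U_(p.2.2) + U_(p.2.1) + U_(p.1))%MM]| + s <=
   \sum_a (2 * mons 2 (fun m => P (m + U_(a))%MM)))%N.
  apply: leq_trans (leq_sum _ (fun a _ => mons2_ge (fun m => P (m + U_(a))%MM))).
  rewrite big_split /=; apply: leq_add.
    by rewrite card_pairs.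
  by rewrite /s card_pairs_swap.
rewrite -big_distrr /= in h3.
move: h1 h2 h3; set x := #|_|; set y := (\sum_(_ < _) _)%N; lia.
Qed.

End Monomials.

Lemma mul_eq_div (k : fieldType) (a x w : k) : a != 0 -> (x * a == w) = (x == w / a).
Proof. by move=> a0; apply/eqP/eqP => [<-|->]; rewrite ?mulfK ?mulfVK. Qed.

Section Weights.
Variables (k : fieldType) (N : nat) (f : 'I_N -> k).
Hypothesis f0 : forall i, f i != 0.
Implicit Types (m : 'X_{1..N}) (w x : k).

Definition wt m : k := \prod_i f i ^+ m i.

Lemma wtD m m' : wt (m + m')%MM = wt m * wt m'.
Proof.
by rewrite /wt -big_split; apply: eq_bigr => i _; rewrite mnmDE exprD.
Qed.

Lemma wtU i : wt U_(i)%MM = f i.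
Proof.
rewrite /wt (bigD1 i) //= mnm1E eqxx expr1 big1 ?mulr1 // => j ne.
by rewrite mnm1E eq_sym (negbTE ne) expr0.
Qed.

Definition nwt t w := mons t (fun m => wt m != w).

Definition mult x := #|[set i | f i == x]|.

(** The dimension of the conjugacy class of the diagonal matrix of the f_i. *)
Definition ncomm := #|[set p : 'I_N * 'I_N | f p.1 != f p.2]|.

Lemma mult_compl x : #|[set j | x != f j]| = (N - mult x)%N.
Proof.
have := cardsC [set i | f i == x]; rewrite card_ord -/(mult x) => h.
have -> : #|[set j | x != f j]| = #|~: [set i | f i == x]|.
  by apply: eq_card => i; rewrite !inE eq_sym.
by lia.
Qed.

Lemma mult_le x : (mult x <= N)%N.
Proof. by rewrite /mult -[X in (_ <= X)%N]card_ord max_card. Qed.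

Lemma ncomm_sum : ncomm = (\sum_i (N - mult (f i)))%N.
Proof.
by rewrite /ncomm card_pairs; apply: eq_bigr => i _; rewrite /= mult_compl.
Qed.

Lemma sum_class x (g : 'I_N -> nat) (a b : nat) :
    (forall i, f i = x -> (a <= g i)%N) -> (forall i, f i != x -> (b <= g i)%N) ->
  (mult x * a + (N - mult x) * b <= \sum_i g i)%N.
Proof.
move=> ha hb; rewrite (bigID (fun i => f i == x)) /=; apply: leq_add.
  rewrite /mult -sum_nat_const; apply: (@leq_trans (\sum_(i | f i == x) a)%N).
    by apply: eq_leq; apply: eq_bigl => i; rewrite inE.
  by apply: leq_sum => i /eqP; apply: ha.
rewrite -mult_compl -sum_nat_const; apply: (@leq_trans (\sum_(i | f i != x) b)%N).
  by apply: eq_leq; apply: eq_bigl => i; rewrite inE eq_sym.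
by apply: leq_sum => i; apply: hb.
Qed.

Lemma mult_disj x y : x != y -> (mult x + mult y <= N)%N.
Proof.
move=> xy; rewrite -leq_subRL ?mult_le // -mult_compl.
apply: subset_leq_card; apply/subsetP => i; rewrite !inE => /eqP ->.
by [].
Qed.

Lemma mult_pos i : (0 < mult (f i))%N.
Proof. by rewrite card_gt0; apply/set0Pn; exists i; rewrite inE. Qed.

Lemma mult_lt i j : f i != f j -> (mult (f i) < N)%N.
Proof. by move=> /mult_disj; have := mult_pos j; lia. Qed.

Lemma ncomm_ge i j : f i != f j -> (2 * N.-1 <= ncomm)%N.
Proof.
move=> ij; have := mult_lt ij; have := mult_pos i.
have := @sum_class (f i) (fun l => N - mult (f l))%N (N - mult (f i)) (mult (f i)).
rewrite -ncomm_sum; set a := mult _.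
have h1 l : f l = f i -> (N - a <= N - mult (f l))%N by move=> ->.
have h2 l : f l != f i -> (a <= N - mult (f l))%N.
  by move=> /mult_disj; rewrite -/a; have := mult_le (f l); lia.
move/(_ h1 h2); move: ncomm => D; nia.
Qed.

Lemma ncomm_ge2 : (forall x, mult x <= N.-2)%N -> (2 <= N)%N -> (2 * N <= ncomm)%N.
Proof.
move=> h N2; rewrite ncomm_sum.
apply: (@leq_trans (\sum_(i < N) 2)%N); first by rewrite sum_nat_const card_ord mulnC.
by apply: leq_sum => i _; have := h (f i); lia.
Qed.

Lemma ncomm_le x : (ncomm <= (N - mult x) * (mult x + N.-1))%N.
Proof.
rewrite ncomm_sum (bigID (fun i => f i == x)) /= mulnDr; apply: leq_add.
  rewrite mulnC -sum_nat_const.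
  apply: (@leq_trans (\sum_(i | f i == x) (N - mult x))%N).
    by apply: leq_sum => i /eqP ->.
  by apply: eq_leq; apply: eq_bigl => i; rewrite inE.
rewrite -mult_compl -sum_nat_const; apply: (@leq_trans (\sum_(i | f i != x) N.-1)%N).
  by apply: leq_sum => i _; have := mult_pos i; lia.
by apply: eq_leq; apply: eq_bigl => i; rewrite inE eq_sym.
Qed.

Let vals := undup [seq f i | i : 'I_N].

Lemma sum_vals (g : k -> nat) : (\sum_i g (f i) = \sum_(x <- vals) mult x * g x)%N.
Proof.
transitivity (\sum_i \sum_(x <- vals) (f i == x) * g x)%N.
  apply: eq_bigr => i _; rewrite (bigD1_seq (f i)) ?undup_uniq //=; last first.
    by rewrite mem_undup; apply: codom_f.
  by rewrite eqxx mul1n big1 ?addn0 // => x; rewrite eq_sym => /negbTE ->.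
rewrite exchange_big; apply: eq_bigr => x _; rewrite -big_distrl /=; congr (_ * _)%N.
by rewrite /mult -sum1_card [RHS]big_mkcond; apply: eq_bigr => i _; rewrite inE; case: eqP.
Qed.

Lemma mult_vals x : x \notin vals -> mult x = 0%N.
Proof.
move=> h; apply/eqP; rewrite cards_eq0; apply/eqP/setP => i; rewrite !inE.
by apply: contraNF h => /eqP <-; rewrite mem_undup; apply: codom_f.
Qed.

(** Writing m(x) for the multiplicity of x, this is the sum over the eigenvalues
    of the inequalities 2 m(x) m(w/x) <= m(x)^2 + m(w/x)^2. *)
Lemma ncomm_le_pairs w : w != 0 ->
  (ncomm <= #|[set p : 'I_N * 'I_N | (f p.1 * f p.2)%R != w]|)%N.
Proof.
move=> w0; rewrite ncomm_sum card_pairs /=.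
have -> : (\sum_a #|[set b | (f a * f b)%R != w]| = \sum_a (N - mult (w / f a)))%N.
  apply: eq_bigr => a _; rewrite -mult_compl; apply: eq_card => b; rewrite !inE.
  by rewrite [f a * _]mulrC mul_eq_div // eq_sym.
suff h : (\sum_a mult (w / f a) <= \sum_a mult (f a))%N.
  rewrite !sumnB; first exact: leq_sub2l.
    by move=> i _; apply: mult_le.
  by move=> i _; apply: mult_le.
rewrite (sum_vals (fun x => mult (w / x))) (sum_vals mult).
have sq : (\sum_(x <- vals) mult (w / x) * mult (w / x) <=
    \sum_(x <- vals) mult x * mult x)%N.
  rewrite -(big_map (fun x => w / x) xpredT (fun y => mult y * mult y)%N).
  rewrite (bigID (fun y => y \in vals)) /= [X in (_ + X)%N]big1 ?addn0; last first.
    by move=> y /mult_vals ->.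
  rewrite -big_filter [X in (_ <= X)%N](bigID (fun y => y \in [seq w / x | x <- vals])) /=.
  rewrite -[X in (_ <= X + _)%N]big_filter; apply: leq_trans (leq_addr _ _).
  apply: eq_leq; apply: perm_big; apply: uniq_perm.
  - rewrite filter_uniq // map_inj_in_uniq ?undup_uniq // => x y.
    rewrite !mem_undup => /codomP[i ->] /codomP[j ->] /(mulfI w0).
    exact: invr_inj.
  - by rewrite filter_uniq ?undup_uniq.
  - by move=> y; rewrite !mem_filter andbC.
have h2 : (2 * \sum_(x <- vals) mult x * mult (w / x) <=
    \sum_(x <- vals) mult x * mult x + \sum_(x <- vals) mult (w / x) * mult (w / x))%N.
  rewrite -big_split /= big_distrr /=; apply: leq_sum => x _.
  by rewrite !mulnn; case: (nat_Cauchy (mult x) (mult (w / x))).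
by move: sq h2; lia.
Qed.

Lemma nwt2_ge w : w != 0 ->
  (ncomm + #|[set i | (f i * f i)%R != w]| <= 2 * nwt 2 w)%N.
Proof.
move=> w0; apply: leq_trans (mons2_ge (fun m => wt m != w)); apply: leq_add.
  apply: leq_trans (ncomm_le_pairs w0) _; apply: eq_leq; apply: eq_card => p.
  by rewrite !inE wtD !wtU mulrC.
by apply: eq_leq; apply: eq_card => i; rewrite !inE wtD !wtU.
Qed.

Definition sqpairs w := #|[set p : 'I_N * 'I_N | (f p.1 * f p.1 * f p.2)%R != w]|.

Lemma nwt3_ge w : w != 0 -> (N * ncomm + 3 * sqpairs w <= 6 * nwt 3 w)%N.
Proof.
move=> w0; apply: leq_trans (mons3_ge (fun m => wt m != w)); apply: leq_add; last first.
  apply: eq_leq; congr (_ * _)%N; apply: eq_card => p.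
  by rewrite !inE !wtD !wtU.
rewrite card_pairs -[X in (X * _)%N]card_ord -sum_nat_const; apply: leq_sum => a _.
have wa : w / f a != 0 by rewrite mulf_neq0 ?invr_neq0.
apply: leq_trans (ncomm_le_pairs wa) _; apply: eq_leq; apply: eq_card => p.
rewrite !inE !wtD !wtU /= [f p.2 * _]mulrC.
by rewrite -[in LHS]mul_eq_div.
Qed.

Lemma sqpairs_ge w mu : (forall x, mult x <= mu)%N -> (N * (N - mu) <= sqpairs w)%N.
Proof.
move=> h; rewrite /sqpairs card_pairs -[X in (X * _)%N]card_ord -sum_nat_const.
apply: leq_sum => i _; apply: leq_trans (leq_sub2l N (h (w / (f i * f i)))) _.
rewrite -mult_compl; apply: eq_leq; apply: eq_card => j; rewrite !inE /=.
have ii : f i * f i != 0 by rewrite mulf_neq0.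
by rewrite [f i * f i * _]mulrC [in RHS]mul_eq_div // eq_sym.
Qed.

Lemma nwt_step t w a : (nwt t (w / f a) <= nwt t.+1 w)%N.
Proof.
apply: leq_trans (mons_shift1_le t a _); apply: mons_sub => m _.
by rewrite wtD wtU mul_eq_div.
Qed.

Lemma nwt_two t w w' : w != w' -> (mons t (predT : pred 'X_{1..N}) <= nwt t w + nwt t w')%N.
Proof.
move=> ww; rewrite /nwt [X in (X <= _)%N](_ : _ = #|[set m : 'X_{1..N < t.+1} | mdeg m == t]|); last first.
  by apply: eq_card => m; rewrite !inE andbT.
apply: leq_trans (leq_card_setU _ _); apply: subset_leq_card; apply/subsetP => m.
rewrite !inE => ->; case: eqP => //= ->; exact: ww.
Qed.

Lemma mons2_all : (N * N + N <= 2 * mons 2 (predT : pred 'X_{1..N}))%N.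
Proof.
apply: leq_trans (mons2_ge _); apply: leq_add.
  by rewrite cardsE card_prod !card_ord.
by rewrite cardsE card_ord.
Qed.

Lemma nwt_half t w : (0 < N)%N -> w != 0 -> (ncomm <= 2 * nwt t.+2 w)%N.
Proof.
move=> N0; elim: t w => [|t ih] w w0.
  by apply: leq_trans (nwt2_ge w0); apply: leq_addr.
have a := Ordinal N0; apply: leq_trans (ih (w / f a) _) _.
  by rewrite mulf_neq0 ?invr_neq0.
by rewrite leq_mul2l nwt_step.
Qed.

(** The estimate through the double counting is too weak when one eigenvalue has
    multiplicity N - 1; there the monomials of given degree without the
    other variable all have the same weight, and are counted directly. *)
Section Reflection.
Variables (b : k) (i0 : 'I_N).
Hypothesis fb : forall i, i != i0 -> f i = b.
Hypothesis fi0 : f i0 != b.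

Lemma card_others : #|[set i | i != i0]| = N.-1.
Proof.
rewrite (_ : [set i | i != i0] = [set~ i0]) ?cardsC1 ?card_ord //.
by apply/setP => i; rewrite !inE.
Qed.

Lemma ncomm_reflection : (ncomm <= 2 * N.-1)%N.
Proof.
have mb : mult b = N.-1.
  rewrite -card_others; apply: eq_card => i; rewrite !inE.
  by case: (eqVneq i i0) => [->|/fb ->]; rewrite ?eqxx ?(negbTE fi0).
have N1 : (0 < N)%N by case: (N) i0 => [[]|].
by have := ncomm_le b; rewrite mb; move: ncomm => D; nia.
Qed.

Let free m := m i0 == 0%N.

Lemma wt_free m : free m -> wt m = b ^+ mdeg m.
Proof.
move=> /eqP m0; rewrite /wt mdegE -prodrXr; apply: eq_bigr => i _.
by case: (eqVneq i i0) => [->|/fb -> //]; rewrite m0 !expr0.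
Qed.

Lemma mons2_free : (N.-1 * N.-1 + N.-1 <= 2 * mons 2 free)%N.
Proof.
apply: leq_trans (mons2_ge _); apply: leq_add; last first.
  rewrite -card_others; apply: subset_leq_card; apply/subsetP => i; rewrite !inE.
  by rewrite /free mnmDE mnm1E => /negbTE ->.
rewrite -card_others -cardsX; apply: subset_leq_card; apply/subsetP => -[i j].
by rewrite !inE /= /free mnmDE !mnm1E => /andP[/negbTE -> /negbTE ->].
Qed.

Lemma mons3_free : (N.-1 * N.-1 <= mons 3 free)%N.
Proof.
rewrite -card_others -cardsX.
apply: (mons_ge (h := fun p : 'I_N * 'I_N => (U_(p.1) + U_(p.1) + U_(p.2))%MM)).
- by move=> p q _ _; apply: square_times_inj.
- by move=> p _; rewrite !mdegD !mdeg1.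
- move=> [i j]; rewrite !inE /= /free !mnmDE !mnm1E.
  by move=> /andP[/negbTE -> /negbTE ->].
Qed.

Lemma nwt2_reflection w : w != b ^+ 2 -> (mons 2 free <= nwt 2 w)%N.
Proof.
by move=> wb; apply: mons_sub => m m2 /wt_free ->; rewrite m2 eq_sym.
Qed.

Lemma nwt3_reflection1 w : w != b ^+ 3 -> (N.-1 * N.-1 <= nwt 3 w)%N.
Proof.
move=> wb; apply: leq_trans mons3_free _.
by apply: mons_sub => m m3 /wt_free ->; rewrite m3 eq_sym.
Qed.

Hypothesis b0 : b != 0.

Lemma nwt3_reflection2 a : a != i0 -> (mons 2 free < nwt 3 (b ^+ 3))%N.
Proof.
move=> ai; apply: leq_trans (mons_shift1_le 2 i0 _).
set Q := fun m => wt (m + U_(i0))%MM != b ^+ 3.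
have [m1 [m1t m1f m1w]] : exists m, [/\ mdeg m = 2%N, ~~ free m & Q m].
  case: (eqVneq (f i0 * f i0) (b * b)) => [e|ne].
    exists (U_(i0) + U_(i0))%MM; split; first by rewrite mdegD !mdeg1.
      by rewrite /free mnmDE mnm1E eqxx.
    rewrite /Q !wtD !wtU e !exprS expr0 mulr1 mulrA.
    by apply: contra fi0 => /eqP h; apply/eqP/(mulfI b0)/(mulfI b0); rewrite !mulrA.
  exists (U_(i0) + U_(a))%MM; split; first by rewrite mdegD !mdeg1.
    by rewrite /free mnmDE mnm1E eqxx.
  rewrite /Q !wtD !wtU (fb ai) mulrAC; apply: contra ne => /eqP h.
  by apply/eqP/(mulIf b0); rewrite h !exprS expr0 mulr1 mulrA.
rewrite (mons_split 2 Q free) -addn1; apply: leq_add.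
  apply: mons_sub => m m2 mf; rewrite mf andbT /Q wtD wtU (wt_free mf) m2.
  by rewrite [b ^+ 3]exprSr (inj_eq (mulfI _)) // expf_neq0.
by apply: (mons_pos m1t); rewrite m1w.
Qed.

End Reflection.
End Weights.

Lemma mdeg2_pair N (u : 'X_{1..N}) : mdeg u = 2%N -> exists i j, u = (U_(i) + U_(j))%MM.
Proof.
move=> ud.
have [i ui] : exists i, u i != 0%N.
  have [/existsP//|] := boolP [exists i, u i != 0%N].
  rewrite negb_exists => /forallP h; move: ud; rewrite mdegE big1 //.
  by move=> l _; apply/eqP; have := h l; rewrite negbK.
have le : (U_(i) <= u)%MM by rewrite lep1mP.
have /mdeg1P[j /eqP ju] : mdeg (u - U_(i))%MM == 1%N.
  by have := congr1 (@mdeg N) (submK le); rewrite mdegD mdeg1 ud; lia.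
by exists i, j; rewrite -(submK le) ju addmC.
Qed.

Lemma third_index N (i j : 'I_N) : (3 <= N)%N -> exists a, a != i /\ a != j.
Proof.
move=> N3; have : (0 < #|~: [set i; j]|)%N.
  by have := cardsC [set i; j]; rewrite card_ord cards2; case: (i != j); lia.
by rewrite card_gt0 => /set0Pn[a]; rewrite !inE negb_or => /andP[]; exists a.
Qed.

Section Inequalities.
Variables (k : fieldType) (N : nat) (f : 'I_N -> k).
Hypothesis f0 : forall i, f i != 0.
Hypothesis fnc : exists i j, f i != f j.

Lemma mult_max : exists x, forall y, (mult f y <= mult f x)%N.
Proof.
have [i [j _]] := fnc.
case: (@arg_maxnP _ i xpredT (fun i => mult f (f i)) isT) => i1 _ hmax.
exists (f i1) => y; have [/existsP[l /eqP <-]|] := boolP [exists l, f l == y].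
  exact: hmax.
rewrite negb_exists => /forallP h; rewrite /mult (_ : [set i | f i == y] = set0) ?cards0 //.
by apply/setP => l; rewrite !inE (negbTE (h l)).
Qed.

Lemma reflection_or_not :
  (exists b i0, [/\ forall i, i != i0 -> f i = b, f i0 != b & b != 0]) \/
  (exists x, (mult f x <= N.-2)%N /\ forall y, (mult f y <= mult f x)%N).
Proof.
have [x xmax] := mult_max; have [i [j ij]] := fnc.
have lt y : (mult f y < N)%N.
  rewrite ltn_neqAle mult_le andbT; apply: contraNneq ij => h.
  have : #|[set l | y != f l]| = 0%N by rewrite mult_compl h subnn.
  move/eqP; rewrite cards_eq0 => /eqP/setP e.
  by have := e i; have := e j; rewrite !inE => /negbFE/eqP <- /negbFE/eqP <-.
have [le|gt] := leqP (mult f x) N.-2; first by right; exists x.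
left; have c1 : #|[set l | x != f l]| == 1%N.
  by rewrite mult_compl; have := lt x; lia.
have [i0 i0E] := cards1P c1.
have fb l : l != i0 -> f l = x.
  move=> li; move/setP: i0E => /(_ l); rewrite !inE (negbTE li).
  by move/negbFE/eqP.
exists x, i0; split => //.
  by move/setP: i0E => /(_ i0); rewrite !inE eqxx eq_sym.
have [l li] : exists l, l != i0.
  by case: (eqVneq i i0) ij => [->|]; [exists j; rewrite eq_sym; apply: contraNneq ij => ->|exists i].
by rewrite -(fb _ li).
Qed.

Lemma ncomm_ge' : (2 * N.-1 <= ncomm f)%N.
Proof. by have [i [j ij]] := fnc; apply: ncomm_ge ij. Qed.

(** Double counting gives 6 M >= N D + 3 s for the number M of cubic monomials of
    weight different from w, where s counts the products x_i ^ 2 x_j among them;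
    this exceeds 6 D unless the action is a reflection. *)
Lemma ncomm_lt_nwt3 w : (4 <= N)%N -> w != 0 -> (ncomm f < nwt f 3 w)%N.
Proof.
move=> N4 w0; case: reflection_or_not => [[b [i0 [fb fi0 b0]]]|[x [xN xmax]]].
  have D := ncomm_reflection fb fi0.
  case: (eqVneq w (b ^+ 3)) => [->|wb]; last first.
    have := nwt3_reflection1 fb wb; move: (nwt _ _ _) D => M; move: (ncomm f) => D.
    nia.
  have [a [ai _]] := third_index i0 i0 (ltnW N4).
  have := nwt3_reflection2 fb fi0 b0 ai; have := mons2_free i0.
  move: (nwt _ _ _) (mons _ _) D => M q; move: (ncomm f) => D.
  nia.
have h3 := nwt3_ge f0 w0.
have hs := @sqpairs_ge _ _ _ f0 w _ xmax.
have hD := ncomm_le f x.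
have hD2 := ncomm_ge'.
move: (nwt f 3 w) (sqpairs f w) (ncomm f) h3 hs hD hD2 => M s D.
move: xN; set mu := mult f x => h1 h2 h3 h4 h5.
have [N6|N6] := leqP 6 N; first by nia.
have [NE|NE] : (N = 4 \/ N = 5)%N by lia.
  rewrite NE in h1 h2 h3 h4 h5.
  have [mE|[mE|mE]] : (mu = 0 \/ mu = 1 \/ mu = 2)%N by lia.
  - by rewrite mE in h3 h4; lia.
  - by rewrite mE in h3 h4; lia.
  - by rewrite mE in h3 h4; lia.
rewrite NE in h1 h2 h3 h4 h5.
have [mE|[mE|[mE|mE]]] : (mu = 0 \/ mu = 1 \/ mu = 2 \/ mu = 3)%N by lia.
- by rewrite mE in h3 h4; lia.
- by rewrite mE in h3 h4; lia.
- by rewrite mE in h3 h4; lia.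
- by rewrite mE in h3 h4; lia.
Qed.

Lemma ncomm_lt_nwt t w : (4 <= N)%N -> w != 0 -> (ncomm f < nwt f t.+3 w)%N.
Proof.
move=> N4; have N0 : (0 < N)%N by lia.
elim: t w => [|t ih] w w0; first exact: ncomm_lt_nwt3.
have a := Ordinal N0; apply: leq_trans (nwt_step f0 _ _ a).
by apply: ih; rewrite mulf_neq0 ?invr_neq0.
Qed.

Section Blocks.
Variables (r : nat) (chi : 'I_r -> k).
Hypothesis chi0 : forall i, chi i != 0.

Lemma ncomm_le_all : (ncomm chi <= r * r.-1)%N.
Proof.
rewrite ncomm_sum; apply: (@leq_trans (\sum_(i < r) r.-1)%N).
  by apply: leq_sum => i _; have := mult_pos chi i; lia.
by rewrite sum_nat_const card_ord.
Qed.

Lemma chi_const_or : (forall i j, chi i = chi j) \/ exists i j, chi i != chi j.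
Proof.
have [/existsP[i /existsP[j h]]|] := boolP [exists i, [exists j, chi i != chi j]].
  by right; exists i, j.
rewrite negb_exists => /forallP h; left => i j.
have := h i; rewrite negb_exists => /forallP/(_ j); rewrite negbK.
by move/eqP.
Qed.

Lemma ncomm_const : (forall i j, chi i = chi j) -> ncomm chi = 0%N.
Proof.
move=> h; apply/eqP; rewrite cards_eq0; apply/eqP/setP => p.
by rewrite !inE (h p.1 p.2) eqxx.
Qed.

(** Each equation alone loses more than D monomials, and r is less than D. *)
Lemma block_cubic t : (4 <= N)%N -> (0 < r)%N -> (r < N)%N ->
  (ncomm f + ncomm chi < \sum_i nwt f t.+3 (chi i))%N.
Proof.
move=> N4 r0 rN; have h : (r * (ncomm f).+1 <= \sum_i nwt f t.+3 (chi i))%N.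
  rewrite -[X in (X * _)%N]card_ord -sum_nat_const; apply: leq_sum => i _.
  exact: ncomm_lt_nwt.
have := ncomm_le_all; have := ncomm_ge'.
move: h; set D := ncomm f; set S := (\sum_i _)%N; set o := ncomm chi => h1 h2 h3.
nia.
Qed.

Lemma block_two_distinct t i j : chi i != chi j -> (0 < N)%N ->
  (2 * mons t.+2 (predT : pred 'X_{1..N}) + (r - 2) * ncomm f <=
    2 * \sum_i nwt f t.+2 (chi i))%N.
Proof.
move=> ij N0; have ne : j != i by apply: contraNneq ij => ->.
rewrite (bigD1 i) //= (bigD1 j) //= addnA mulnDr; apply: leq_add.
  by rewrite leq_mul2l nwt_two.
rewrite big_distrr /=.
apply: (@leq_trans (\sum_(l < r | (l != i) && (l != j)) ncomm f)%N); last first.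
  by apply: leq_sum => l _; apply: nwt_half.
rewrite sum_nat_const leq_mul2r; apply/orP; right.
have := cardsC [set i; j]; rewrite cards2 eq_sym ne card_ord.
have -> : #|~: [set i; j]| = #|(fun l => (l != i) && (l != j) : bool)|.
  by apply: eq_card => l; rewrite !inE negb_or.
by move=> h; rewrite -[X in (X - 2)%N]h /= addKn.
Qed.

Lemma block_half t : (0 < N)%N -> (r * ncomm f <= 2 * \sum_i nwt f t.+2 (chi i))%N.
Proof.
move=> N0; rewrite big_distrr -[X in (X * _)%N]card_ord -sum_nat_const.
by apply: leq_sum => i _; apply: nwt_half.
Qed.

(** The equations of equal weight lose at least D / 2 monomials each; two of
    different weights lose all monomials of degree 2 between them. *)
Lemma block_many : (3 <= r)%N -> (r.+2 <= N)%N ->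
  (ncomm f + ncomm chi < \sum_i nwt f 2 (chi i))%N.
Proof.
move=> r3 rN; have N0 : (0 < N)%N by lia.
have h1 := block_half 0 N0; have hD := ncomm_ge'.
case: chi_const_or => [/ncomm_const ->|[i [j ij]]].
  by move: h1 hD; set D := ncomm f; set S := (\sum_i _)%N; nia.
have h2 := block_two_distinct 0 ij N0; have h3 := mons2_all N; have h4 := ncomm_le_all.
move: h1 hD h2 h3 h4; set D := ncomm f; set S := (\sum_i _)%N; set q := mons _ _.
set o := ncomm chi => h1 hD h2 h3 h4.
have [r4|r4] := leqP 4 r.
  have [r' rE] : exists r', r = (r' + 4)%N by exists (r - 4)%N; lia.
  have h5 : (r' * (2 * N.-1) <= r' * D)%N by rewrite leq_mul2l hD orbT.
  have h6 : (r' * (2 * r.+1) <= r' * (2 * N.-1))%N by rewrite leq_mul2l; lia.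
  have h7 : (r.+2 * r.+2 <= N * N)%N by apply: leq_mul.
  have e : ((r - 2) * D = r' * D + 2 * D)%N by rewrite -mulnDl; congr (_ * _)%N; lia.
  rewrite e in h2; move: h2 h3 h4 h5 h6 h7 rN; rewrite rE.
  set u := (r' * D)%N; set v := (r' * (2 * N.-1))%N; lia.
have rE : r = 3%N by lia.
have h7 : (5 * 5 <= N * N)%N by apply: leq_mul; lia.
rewrite rE in h1 h2 h4.
by have [D12|D12] := leqP D 12; lia.
Qed.

(** Here 2 M >= D + #{i | f_i ^ 2 <> chi} for each of the two weights, and the
    second terms together exceed the number of parameters on the chi side. *)
Lemma block_pencil : (5 <= N)%N -> r = 2%N ->
    (forall w, (forall i, chi i = w) -> exists i, f i * f i != w) ->
  (ncomm f + ncomm chi < \sum_i nwt f 2 (chi i))%N.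
Proof.
move=> N5 r2 h.
have hi i := nwt2_ge f0 (chi0 i).
have r0 : (0 < r)%N by rewrite r2. have r1 : (1 < r)%N by rewrite r2.
pose i0 := Ordinal r0; pose i1 := Ordinal r1.
have S2 (g : 'I_r -> nat) : (\sum_i g i = g i0 + g i1)%N.
  rewrite (bigD1 i0) //= (bigD1 i1) //= big1 ?addn0 // => i /andP[n0 n1].
  have := ltn_ord i; move: n0 n1; rewrite -!val_eqE /=; lia.
rewrite S2; have := hi i0; have := hi i1.
case: chi_const_or => [hc|[i [j ij]]].
  rewrite (hc i1 i0) (ncomm_const hc).
  have [i fi] := h (chi i0) (fun i => hc i i0).
  have : (0 < #|[set i | (f i * f i)%R != chi i0]|)%N.
    by rewrite card_gt0; apply/set0Pn; exists i; rewrite inE.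
  by lia.
have c01 : chi i0 != chi i1.
  have e (l : 'I_r) : l = i0 \/ l = i1.
    have := ltn_ord l; rewrite [X in (_ < X)%N]r2 => l2.
    have [l0|l1] : (l = 0%N :> nat) \/ (l = 1%N :> nat) by lia.
      by left; apply: val_inj.
    by right; apply: val_inj.
  by case: (e i) (e j) ij => [->|->] [->|->]; rewrite ?eqxx // eq_sym.
have : (N <= #|[set i | (f i * f i)%R != chi i0]| + #|[set i | (f i * f i)%R != chi i1]|)%N.
  rewrite -[X in (X <= _)%N]card_ord -cardsT; apply: leq_trans (leq_card_setU _ _).
  apply: subset_leq_card; apply/subsetP => i' _; rewrite !inE.
  by case: eqP => //= ->.
have := ncomm_le_all; set o := ncomm chi; rewrite r2.
set a := nwt _ _ _; set b := nwt _ _ _; move: (ncomm f) => D; lia.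
Qed.

End Blocks.

(** One quadric of weight chi and an equation of weight psi, modulo multiples of
    the quadric by monomials of weight different from psi / chi. Multiplication by
    a variable outside a pair of variables whose product has weight chi reduces
    to an equation of degree 3. *)
Lemma quadric_and_form t chi psi i j : (4 <= N)%N -> chi != 0 -> psi != 0 ->
    f i * f j = chi ->
  (ncomm f + nwt f t.+1 (psi / chi) + (N - 4) < nwt f 2 chi + nwt f t.+3 psi)%N.
Proof.
move=> N4 chi0 psi0 ij; elim: t psi psi0 => [|t ih] psi psi0; last first.
  have [a [ai aj]] := third_index i j (ltnW N4).
  have pa0 : psi / f a != 0 by rewrite mulf_neq0 ?invr_neq0.
  have := ih _ pa0.
  have e m w : (wt f (m + U_(a))%MM != w) = (wt f m != w / f a).
    by rewrite wtD wtU mul_eq_div.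
  rewrite /nwt [X in (_ -> _ < _ + X)%N](mons_shift1 _ a).
  rewrite [X in (_ -> _ + X + _ < _)%N](mons_shift1 _ a).
  rewrite (@eq_mons _ t.+3 _ (fun m => wt f m != psi / f a)); last by move=> m _; apply: e.
  rewrite (@eq_mons _ t.+1 (fun m => wt f (m + U_(a))%MM != psi / chi)
    (fun m => wt f m != psi / f a / chi)); last first.
    by move=> m _; rewrite e -!mulrA [_ / f a]mulrC.
  have : (mons t.+2 (fun m => (wt f m != psi / chi) && (m a == 0%N)) <=
          mons t.+4 (fun m => (wt f m != psi) && (m a == 0%N)))%N.
    rewrite -[t.+4]addn2 (@mons_shift _ t.+2 2 (U_(i) + U_(j))%MM) ?mdegD ?mdeg1 //.
    apply: leq_trans (leq_addr _ _); apply: mons_sub => m _ /andP[h1 h2].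
    rewrite !wtD !wtU ij mul_eq_div // h1 /= !mnmDE !mnm1E.
    by rewrite ![_ == a]eq_sym (negbTE ai) (negbTE aj) !addn0.
  move: (mons _ _) (mons _ _) (mons _ _) (mons _ _) (mons _ _) (ncomm f) => a1 a2 a3 a4 a5 D.
  lia.
have m1 w : nwt f 1 w = (N - mult f w)%N.
  rewrite /nwt mons1 -mult_compl; apply: eq_card => l.
  by rewrite !inE wtU eq_sym.
have h2 := nwt2_ge f0 chi0; rewrite m1.
case: reflection_or_not => [[b [i0 [fb fi0 b0]]]|[x [xN xmax]]]; last first.
  have hm y : (mult f y <= N.-2)%N by apply: leq_trans xN.
  have N2 : (2 <= N)%N by lia.
  have h3 := nwt3_ge f0 psi0; have h4 := ncomm_ge2 hm N2.
  have h5 := sqpairs_ge f0 psi hm.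
  move: h2 h3 h4 h5; set D := ncomm f; set s := sqpairs f psi; set M3 := nwt f 3 psi.
  set M2 := nwt f 2 chi; set o := #|_|; set u := mult f _ => h2 h3 h4 h5.
  have {}h5 : (2 * N <= s)%N by nia.
  nia.
have hD := ncomm_reflection fb fi0; have hD2 := ncomm_ge'.
have [a [ai _]] := third_index i0 i0 (ltnW N4).
have q := mons2_free i0.
case: (eqVneq psi (b ^+ 3)) => [psib|psib]; last first.
  have := nwt3_reflection1 fb psib.
  move: h2 hD hD2; set D := ncomm f; set M3 := nwt f 3 psi.
  set M2 := nwt f 2 chi; set o := #|_|; set u := mult f _ => h2 hD hD2 h3.
  nia.
have := nwt3_reflection2 fb fi0 b0 ai; rewrite -psib.
case: (eqVneq chi (b ^+ 2)) => [chib|chib]; last first.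
  have := nwt2_reflection fb chib.
  move: h2 hD hD2 q; set D := ncomm f; set M3 := nwt f 3 psi.
  set M2 := nwt f 2 chi; set o := #|_|; set u := mult f _; set q := mons _ _.
  move=> h2 hD hD2 q' h3 h4; nia.
have mb : mult f (psi / chi) = N.-1.
  have -> : psi / chi = b by rewrite psib chib exprS mulfK // expf_neq0.
  rewrite -(card_others i0); apply: eq_card => l; rewrite !inE.
  by case: (eqVneq l i0) => [->|/fb ->]; rewrite ?eqxx ?(negbTE fi0).
rewrite mb.
move: h2 hD hD2 q; set D := ncomm f; set M3 := nwt f 3 psi.
set M2 := nwt f 2 chi; set o := #|_|; set q := mons _ _.
move=> h2 hD hD2 q' h3; nia.
Qed.

(** Two monomials that differ by a factor x_b / x_g do not have the same weight,
    so one of the two has a weight different from psi. *)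
Lemma toggle_monomials t psi b g (E : {set 'I_N}) (R : pred 'X_{1..N}) :
    f b != f g -> b \in E -> g \in E -> (#|E| <= 3)%N ->
    (forall l, l \notin E -> R (U_(b) *+ t.+2 + U_(l))%MM) ->
    (forall l, l \notin E -> R (U_(b) *+ t.+1 + U_(g) + U_(l))%MM) ->
  (N - 3 <= mons t.+3 (fun m => (wt f m != psi) && R m))%N.
Proof.
move=> bg bE gE E3 R1 R2.
apply: (@leq_trans #|~: E|).
  by have := cardsC E; rewrite card_ord; lia.
pose h l := if wt f (U_(b) *+ t.+2 + U_(l))%MM != psi then (U_(b) *+ t.+2 + U_(l))%MM
  else (U_(b) *+ t.+1 + U_(g) + U_(l))%MM.
have hl l l' : l \notin E -> l' \notin E -> h l l' = (l == l').
  move=> lE l'E; have nb : b == l' = false by apply: contraNF l'E => /eqP <-.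
  have ng : g == l' = false by apply: contraNF l'E => /eqP <-.
  rewrite /h; case: ifP => _; first by rewrite mnmDE mulmnE !mnm1E nb.
  by rewrite 2!mnmDE mulmnE !mnm1E nb ng.
apply: (mons_ge (h := h)).
- move=> l l'; rewrite !inE => lE l'E e.
  by have := hl l l' lE l'E; rewrite e hl // eqxx; case: eqP.
- move=> l _; rewrite /h; case: ifP => _; first by rewrite mdegD mdegMn !mdeg1 mul1n addn1.
  by rewrite 2!mdegD mdegMn !mdeg1 mul1n !addn1.
move=> l; rewrite inE => lE; rewrite /h; case: ifP => [->|/negbFE/eqP e].
  by rewrite R1.
rewrite R2 // andbT -e; apply: contra bg => /eqP.
rewrite (mulmSr U_(b) t.+1) 4!wtD !wtU -!mulrA.
have w0 : wt f (U_(b) *+ t.+1)%MM != 0.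
  by rewrite /wt; apply/prodf_neq0 => i _; apply: expf_neq0.
by move/(mulfI w0)/(mulIf (f0 l)) => ->.
Qed.

(** Multiplication by u, and by the square of a variable y of the other
    eigenvalue, which is prime to u, sends the two sets of cofactors to disjoint
    sets of monomials of degree t + 3; N - 3 further monomials are divisible by
    neither. *)
Lemma involution_pencil t chi psi u : (5 <= N)%N -> (forall i, f i * f i = chi) ->
    mdeg u = 2%N -> wt f u = chi ->
  (nwt f t.+1 (psi / chi) +
    mons t.+1 (fun m => (wt f m != psi / chi) && ~~ (u <= m)%MM) + (N - 3)
    <= nwt f t.+3 psi)%N.
Proof.
move=> N5 inv ud uw.
have [i0 [j0 ij0]] := fnc.
have chi0 : chi != 0 by rewrite -(inv i0) mulf_neq0.
have [i [j uE]] := mdeg2_pair ud.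
have fij : f i = f j.
  by move: uw; rewrite uE wtD !wtU -(inv i) => /(mulfI (f0 i)) ->.
have [y fy] : exists y, f y != f i.
  case: (eqVneq (f i0) (f i)) => [e|]; last by exists i0.
  by exists j0; rewrite -e eq_sym.
rewrite /nwt -[t.+3]addn2 (mons_shift t.+1 _ ud) -addnA; apply: leq_add.
  by apply: mons_sub => m _; rewrite wtD uw mul_eq_div.
have yd : mdeg (U_(y) + U_(y))%MM = 2%N by rewrite mdegD !mdeg1.
rewrite (mons_shift t.+1 _ yd); apply: leq_add.
  apply: mons_sub => m _ /andP[h1 h2]; rewrite wtD wtD wtU inv mul_eq_div // h1 /=.
  apply: contra h2 => /mnm_lepP h; apply/mnm_lepP => l.
  have := h l; rewrite !mnmDE !mnm1E; case: (eqVneq y l) => [<-|_]; last by rewrite addn0.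
  move=> _; rewrite uE mnmDE !mnm1E.
  have -> : (i == y) = false by apply: contraNF fy => /eqP ->.
  have -> : (j == y) = false by apply: contraNF fy => /eqP <-; rewrite fij.
  by [].
rewrite addn2.
under eq_mons => m _ do rewrite -andbA.
case: (eqVneq i j) => [ij|ij].
  have [|z [zi zy]] := third_index i y; first by lia.
  have [g gE gz] : exists2 g, g \in [set i; y] & f z != f g.
    case: (eqVneq (f z) (f i)) => [e|ne]; last by exists i; rewrite ?inE ?eqxx.
    by exists y; rewrite ?inE ?eqxx ?orbT // e eq_sym.
  have nz l x : l \notin [set z; i; y] -> x \in [set i; y] ->
     [/\ (z == x) = false, (l == x) = false & ((g == x : bool) <= 1)%N].
    rewrite !inE !negb_or => /andP[/andP[lz li] ly] /orP[] /eqP ->;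
      rewrite ?(negbTE zi) ?(negbTE zy) ?(negbTE li) ?(negbTE ly); split => //; exact: leq_b1.
  have R (m : 'X_{1..N}) : (forall x, x \in [set i; y] -> (m x <= 1)%N) ->
      ~~ (u <= m)%MM && ~~ (U_(y) + U_(y) <= m)%MM.
    move=> h; apply/andP; split; apply/negP => /mnm_lepP le.
      by have := le i; have := h i; rewrite uE -ij !inE eqxx mnmDE mnm1E eqxx => /(_ isT); lia.
    by have := le y; have := h y; rewrite !inE eqxx orbT mnmDE mnm1E eqxx => /(_ isT); lia.
  apply: (@toggle_monomials t psi z g [set z; i; y]) => //.
  - by rewrite !inE eqxx.
  - by move: gE; rewrite !inE => /orP[] ->; rewrite ?orbT.
  - by apply: leq_trans (leq_card_setU _ _) _; rewrite cards2 cards1; case: (z != i).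
  - move=> l lE; apply: R => x xE; have [z1 z2 z3] := nz l x lE xE.
    by rewrite mnmDE mulmnE !mnm1E z1 z2.
  - move=> l lE; apply: R => x xE; have [z1 z2 z3] := nz l x lE xE.
    by rewrite 2!mnmDE mulmnE !mnm1E z1 z2 addn0.
have iy : (i == y) = false by apply: contraNF fy => /eqP ->.
have jy : (j == y) = false by apply: contraNF fy => /eqP <-; rewrite fij.
have R (m : 'X_{1..N}) : m j = 0%N -> (m y <= 1)%N -> ~~ (u <= m)%MM && ~~ (U_(y) + U_(y) <= m)%MM.
  move=> mj my; apply/andP; split; apply/negP => /mnm_lepP le.
    by have := le j; rewrite uE mj mnmDE !mnm1E eqxx addn1.
  by have := le y; rewrite mnmDE mnm1E eqxx; lia.
apply: (@toggle_monomials t psi i y [set i; j; y]) => //.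
- by rewrite eq_sym.
- by rewrite !inE eqxx.
- by rewrite !inE eqxx orbT.
- by apply: leq_trans (leq_card_setU _ _) _; rewrite cards2 cards1; case: (i != j).
- move=> l; rewrite !inE !negb_or => /andP[/andP[li lj] ly].
  by apply: R; rewrite mnmDE mulmnE !mnm1E ?(negbTE ij) ?(negbTE lj) ?iy ?(negbTE ly).
- move=> l; rewrite !inE !negb_or => /andP[/andP[li lj] ly].
  apply: R; rewrite 2!mnmDE mulmnE !mnm1E ?(negbTE ij) ?(negbTE lj) ?iy ?(negbTE ly) ?eqxx //.
  by rewrite eq_sym jy.
Qed.

End Inequalities.

(** * Diagonal substitutions *)

Section Diagonal.
Variables (k : closedFieldType) (N : nat) (f : 'I_N -> k).
Implicit Types (p q : {mpoly k[N]}) (w : k).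

Definition dsub p := lsub (diag_mx (\row_i f i)) p.

Lemma dsub_monomial m : dsub 'X_[m] = wt f m *: 'X_[m].
Proof.
apply: mpoly_eq_col => x; rewrite lsub_meval mevalZ !mevalX -big_split /=.
by apply: eq_bigr => i _; rewrite mul_diag_mx !mxE exprMn.
Qed.

Lemma dsub_coef p m : (dsub p)@_m = wt f m * p@_m.
Proof.
rewrite /dsub [p in lsub _ p]mpolyE [p in _ * p@_m]mpolyE lsub_sum !raddf_sum /=.
rewrite mulr_sumr; apply: eq_bigr => m' _.
rewrite lsubZ -/(dsub _) dsub_monomial !mcoeffZ mcoeffX.
by case: eqP => [->|_]; rewrite ?mulr0 // !mulr1 mulrC.
Qed.

Definition iso w p := \sum_(m <- msupp p | wt f m == w) p@_m *: 'X_[m].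

Lemma iso_coef w p m : (iso w p)@_m = p@_m *+ (wt f m == w).
Proof.
rewrite /iso raddf_sum /= big_mkcond /= [p in p@_m *+ _]mpolyE [in RHS]raddf_sum -sumrMnl.
apply: eq_bigr => m' _; rewrite /= !mcoeffZ mcoeffX.
case: (eqVneq m' m) => [->|_]; first by case: eqP.
by rewrite mulr0 mul0rn; case: eqP.
Qed.

Lemma iso_wt w p m : (iso w p)@_m != 0 -> wt f m = w.
Proof. by rewrite iso_coef; case: (wt f m =P w) => // _; rewrite mulr0n eqxx. Qed.

Lemma iso_homog w p t : p \is t.-homog -> iso w p \is t.-homog.
Proof.
move=> hp; rewrite /iso big_seq_cond; apply: rpred_sum => m /andP[mp _].
by rewrite dhomogZ // dhomogX /= (dhomog_mf hp mp).
Qed.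

Definition kill (r : seq k) p := foldr (fun w q => dsub q - w *: q) p r.

Lemma kill_coef r p m : (kill r p)@_m = \prod_(w <- r) (wt f m - w) * p@_m.
Proof.
elim: r => [|w r ih] /=; first by rewrite big_nil mul1r.
by rewrite mcoeffB mcoeffZ dsub_coef ih big_cons mulrBl mulrBl !mulrA.
Qed.

End Diagonal.

Section StableIdeal.
Variables (k : closedFieldType) (n c : nat) (f : 'I_n.+1 -> k).
Variable G : 'I_c -> {mpoly k[n.+1]}.
Hypothesis stab : forall i, generated_by G (dsub f (G i)).

Lemma generated_dsub p : generated_by G p -> generated_by G (dsub f p).
Proof.
move=> [g ->]; rewrite /dsub lsub_sum; elim: (index_enum _) => [|i r ih].
  by rewrite big_nil; exists (fun _ => 0); rewrite big1 // => i _; rewrite mul0r.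
by rewrite big_cons lsubM; apply: generated_byD => //; apply: generated_byM; apply: stab.
Qed.

(** Interpolating at the weights of p writes its components as combinations of
    the images of p under the powers of the substitution. *)
Lemma generated_iso w p : generated_by G p -> generated_by G (iso f w p).
Proof.
move=> hp; pose r := [seq w' <- [seq wt f m | m <- msupp p] | w' != w].
have K0 : \prod_(w' <- r) (w - w') != 0.
  rewrite prodf_seq_neq0; apply/allP => w'; rewrite mem_filter /= => /andP[ne _].
  by rewrite subr_eq0 eq_sym.
have -> : iso f w p = (\prod_(w' <- r) (w - w'))^-1%:MP * kill f r p.
  apply/mpolyP => m; rewrite mul_mpolyC mcoeffZ kill_coef iso_coef.
  case: (eqVneq (wt f m) w) => [->|ne]; first by rewrite mulrA mulVf // mul1r.
  have [mp|] := boolP (m \in msupp p); last first.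
    by rewrite mcoeff_msupp negbK => /eqP ->; rewrite !mulr0.
  rewrite (_ : \prod_(w' <- r) (wt f m - w') = 0) ?mul0r ?mulr0 //; apply/eqP.
  rewrite prodf_seq_eq0; apply/hasP; exists (wt f m); last by rewrite /= subrr.
  by rewrite mem_filter ne map_f.
apply: generated_byM; elim: r {K0} => //= w' r ih; apply: generated_byD.
  exact: generated_dsub.
by rewrite -scaleNr -mul_mpolyC; apply: generated_byM.
Qed.

End StableIdeal.

(** * The equations of lowest degree *)

Lemma enum_fiber c (t : 'I_c -> nat) i0 :
  exists r (ev : 'I_r.+1 -> 'I_c), [/\ injective ev, forall a, t (ev a) = t i0
    & forall i, t i = t i0 -> exists a, ev a = i].
Proof.
pose I := [set i | t i == t i0].
have I0 : i0 \in I by rewrite inE.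
have cI : #|I|.-1.+1 = #|I| by rewrite prednK // card_gt0; apply/set0Pn; exists i0.
exists #|I|.-1, (fun a => enum_val (cast_ord cI a)); split.
- by move=> a b /enum_val_inj/cast_ord_inj.
- by move=> a; have := enum_valP (cast_ord cI a); rewrite inE => /eqP.
- move=> i ti; have iI : i \in I by rewrite inE ti.
  exists (cast_ord (esym cI) (enum_rank_in I0 i)).
  by rewrite cast_ordKV enum_rankK_in.
Qed.

Lemma sum_fiber (V : nmodType) c (t : 'I_c -> nat) e r (ev : 'I_r -> 'I_c) (F : 'I_c -> V) :
    injective ev -> (forall a, t (ev a) = e) -> (forall i, t i = e -> exists a, ev a = i) ->
  \sum_(i | t i == e) F i = \sum_a F (ev a).
Proof.
move=> evI evd ev_onto.
rewrite -(big_imset _ (in2W evI)) /=; apply: eq_bigl => i; apply/eqP/imsetP.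
  by move/ev_onto => [a <-]; exists a.
by move=> [a _ ->].
Qed.

Section LowestBlock.
Variables (k : closedFieldType) (n c : nat) (d : c.-tuple nat).
Variables (f : 'I_n.+1 -> k) (m : nat) (mu : k).
Hypotheses (fm : forall i, f i ^+ m = mu) (m0 : m%:R != 0 :> k) (mu0 : mu != 0).
Variable G : 'I_c -> {mpoly k[n.+1]}.
Hypothesis hG : forms d G.
Hypothesis indep : forall (g : 'I_c -> {mpoly k[n.+1]}) j a,
  \sum_i g i * G i = 0 -> g j = a%:MP -> a = 0.
Hypothesis stab : forall i, generated_by G (dsub f (G i)).
Variables (e r : nat) (ev : 'I_r.+1 -> 'I_c).
Hypotheses (evI : injective ev) (evd : forall a, tnth d (ev a) = e).
Hypothesis ev_onto : forall i, tnth d i = e -> exists a, ev a = i.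
Hypothesis emin : forall i, (e <= tnth d i)%N.

Lemma wt_expn m' : wt f m' ^+ m = mu ^+ mdeg m'.
Proof.
rewrite /wt -prodrXl mdegE -prodrXr; apply: eq_bigr => i _.
by rewrite exprAC fm.
Qed.

Lemma iter_dsub (p : {mpoly k[n.+1]}) t : p \is t.-homog -> iter m (dsub f) p = mu ^+ t *: p.
Proof.
move=> hp; apply/mpolyP => m'; rewrite mcoeffZ.
have -> l : (iter l (dsub f) p)@_m' = wt f m' ^+ l * p@_m'.
  by elim: l => [|l ih]; rewrite ?mul1r // iterS dsub_coef ih exprS mulrA.
rewrite wt_expn; have [mp|] := boolP (m' \in msupp p); first by rewrite (dhomog_mf hp mp).
by rewrite mcoeff_msupp negbK => /eqP ->; rewrite !mulr0.
Qed.

Let comb (x : 'rV[k]_r.+1) := \sum_a x 0 a *: G (ev a).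

Let combL a x y : comb (a *: x + y) = a *: comb x + comb y.
Proof.
rewrite /comb scaler_sumr -big_split; apply: eq_bigr => b _ /=.
by rewrite !mxE scalerDl scalerA.
Qed.

Let comb0 : comb 0 = 0.
Proof. by rewrite /comb big1 // => a _; rewrite mxE scale0r. Qed.

Let combZ a x : comb (a *: x) = a *: comb x.
Proof. by rewrite -[a *: x]addr0 combL comb0 addr0. Qed.

Let combB x y : comb (x - y) = comb x - comb y.
Proof. by rewrite addrC -scaleN1r combL scaleN1r addrC. Qed.

Let comb_row1 a : comb (row a 1%:M) = G (ev a).
Proof.
rewrite /comb (bigD1 a) //= big1 ?addr0 => [|b ne].
  by rewrite !mxE eqxx scale1r.
by rewrite !mxE eq_sym (negbTE ne) scale0r.
Qed.

Let comb_mul (x : 'rV[k]_r.+1) (M : 'M_r.+1) : comb (x *m M) = \sum_a x 0 a *: comb (row a M).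
Proof.
rewrite mulmx_sum_row; elim: (index_enum _) => [|a l ih]; first by rewrite !big_nil comb0.
by rewrite !big_cons combL ih.
Qed.

Let sum_ev (g : 'I_c -> {mpoly k[n.+1]}) : (forall i, tnth d i != e -> g i = 0) ->
  \sum_i g i = \sum_a g (ev a).
Proof.
move=> h; rewrite (bigID (fun i => tnth d i == e)) /= [X in _ + X]big1 ?addr0; last first.
  by move=> i; apply: h.
exact: sum_fiber evI evd ev_onto.
Qed.

Let comb_eq0 x : comb x = 0 -> x = 0.
Proof.
move=> h; apply/rowP => a; rewrite [RHS]mxE.
pose y i := \sum_(b | ev b == i) x 0 b.
have yE b : y (ev b) = x 0 b.
  rewrite /y (big_pred1 b) // => b'; apply/eqP/eqP => [/evI //|-> //].
apply: (indep (g := fun i => (y i)%:MP) (j := ev a)); last by rewrite yE.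
rewrite sum_ev; first by rewrite -[RHS]h; apply: eq_bigr => b _; rewrite yE mul_mpolyC.
move=> i ie; rewrite /y big_pred0 ?mpolyC0 ?mul0r // => b.
by apply: contraNF ie => /eqP <-; rewrite evd.
Qed.

(** The substitution acts on the span of the equations of lowest degree, and its
    m-th power is a scalar there; this uses that the equations are linearly
    independent. *)
Lemma lowest_block : exists (chi : 'I_r.+1 -> k) (C : 'M[k]_r.+1)
    (H : 'I_r.+1 -> {mpoly k[n.+1]}),
  [/\ forall a b, chi a = chi b -> C a b = (a == b)%:R,
      forall b, H b \is e.-homog,
      forall b m', (H b)@_m' != 0 -> wt f m' = chi b,
      forall a, G (ev a) = \sum_b C a b *: H b
    & forall b, H b != 0].
Proof.
have /fin_all_exists[M0 M0E] a : exists x, dsub f (G (ev a)) = comb x.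
  have he : dsub f (G (ev a)) \is e.-homog by apply: lsub_homog; rewrite -(evd a).
  have [g [gE gh]] := generated_homog hG he (stab (ev a)).
  exists (\row_b (g (ev b))@_0%MM); rewrite gE sum_ev.
    apply: eq_bigr => b _; rewrite mxE -mul_mpolyC; congr (_ * _).
    apply: dhomog0_const; have [h _] := gh (ev b); have := h _.
    by rewrite evd leqnn subnn => /(_ isT).
  move=> i ie; have [_ ->] := gh i; first by rewrite mul0r.
  by rewrite ltn_neqAle eq_sym ie emin.
pose M := \matrix_a M0 a.
have ME x : dsub f (comb x) = comb (x *m M).
  rewrite comb_mul /comb /dsub lsub_sum; apply: eq_bigr => a _.
  by rewrite lsubZ -/(dsub f _) M0E rowK.
have Mm : M ^+ m = (mu ^+ e)%:M.
  apply/row_matrixP => a; apply/eqP; rewrite -subr_eq0; apply/eqP/comb_eq0.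
  have iE l : iter l (dsub f) (G (ev a)) = comb (row a (M ^+ l)).
    elim: l => [|l ih]; last by rewrite iterS ih ME exprSr -row_mul.
    by rewrite expr0 comb_row1.
  rewrite combB -iE (iter_dsub (hG _)) evd -[X in row a X]scalemx1 linearZ /=.
  by rewrite combZ comb_row1 subrr.
have [chi [C [uC MC Cd]]] := power_eigenbasis Mm m0 (expf_neq0 e mu0).
pose D := diag_mx (\row_a chi a).
have CM : invmx C *m M = D *m invmx C.
  apply: (can_inj (mulmxK uC)); rewrite -!mulmxA MC mulVmx // mulmx1.
  by rewrite mulmxA mulVmx // mul1mx.
have hH b : comb (row b (invmx C)) \is e.-homog.
  by apply: rpred_sum => a _; rewrite dhomogZ // -(evd a); apply: hG.
have HD b : dsub f (comb (row b (invmx C))) = chi b *: comb (row b (invmx C)).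
  rewrite ME -row_mul CM -combZ; congr comb; apply/rowP => a.
  by rewrite mxE mul_diag_mx !mxE.
exists chi, C, (fun b => comb (row b (invmx C))); split => //.
- move=> b m' ne; have := congr1 (mcoeff m') (HD b).
  by rewrite dsub_coef mcoeffZ => /(mulIf ne).
- move=> a; rewrite -comb_row1 -(mulmxV uC) row_mul comb_mul.
  by apply: eq_bigr => b _; rewrite mxE.
- move=> b; apply/eqP => /comb_eq0 rb.
  have : row b (invmx C *m C) = 0 by rewrite row_mul rb mul0mx.
  rewrite mulVmx // => /rowP/(_ b); rewrite !mxE eqxx => /eqP.
  by rewrite oner_eq0.
Qed.

End LowestBlock.

(** * Types of tuples with a special linear symmetry *)

Section Special.
Variables (k : closedFieldType) (n c : nat) (d : c.-tuple nat).
Variable f : 'I_n.+1 -> k.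
Implicit Types (F G : 'I_c -> {mpoly k[n.+1]}).

(** G becomes a type after a change of coordinates that commutes with the
    diagonal matrix of the f_i; only the class of that matrix has to be added
    to the parameters. *)
Definition special G : Prop :=
  exists (T : {set Defs.coord n d}) (A : {set 'I_c * 'I_c * 'X_{1..n.+1 < dmax d}})
    (H : 'I_c -> {mpoly k[n.+1]}) (v : 'I_c -> 'I_c -> {mpoly k[n.+1]}),
  [/\ (ncomm f + #|A| < #|~: T|)%N, forms d H,
      forall s, s \notin T -> cf H s = 0,
      forall i j, (msize (v i j) <= dmax d)%N /\
        forall m : 'X_{1..n.+1 < dmax d}, (v i j)@_m != 0 -> (i, j, m) \in A
    & forall i, G i = H i + \sum_j v i j * H j].

Lemma small_type_of_special F G (P : 'M[k]_n.+1) :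
    special G -> (forall i, F i = lsub P (G i)) ->
    (forall i j, f i = f j -> P i j = (i == j)%:R) ->
  small_type d F.
Proof.
move=> [T [A [H [v [lt hH HT vA GE]]]]] FP Pn.
exists [set p | f p.1 != f p.2], T, A; split; first exact: lt.
exists P, H, (fun z : 'I_c * 'I_c * 'X_{1..n.+1 < dmax d} => (v z.1.1 z.1.2)@_z.2); split => //.
  by move=> i j; rewrite inE negbK => /eqP; apply: Pn.
move=> i; rewrite FP GE; congr (lsub P (H i + _)).
under eq_bigr => j _ do rewrite (mpolywE (vA i j).1) mulr_suml.
rewrite pair_big /=.
rewrite [RHS](_ : _ = \sum_(z : 'I_c * 'I_c * 'X_{1..n.+1 < dmax d} | z.1.1 == i) (v z.1.1 z.1.2)@_z.2 *: ('X_[(z.2 : 'X_{1..n.+1})] * H z.1.2)); last first.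
  rewrite [RHS](bigID (fun z => z \in A)) /= [X in _ = _ + X]big1 ?addr0.
    by apply: eq_bigl => z; rewrite andbC.
  move=> [[i' j] m] /= /andP[_ nA]; have [_ h] := vA i' j.
  have [->|/h mA] := eqVneq ((v i' j)@_m) 0; first by rewrite scale0r.
  by rewrite mA in nA.
rewrite (reindex_onto (fun p : 'I_c * 'X_{1..n.+1 < dmax d} => (i, p.1, p.2))
   (fun z => (z.1.2, z.2))) /=; last by move=> [[i' j] m] /= /eqP ->.
rewrite [RHS](eq_bigl xpredT); last by move=> [j m] /=; rewrite !eqxx.
by apply: eq_bigr => p _; rewrite -scalerAl.
Qed.

Lemma coords_ge (R : 'I_c -> pred 'X_{1..n.+1}) :
  (\sum_i mons (tnth d i) (R i) <= #|[set s : Defs.coord n d | R (tag s) (cmon s)]|)%N.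
Proof.
rewrite -sum1_card (partition_big (fun s : Defs.coord n d => tag s) predT) //=.
apply: leq_sum => i _; rewrite sum1_card.
pose g (s : Defs.coord n d) : 'X_{1..n.+1 < (tnth d i).+1} := insubd bm0 (cmon s).
apply: leq_trans (leq_imset_card g _); rewrite /mons; apply: subset_leq_card.
apply/subsetP => m; rewrite inE => /andP[/eqP mi Rm].
have [s [si sm]] := coord_ex mi; apply/imsetP; exists s.
  by rewrite unfold_in /= inE si sm eqxx Rm.
by apply: val_inj; rewrite /g val_insubd sm bmdeg.
Qed.

Lemma special_of_relations G H (v : 'I_c -> 'I_c -> {mpoly k[n.+1]})
    (A : {set 'I_c * 'I_c * 'X_{1..n.+1 < dmax d}}) (R : 'I_c -> pred 'X_{1..n.+1}) :
    (ncomm f + #|A| < \sum_i mons (tnth d i) (R i))%N -> forms d H ->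
    (forall i m, R i m -> (H i)@_m = 0) ->
    (forall i j, (msize (v i j) <= dmax d)%N) ->
    (forall i j (m : 'X_{1..n.+1 < dmax d}), (v i j)@_m != 0 -> (i, j, m) \in A) ->
    (forall i, G i = H i + \sum_j v i j * H j) ->
  special G.
Proof.
move=> lt hH HR vs vA GE.
exists [set s | ~~ R (tag s) (cmon s)], A, H, v; split => //.
  apply: leq_trans lt _; apply: leq_trans (coords_ge R) _.
  by apply: subset_leq_card; apply/subsetP => s; rewrite !inE negbK.
  by move=> s; rewrite inE negbK; apply: HR.
by move=> i j; split=> // m; apply: vA.
Qed.

Section Blocks.
Variables (e r : nat) (ev : 'I_r.+1 -> 'I_c).
Hypotheses (evI : injective ev) (evd : forall a, tnth d (ev a) = e).

Lemma sum_ev_le (i0 : 'I_c) (g : 'I_c -> nat) : (forall a, ev a != i0) ->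
  (\sum_a g (ev a) + g i0 <= \sum_i g i)%N.
Proof.
move=> h; rewrite (bigD1 i0) //= addnC leq_add2l -(big_imset _ (in2W evI)) /=.
rewrite [X in (_ <= X)%N](bigID (fun i => i \in [set ev a | a : 'I_r.+1])) /=.
apply: leq_trans (leq_addr _ _); apply: eq_leq; apply: eq_bigl => i.
by apply/idP/andP => [ii|[] //]; split => //; case/imsetP: ii => a _ ->.
Qed.

Lemma sum_ev_le' (g : 'I_c -> nat) : (\sum_a g (ev a) <= \sum_i g i)%N.
Proof.
rewrite -(big_imset _ (in2W evI)) /=.
rewrite [X in (_ <= X)%N](bigID (fun i => i \in [set ev a | a : 'I_r.+1])) /=.
exact: leq_addr.
Qed.

(** The equations of lowest degree are replaced by eigenvectors, which have no
    monomials of another weight; the entries of C between different weights are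
    the parameters. *)
Lemma special_first_block G (chi : 'I_r.+1 -> k) (C : 'M[k]_r.+1)
    (H : 'I_r.+1 -> {mpoly k[n.+1]}) :
    forms d G -> (forall a b, chi a = chi b -> C a b = (a == b)%:R) ->
    (forall b, H b \is e.-homog) -> (forall b m, (H b)@_m != 0 -> wt f m = chi b) ->
    (forall a, G (ev a) = \sum_b C a b *: H b) ->
    (ncomm f + ncomm chi < \sum_a nwt f e (chi a))%N ->
  special G.
Proof.
move=> hG Cn hH Hchi GH lt.
pose H' i := if [pick a | ev a == i] is Some a then H a else G i.
have H'ev a : H' (ev a) = H a.
  by rewrite /H'; case: pickP => [b /eqP/evI -> //|/(_ a)]; rewrite eqxx.
pose P i j (p : 'I_r.+1 * 'I_r.+1) := [&& ev p.1 == i, ev p.2 == j & chi p.1 != chi p.2].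
apply: (@special_of_relations G H' (fun i j => \sum_(p | P i j p) (C p.1 p.2)%:MP)
  [set (ev p.1, ev p.2, bm0) | p in [set p | chi p.1 != chi p.2]]
  (fun i m => [exists a, (ev a == i) && (wt f m != chi a)])).
- apply: leq_ltn_trans (leq_trans lt _); first by rewrite leq_add2l leq_imset_card.
  apply: leq_trans (sum_ev_le' _); apply: leq_sum => a _; rewrite evd.
  by apply: mons_sub => m _ h; apply/existsP; exists a; rewrite eqxx.
- by move=> i; rewrite /H'; case: pickP => // a /eqP <-; rewrite evd; apply: hH.
- move=> i m /existsP[a /andP[/eqP <- h]]; rewrite H'ev; apply/eqP; apply: contraR h.
  by move/Hchi => ->.
- move=> i j; apply: leq_trans (msize_sum _ _ _) _; apply/bigmax_leqP => p _.
  by rewrite msizeC; apply: leq_trans (leq_b1 _) _.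
- move=> i j m; rewrite raddf_sum /=.
  have [/existsP[p Pp]|] := boolP [exists p, P i j p]; last first.
    by rewrite negb_exists => /forallP h; rewrite big_pred0 ?eqxx // => p; apply/negbTE.
  case/and3P: Pp => /eqP <- /eqP <- h ne; apply/imsetP; exists p; first by rewrite inE.
  congr (_, _, _); apply: val_inj => /=; apply/eqP; apply: contraNT ne => m0.
  by rewrite big1 // => q _; rewrite mcoeffC (negbTE m0) mulr0.
move=> i; under eq_bigr => j _ do rewrite mulr_suml.
rewrite (exchange_big_dep (fun p : 'I_r.+1 * 'I_r.+1 => (ev p.1 == i) && (chi p.1 != chi p.2))) /=; last first.
  by move=> j p _ /and3P[-> _ ->].
rewrite (eq_bigr (fun p => C p.1 p.2 *: H p.2)); last first.
  move=> p /andP[h1 h2]; rewrite (big_pred1 (ev p.2)).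
    by rewrite H'ev mul_mpolyC.
  by move=> j; rewrite /P h1 h2 andbT eq_sym.
rewrite /H'; case: pickP => [a /eqP ai|h]; last first.
  by rewrite big_pred0 ?addr0 // => p; rewrite h.
rewrite -ai GH (bigD1 a) //= Cn // eqxx scale1r; congr (_ + _).
rewrite (bigID (fun b => chi a == chi b)) /= big1 ?add0r => [|b /andP[ba /eqP /Cn ->]]; last first.
  by rewrite eq_sym (negbTE ba) scale0r.
rewrite (reindex_onto (fun b => (a, b)) snd) /=; last first.
  by move=> [a' b] /andP[/eqP/evI /= -> _].
apply: eq_bigl => b; rewrite !eqxx /= andbT; case: (chi a =P chi b) => [_|ne]; first by rewrite andbF.
by rewrite andbT; apply: contra_not_neq ne => ->.
Qed.

(** One equation is replaced by a semi-invariant P; the parameters are the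
    coefficients of the multiples of the other equations that make up the
    difference. *)
Lemma special_second_block G t j0 (P : {mpoly k[n.+1]}) psi chi (cst : 'I_c -> k)
    (B : 'I_r.+1 -> {mpoly k[n.+1]}) (R : 'I_r.+1 -> pred 'X_{1..n.+1}) :
    forms d G -> tnth d j0 = (t.+1 + e)%N ->
    (forall a m, (G (ev a))@_m != 0 -> wt f m = chi) ->
    P \is (tnth d j0).-homog -> (forall m, P@_m != 0 -> wt f m = psi) ->
    (forall j, cst j != 0 -> tnth d j = tnth d j0 /\ j != j0) ->
    (forall a, B a \is t.+1.-homog) -> (forall a m, (B a)@_m != 0 -> R a m) ->
    G j0 = P + \sum_j cst j *: G j + \sum_a B a * G (ev a) ->
    (ncomm f + (#|[set j | tnth d j == tnth d j0]|.-1 + \sum_a mons t.+1 (R a)) <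
      r.+1 * nwt f e chi + nwt f (tnth d j0) psi)%N ->
  special G.
Proof.
move=> hG dj0 Gchi hP Ppsi hc hB BR GE lt.
have ej a : ev a != j0.
  by apply/eqP => ea; have := evd a; rewrite ea dj0; lia.
pose H i := if i == j0 then P else G i.
pose v i j := if i == j0 then (cst j)%:MP + \sum_(a | ev a == j) B a else 0.
pose A1 : {set 'I_c * 'I_c * 'X_{1..n.+1 < dmax d}} :=
  [set (j0, j, bm0) | j in [set j | tnth d j == tnth d j0] :\ j0].
pose Q := [set p : 'I_r.+1 * 'X_{1..n.+1 < t.+2} |
  (mdeg (bmnm p.2) == t.+1) && R p.1 (bmnm p.2)].
pose A2 : {set 'I_c * 'I_c * 'X_{1..n.+1 < dmax d}} :=
  [set (j0, ev p.1, insubd bm0 (bmnm p.2)) | p in Q].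
have ins b (m : 'X_{1..n.+1}) : (mdeg m < b.+1)%N ->
    bmnm (insubd (bm0 : 'X_{1..n.+1 < b.+1}) m) = m.
  by move=> h; rewrite -[LHS]/(val _) val_insubd h.
apply: (@special_of_relations G H v (A1 :|: A2)
  (fun i m => if i == j0 then wt f m != psi else [exists a, ev a == i] && (wt f m != chi))).
- apply: leq_ltn_trans (leq_trans lt _).
    rewrite leq_add2l; apply: leq_trans (leq_card_setU _ _) _; apply: leq_add.
      apply: leq_trans (leq_imset_card _ _) _.
      by rewrite (cardsD1 j0 [set j | tnth d j == tnth d j0]) inE eqxx.
    by apply: leq_trans (leq_imset_card _ _) _; rewrite card_pairs.
  apply: leq_trans (sum_ev_le (i0 := j0) _ _) => //; apply: leq_add; last first.
    by rewrite eqxx.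
  rewrite -[X in (X * _)%N]card_ord -sum_nat_const; apply: leq_sum => a _.
  rewrite evd; apply: mons_sub => m _ h; rewrite (negbTE (ej a)) h andbT.
  by apply/existsP; exists a.
- by move=> i; rewrite /H; case: eqP => [->|].
- move=> i m; rewrite /H; case: eqP => [_|_] h; apply/eqP; move: h.
    by apply: contraR => /Ppsi ->.
  by case/andP => /existsP[a /eqP <-]; apply: contraR => /Gchi ->.
- move=> i j; rewrite /v; case: eqP => [_|_]; last by rewrite msize0.
  apply: leq_trans (msizeD_le _ _) _; rewrite geq_max msizeC; apply/andP; split.
    by apply: leq_trans (leq_b1 _) _.
  apply: leq_trans (msize_sum _ _ _) _; apply/bigmax_leqP => a _.
  apply: leq_trans (msize_homog (hB a)) _; have := lt_dmax d j0; rewrite dj0; lia.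
- move=> i j m; rewrite /v; case: (eqVneq i j0) => [->|_]; last by rewrite mcoeff0 eqxx.
  rewrite mcoeffD mcoeffC inE.
  have [c0|c0] := eqVneq (cst j * ((m : 'X_{1..n.+1}) == 0%MM)%:R) 0; last first.
    move=> _; apply/orP; left; apply/imsetP; exists j.
      have [|dj jj] := hc j; first by apply: contraNneq c0 => ->; rewrite mul0r.
      by rewrite !inE jj dj eqxx.
    congr (_, _, _); apply: val_inj; apply/eqP; apply: contraNT c0 => /negbTE /= ->.
    by rewrite mulr0.
  rewrite c0 add0r raddf_sum /= => ne; apply/orP; right.
  have [/existsP[a /andP[/eqP aj am]]|] := boolP [exists a, (ev a == j) && ((B a)@_m != 0)]; last first.
    rewrite negb_exists => /forallP h; case/eqP: ne; apply: big1 => a aj.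
    by have := h a; rewrite aj negbK => /eqP.
  have mt : mdeg m = t.+1.
    by apply: (dhomog_mf (hB a)); rewrite mcoeff_msupp.
  apply/imsetP; exists (a, insubd bm0 (m : 'X_{1..n.+1})).
    by rewrite inE /= ins ?mt // eqxx BR.
  rewrite /= aj; congr (_, _, _); apply: val_inj.
  by rewrite /= ins ?mt //; symmetry; apply: ins; rewrite -/(dmax d) bmdeg.
move=> i; rewrite /v /H; case: (eqVneq i j0) => [->|ne]; last first.
  by rewrite big1 ?addr0 // => j _; rewrite mul0r.
rewrite {1}GE -addrA; congr (_ + _).
under [in RHS]eq_bigr => j _ do rewrite mulrDl mulr_suml.
rewrite big_split /=; congr (_ + _).
  apply: eq_bigr => j _; rewrite mul_mpolyC.
  have [->|/hc[_ /negbTE ->] //] := eqVneq (cst j) 0; by rewrite !scale0r.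
rewrite (exchange_big_dep xpredT) //=; apply: eq_bigr => a _.
by rewrite (big_pred1 (ev a)) ?(negbTE (ej a)) // => j; rewrite eq_sym.
Qed.

End Blocks.
End Special.

(** * Equations of a complete intersection with a diagonal symmetry *)

(** Division with remainder by one polynomial, for a monomial order; the term of
    highest order of p either is cancelled by a multiple of g or goes to the
    remainder. *)
Lemma divide_by_form (k : fieldType) N (g p : {mpoly k[N]}) e s :
    g \is e.-homog -> g != 0 -> p \is (s + e).-homog ->
  exists q, q \is s.-homog /\ forall m, (p - q * g)@_m != 0 -> ~~ (mlead g <= m)%MM.
Proof.
move=> hg g0; have gu0 : g@_(mlead g) != 0 by rewrite mleadc_eq0.
have gu : mlead g \in msupp g by rewrite mlead_supp.
have [mm mmE] : {mm | mlead p = mm} by exists (mlead p).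
elim/(well_founded_induction (@ltom_wf N)): mm p mmE => mm ih p pmm hp.
have [->|p0] := eqVneq p 0.
  by exists 0; split=> [|m]; rewrite ?dhomog0 // mul0r subr0 mcoeff0 eqxx.
have pp : mm \in msupp p by rewrite -pmm mlead_supp.
have step (t : {mpoly k[N]}) : t \is (s + e).-homog -> t@_mm = p@_mm ->
    (forall m, m \in msupp t -> (m <= mm)%O) ->
    exists q, q \is s.-homog /\
      forall m, (p - t - q * g)@_m != 0 -> ~~ (mlead g <= m)%MM.
  move=> ht tp tm; have hpt : p - t \is (s + e).-homog by apply: rpredB.
  have [pt|ne] := eqVneq (p - t) 0.
    exists 0; rewrite pt; split=> [|m]; rewrite ?dhomog0 //.
    by rewrite mul0r subr0 mcoeff0 eqxx.
  apply: (ih (mlead (p - t))) => //.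
  have lpt : mlead (p - t) \in msupp (p - t) by rewrite mlead_supp.
  rewrite Order.POrderTheory.lt_neqAle; apply/andP; split.
    apply: contraTneq lpt => ->; rewrite mcoeff_msupp negbK mcoeffB tp.
    by rewrite subrr.
  have := msuppB_le lpt; rewrite mem_cat => /orP[h|]; last exact: tm.
  by rewrite -pmm; apply: msupp_le_mlead.
have [um|num] := boolP (mlead g <= mm)%MM; last first.
  have [|||q [hq hr]] := step (p@_mm *: 'X_[mm]).
  - by rewrite dhomogZ // dhomogX /= (dhomog_mf hp pp).
  - by rewrite mcoeffZ mcoeffX eqxx mulr1.
  - move=> m /msuppZ_le; rewrite msuppX inE => /eqP ->; exact: Order.POrderTheory.lexx.
  exists q; split => // m.
  case: (eqVneq m mm) => [->|ne] //; move=> h; apply: hr; move: h.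
  by rewrite !mcoeffB mcoeffZ mcoeffX (eq_sym mm) (negbTE ne) mulr0 subr0.
pose a := p@_mm / g@_(mlead g).
have hX : a *: 'X_[mm - mlead g] \is s.-homog.
  rewrite dhomogZ // dhomogX /=; apply/eqP.
  have := congr1 (@mdeg N) (submK um); rewrite mdegD (dhomog_mf hp pp) (dhomog_mf hg gu).
  exact: addIn.
have [|||q [hq hr]] := step (a *: 'X_[mm - mlead g] * g).
- exact: dhomogM.
- rewrite -scalerAl mcoeffZ mulrC -[X in (_ * g)@_X](submK um) mulrC.
  by rewrite [_ * g]mulrC mcoeffMX divfK.
- move=> m; rewrite -scalerAl => /msuppZ_le; rewrite mulrC => /msupp_le_mlead h.
  apply: Order.POrderTheory.le_trans h _; apply: Order.POrderTheory.le_trans (mleadM_le _ _) _.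
  by rewrite mleadXm addmC submK // Order.POrderTheory.lexx.
exists (a *: 'X_[mm - mlead g] + q); split; first exact: rpredD.
by move=> m; rewrite mulrDl opprD addrA; apply: hr.
Qed.

Section DiagonalSymmetry.
Variables (k : closedFieldType) (n c : nat) (d : c.-tuple nat).
Variables (f : 'I_n.+1 -> k).
Hypothesis f0 : forall i, f i != 0.
Variable G : 'I_c -> {mpoly k[n.+1]}.
Hypothesis hG : forms d G.
Hypothesis indep : forall (g : 'I_c -> {mpoly k[n.+1]}) j a,
  \sum_i g i * G i = 0 -> g j = a%:MP -> a = 0.
Hypothesis stab : forall i, generated_by G (dsub f (G i)).

Lemma wt_neq0 m : wt f m != 0.
Proof. by rewrite /wt; apply/prodf_neq0 => i _; apply: expf_neq0. Qed.

Lemma semi_invariantP (p : {mpoly k[n.+1]}) w :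
  (forall m, p@_m != 0 -> wt f m = w) <-> dsub f p = w *: p.
Proof.
split=> [h|h m pm].
  apply/mpolyP => m; rewrite dsub_coef mcoeffZ.
  by have [->|/h ->] := eqVneq (p@_m) 0; rewrite ?mulr0.
by have /(congr1 (mcoeff m)) := h; rewrite dsub_coef mcoeffZ => /(mulIf pm).
Qed.

Lemma iso_sum (p : {mpoly k[n.+1]}) (ws := undup [seq wt f m | m <- msupp p]) :
  \sum_(i < size ws) iso f ws`_i p = p.
Proof.
apply/mpolyP => m; rewrite raddf_sum /=; under eq_bigr => i _ do rewrite iso_coef.
have [mp|] := boolP (m \in msupp p); last first.
  by rewrite mcoeff_msupp negbK => /eqP ->; rewrite big1 // => i _; rewrite mul0rn.
have wm : wt f m \in ws by rewrite mem_undup map_f.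
have lt : (index (wt f m) ws < size ws)%N by rewrite index_mem.
rewrite (bigD1 (Ordinal lt)) //= nth_index // eqxx big1 ?addr0 // => i ne.
case: (wt f m =P ws`_i) => // e; case/eqP: ne; apply: val_inj => /=.
by rewrite e index_uniq // undup_uniq.
Qed.

(** The components of G j0 lie in the ideal and add up to G j0; their
    coefficients on G j0 add up to 1, because a relation between the generators
    has no constant coefficient. *)
Lemma semi_invariant_generator j0 :
  exists psi (P : {mpoly k[n.+1]}) (g : 'I_c -> {mpoly k[n.+1]}),
  [/\ psi != 0, P \is (tnth d j0).-homog, forall m, P@_m != 0 -> wt f m = psi,
      P = \sum_i g i * G i
    & g j0 = 1 /\ forall i,
        ((tnth d i <= tnth d j0)%N -> g i \is (tnth d j0 - tnth d i).-homog) /\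
        ((tnth d j0 < tnth d i)%N -> g i = 0)].
Proof.
pose ws := undup [seq wt f m | m <- msupp (G j0)].
have hiso w : iso f w (G j0) \is (tnth d j0).-homog by apply: iso_homog.
have /fin_all_exists[g gP] (i : 'I_(size ws)) : exists g : 'I_c -> {mpoly k[n.+1]},
    iso f ws`_i (G j0) = \sum_j g j * G j /\ forall j,
        ((tnth d j <= tnth d j0)%N -> g j \is (tnth d j0 - tnth d j).-homog) /\
        ((tnth d j0 < tnth d j)%N -> g j = 0).
  by apply: (generated_homog hG) => //; apply: generated_iso => //; apply: generated_by_gen.
pose ga i := (g i j0)@_0%MM.
have gaE i : g i j0 = (ga i)%:MP.
  apply: dhomog0_const; have [_ /(_ j0) [h _]] := gP i.
  by move: (h (leqnn _)); rewrite subnn.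
have ga1 : \sum_i ga i - 1 = 0.
  apply: (indep (g := fun j => \sum_i g i j - (j == j0)%:R) (j := j0)); last first.
    by rewrite eqxx mpolyCB mpolyC1 raddf_sum; under eq_bigr => i _ do rewrite gaE.
  under eq_bigr => j _ do rewrite mulrBl mulr_suml.
  rewrite sumrB exchange_big /= (bigD1 j0 (F := fun j => (j == j0)%:R * G j)) //=.
  rewrite eqxx mul1r [X in _ - (_ + X)]big1 ?addr0 => [|j /negbTE ->]; last by rewrite mul0r.
  rewrite -[X in _ - X](iso_sum (G j0)) -/ws; apply/eqP; rewrite subr_eq0; apply/eqP.
  by apply: eq_bigr => i _; rewrite (gP i).1.
have [i gi] : exists i, ga i != 0.
  have [/existsP//|] := boolP [exists i, ga i != 0].
  rewrite negb_exists => /forallP h; move/eqP: ga1; rewrite big1 ?sub0r.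
    by rewrite oppr_eq0 oner_eq0.
  by move=> i _; apply/eqP; have := h i; rewrite negbK.
have [gE gd] := gP i.
exists ws`_i, ((ga i)^-1 *: iso f ws`_i (G j0)), (fun j => (ga i)^-1%:MP * g i j); split.
- have /(mem_nth 0) := ltn_ord i; rewrite mem_undup => /mapP[m _ ->].
  exact: wt_neq0.
- by rewrite dhomogZ.
- move=> m; rewrite mcoeffZ mulf_eq0 negb_or => /andP[_]; exact: iso_wt.
- rewrite gE scaler_sumr; apply: eq_bigr => j _.
  by rewrite -mul_mpolyC mulrA.
split; first by rewrite gaE -mpolyCM mulVf.
move=> j; have [h1 h2] := gd j; split=> h; last by rewrite h2 ?mulr0.
by rewrite mul_mpolyC dhomogZ ?h1.
Qed.

Section Second.
Variables (e r : nat) (ev : 'I_r.+1 -> 'I_c) (j0 : 'I_c).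
Hypotheses (evI : injective ev) (evd : forall a, tnth d (ev a) = e).
Hypothesis ev_onto : forall i, tnth d i = e -> exists a, ev a = i.
Hypothesis emin : forall i, (e <= tnth d i)%N.
Hypotheses (j0e : tnth d j0 != e)
  (j0min : forall i, tnth d i != e -> (tnth d j0 <= tnth d i)%N).

(** Between e and the degree of G j0 there is no other degree, so the relation
    for P only involves the equations of these two degrees. *)
Lemma second_degree_relation :
  exists psi (P : {mpoly k[n.+1]}) (cst : 'I_c -> k) (B : 'I_r.+1 -> {mpoly k[n.+1]}),
  [/\ psi != 0, P \is (tnth d j0).-homog /\ (forall m, P@_m != 0 -> wt f m = psi),
      forall j, cst j != 0 -> tnth d j = tnth d j0 /\ j != j0,
      forall a, B a \is (tnth d j0 - e).-homog
    & G j0 = P + \sum_j cst j *: G j + \sum_a B a * G (ev a)].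
Proof.
have [psi [P [g [psi0 hP Ppsi PE [gj0 gd]]]]] := semi_invariant_generator j0.
pose cst j := if (tnth d j == tnth d j0) && (j != j0) then - (g j)@_0%MM else 0.
exists psi, P, cst, (fun a => - g (ev a)); split => //.
- by move=> j; rewrite /cst; case: ifP; rewrite ?eqxx // => /andP[/eqP].
- by move=> a; rewrite rpredN; have [h _] := gd (ev a); rewrite -(evd a) h // evd emin.
have T i : g i * G i = (i == j0)%:R * G i - cst i *: G i +
    (if tnth d i == e then g i * G i else 0).
  rewrite /cst; case: (eqVneq i j0) => [->|ne].
    by rewrite gj0 eqxx andbF (negbTE j0e) /= scale0r subr0 addr0.
  rewrite mul0r andbT; have [h1 h2] := gd i.
  case: (eqVneq (tnth d i) e) => [->|ie].
    by rewrite eq_sym (negbTE j0e) /= scale0r subr0 add0r.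
  case: (eqVneq (tnth d i) (tnth d j0)) => [ij|ij].
    rewrite scaleNr add0r opprK addr0 -mul_mpolyC -dhomog0_const //.
    by have := h1 (eq_leq ij); rewrite ij subnn.
  by rewrite h2 ?mul0r ?scale0r ?subr0 ?addr0 //= ltn_neqAle eq_sym ij j0min.
have {}PE : P = G j0 - \sum_j cst j *: G j + \sum_a g (ev a) * G (ev a).
  rewrite PE (eq_bigr _ (fun i _ => T i)) big_split sumrB /= -big_mkcond /=.
  rewrite (sum_fiber _ evI evd ev_onto); congr (_ - _ + _).
  rewrite (bigD1 j0) //= eqxx mul1r big1 ?addr0 // => j /negbTE ->.
  by rewrite mul0r.
rewrite PE; under [X in _ = _ + X]eq_bigr => a _ do rewrite mulNr.
by rewrite sumrN; ring.
Qed.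

(** Multiples of the lower equations that have the weight of P may be absorbed
    in P. *)
Lemma off_weight (P : {mpoly k[n.+1]}) psi chi (Q : {mpoly k[n.+1]})
    (B : 'I_r.+1 -> {mpoly k[n.+1]}) : chi != 0 ->
    (forall a m, (G (ev a))@_m != 0 -> wt f m = chi) ->
    P \is (tnth d j0).-homog -> (forall m, P@_m != 0 -> wt f m = psi) ->
    (forall a, B a \is (tnth d j0 - e).-homog) ->
    G j0 = P + Q + \sum_a B a * G (ev a) ->
  exists (P' : {mpoly k[n.+1]}) (B' : 'I_r.+1 -> {mpoly k[n.+1]}),
  [/\ P' \is (tnth d j0).-homog, forall m, P'@_m != 0 -> wt f m = psi,
      forall a, B' a \is (tnth d j0 - e).-homog,
      forall a m, (B' a)@_m != 0 -> (B a)@_m != 0 /\ wt f m != psi / chi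
    & G j0 = P' + Q + \sum_a B' a * G (ev a)].
Proof.
move=> chi0 Gchi hP Ppsi hB GE.
pose I a := iso f (psi / chi) (B a).
have hI a : I a \is (tnth d j0 - e).-homog by apply: iso_homog.
exists (P + \sum_a I a * G (ev a)), (fun a => B a - I a); split.
- apply: rpredD => //; apply: rpred_sum => a _.
  have -> : tnth d j0 = (tnth d j0 - e + e)%N by rewrite subnK.
  by apply: dhomogM => //; rewrite -(evd a).
- apply/semi_invariantP; rewrite /dsub lsubD lsub_sum -!/(dsub _ _) scalerDr.
  have /semi_invariantP -> := Ppsi; congr (_ + _); rewrite scaler_sumr.
  apply: eq_bigr => a _; rewrite /dsub lsubM -!/(dsub _ _).
  have /semi_invariantP -> := Gchi a; have /semi_invariantP -> := @iso_wt _ _ f (psi / chi) (B a).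
  by rewrite -scalerAl -scalerAr scalerA divfK.
- by move=> a; apply: rpredB.
- move=> a m; rewrite mcoeffB iso_coef; case: (eqVneq (wt f m) (psi / chi)) => [_|_] /=.
    by rewrite subrr eqxx.
  by rewrite subr0.
rewrite {1}GE; under [X in _ = _ + X]eq_bigr => a _ do rewrite mulrBl.
by rewrite sumrB; ring.
Qed.

Lemma card_levels : (#|[set j | tnth d j == tnth d j0]| + r.+1 <= c)%N.
Proof.
have := cardsC [set j | tnth d j == tnth d j0]; rewrite card_ord => cE.
suff : (r.+1 <= #|~: [set j | tnth d j == tnth d j0]|)%N by lia.
rewrite -[X in (X <= _)%N]card_ord -(card_imset _ evI).
apply: subset_leq_card; apply/subsetP => _ /imsetP[a _ ->].
by rewrite !inE evd eq_sym.
Qed.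

Lemma card_level_pos : (0 < #|[set j | tnth d j == tnth d j0]|)%N.
Proof. by rewrite card_gt0; apply/set0Pn; exists j0; rewrite inE. Qed.

End Second.
End DiagonalSymmetry.

Lemma divide_by_form_le (k : fieldType) N (g p : {mpoly k[N]}) e t :
    g \is e.-homog -> g != 0 -> p \is t.-homog ->
  exists q, (forall g', g' \is e.-homog -> q * g' \is t.-homog) /\
    forall m, (p - q * g)@_m != 0 -> ~~ (mlead g <= m)%MM.
Proof.
move=> hg g0 hp; have [et|te] := leqP e t.
  have hp' : p \is (t - e + e).-homog by rewrite subnK.
  have [q [hq hr]] := divide_by_form hg g0 hp'; exists q; split=> // g' hg'.
  by rewrite -(subnK et); apply: dhomogM.
exists 0; split=> [g' _|m]; first by rewrite mul0r dhomog0.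
rewrite mul0r subr0 -mcoeff_msupp => /(dhomog_mf hp) mt; apply/negP => le.
have := congr1 (@mdeg N) (submK le).
by rewrite mdegD mt (dhomog_mf hg (mlead_supp g0)); lia.
Qed.

Section SpecialOfDiagonal.
Variables (k : closedFieldType) (n c : nat) (d : c.-tuple nat).
Variables (f : 'I_n.+1 -> k) (m : nat) (mu : k).
Hypotheses (fm : forall i, f i ^+ m = mu) (m0 : m%:R != 0 :> k) (mu0 : mu != 0).
Hypothesis f0 : forall i, f i != 0.
Hypothesis fnc : exists i j, f i != f j.
Variable G : 'I_c -> {mpoly k[n.+1]}.
Hypothesis hG : forms d G.
Hypothesis indep : forall (g : 'I_c -> {mpoly k[n.+1]}) j a,
  \sum_i g i * G i = 0 -> g j = a%:MP -> a = 0.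
Hypothesis stab : forall i, generated_by G (dsub f (G i)).
Hypotheses (hd2 : forall i, (2 <= tnth d i)%N) (c2 : (2 <= c)%N) (cn : (c < n)%N).
Hypothesis hd22 : tval d <> [:: 2; 2]%N.

Section Quadrics.
Variables (r : nat) (ev : 'I_r.+1 -> 'I_c) (chi : k).
Hypotheses (evI : injective ev) (evd : forall a, tnth d (ev a) = 2%N).
Hypothesis ev_onto : forall i, tnth d i = 2%N -> exists a, ev a = i.
Hypothesis Gchi : forall a m', (G (ev a))@_m' != 0 -> wt f m' = chi.
Hypothesis G0 : forall a, G (ev a) != 0.

Lemma quadric_lead a : mdeg (mlead (G (ev a))) = 2%N /\ wt f (mlead (G (ev a))) = chi.
Proof.
have h := mlead_supp (G0 a); split; last by apply: (Gchi (a := a)); rewrite -mcoeff_msupp.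
by rewrite (dhomog_mf (hG _) h) evd.
Qed.

Lemma chi_neq0 : chi != 0.
Proof. by have [_ <-] := quadric_lead ord0; apply: wt_neq0. Qed.

(** With at most two quadrics, this is where the multidegree (2, 2) is excluded. *)
Lemma higher_degree : (r <= 1)%N -> exists j, tnth d j != 2%N.
Proof.
move=> r1; have [/existsP//|] := boolP [exists j, tnth d j != 2%N].
rewrite negb_exists => /forallP h.
have all2 j : tnth d j = 2%N by apply/eqP; have := h j; rewrite negbK.
have : (c <= r.+1)%N.
  rewrite -[c]card_ord -[r.+1]card_ord -(card_imset _ evI); apply: subset_leq_card.
  by apply/subsetP => j _; have [a <-] := ev_onto (all2 j); apply: imset_f.
move=> cr; have cE : c = 2%N by lia.
case: hd22; apply: (@eq_from_nth _ 0%N); rewrite ?size_tuple ?cE //.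
move=> i ic.
rewrite -(tnth_nth 0%N d (Ordinal ic)) all2.
by move: (ic); rewrite cE; case: i {ic} => [|[|]].
Qed.

Lemma next_degree : (r <= 1)%N -> exists j0 t, [/\ tnth d j0 = t.+3,
  tnth d j0 != 2%N & forall i, tnth d i != 2%N -> (tnth d j0 <= tnth d i)%N].
Proof.
move=> /higher_degree[j1 hj].
case: (@arg_minnP _ j1 (fun j => tnth d j != 2%N) (fun j => tnth d j) hj) => j0 h jm.
exists j0, (tnth d j0 - 3)%N; split => //.
by have := hd2 j0; move/eqP: h; lia.
Qed.

(** For a single quadric, the cofactors need only the weights different from
    psi / chi. *)
Lemma special_one_quadric : r = 0%N -> special d f G.
Proof.
move=> r0; have [|j0 [t [dj0 j02 j0m]]] := next_degree; first by rewrite r0.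
have [psi [P [cst [B [psi0 [hP Ppsi] hc hB GE]]]]] :=
  second_degree_relation f0 hG indep stab evI evd ev_onto hd2 j02 j0m.
have [P' [B' [hP' P'psi hB' B'B {}GE]]] :=
  off_weight hG evd hd2 chi_neq0 Gchi hP Ppsi hB GE.
have [d2 w2] := quadric_lead ord0; have [i [j uE]] := mdeg2_pair d2.
have fij : f i * f j = chi by rewrite -w2 uE wtD !wtU.
apply: (special_second_block evI evd (t := t) (R := fun _ m => wt f m != psi / chi)
  hG _ Gchi hP' P'psi hc _ _ GE) => //.
- by rewrite dj0 addn2.
- by move=> a; have := hB' a; rewrite dj0 subSS subn1.
- by move=> a m' /B'B[].
have n4 : (4 <= n.+1)%N by lia.
have := quadric_and_form f0 fnc t n4 chi_neq0 psi0 fij.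
have := card_levels evI evd j02; have := card_level_pos d j0.
rewrite dj0 -/(nwt f t.+1 (psi / chi)) sum_nat_const card_ord r0 !mul1n.
set s := #|_|; move: (ncomm f) (nwt _ _ _) (nwt _ _ _) (nwt _ _ _) => D x y z; lia.
Qed.

(** For a pencil of quadrics, the cofactor of the second one can be reduced
    modulo the leading monomial of the first. *)
Lemma special_involution : r = 1%N -> (forall i, f i * f i = chi) -> special d f G.
Proof.
move=> r1 inv; have [|j0 [t [dj0 j02 j0m]]] := next_degree; first by rewrite r1.
have [psi [P [cst [B [psi0 [hP Ppsi] hc hB GE]]]]] :=
  second_degree_relation f0 hG indep stab evI evd ev_onto hd2 j02 j0m.
have lt1 : (1 < r.+1)%N by rewrite r1.
pose a0 : 'I_r.+1 := ord0; pose a1 := Ordinal lt1.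
have ne : a1 != a0 by [].
have S2 (V : nmodType) (x : 'I_r.+1 -> V) : \sum_a x a = x a0 + x a1.
  rewrite (bigD1 a0) //= (bigD1 a1) //= big1 ?addr0 // => a /andP[n0 n1].
  have := ltn_ord a; move: n0 n1; rewrite -!val_eqE /=; lia.
have hG2 a : G (ev a) \is 2.-homog by rewrite -(evd a).
have [q [hq qu]] := divide_by_form_le (hG2 a0) (G0 a0) (hB a1).
pose u := mlead (G (ev a0)).
pose B1 a := if a == a0 then B a0 + q * G (ev a1) else B a1 - q * G (ev a0).
have hB1 a : B1 a \is (tnth d j0 - 2).-homog.
  rewrite /B1; case: ifP => _; first by apply: rpredD => //; apply: hq.
  by apply: rpredB => //; apply: hq.
have GE1 : G j0 = P + \sum_j cst j *: G j + \sum_a B1 a * G (ev a).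
  by rewrite {1}GE !S2 /B1 eqxx (negbTE ne); ring.
have [P' [B' [hP' P'psi hB' B'B {}GE1]]] :=
  off_weight hG evd hd2 chi_neq0 Gchi hP Ppsi hB1 GE1.
have [d2 w2] := quadric_lead a0.
apply: (special_second_block evI evd (t := t)
  (R := fun a m => (wt f m != psi / chi) && ((a == a1) ==> ~~ (u <= m)%MM))
  hG _ Gchi hP' P'psi hc _ _ GE1) => //.
- by rewrite dj0 addn2.
- by move=> a; have := hB' a; rewrite dj0 subSS subn1.
- move=> a m' /B'B[h ->] /=; apply/implyP => /eqP aa; apply: qu.
  by move: h; rewrite /B1 aa (negbTE ne).
have hl := card_levels evI evd j02; have hp := card_level_pos d j0.
have n5 : (5 <= n.+1)%N by move: hl hp; rewrite r1; set s := #|_|; lia.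
have := involution_pencil f0 fnc t psi n5 inv d2 w2.
have := nwt2_ge f0 chi_neq0.
rewrite (_ : #|_| = 0%N); last first.
  by apply/eqP; rewrite cards_eq0; apply/eqP/setP => i; rewrite !inE inv eqxx.
rewrite S2 eqxx (eq_sym a0) (negbTE ne) /=.
have -> : mons t.+1 (fun m' => (wt f m' != psi / chi) && true) = nwt f t.+1 (psi / chi).
  by apply: eq_mons => m' _; rewrite andbT.
rewrite dj0 r1 /= in hl hp *; move: hl hp.
set s := #|_|; set x := nwt _ _ _; set y := nwt _ _ _; set z := mons _ _; set w := nwt _ _ _.
move: (ncomm f) => D; lia.
Qed.

End Quadrics.

Lemma special_of_diagonal : special d f G.
Proof.
have i1 : 'I_c by apply: Ordinal c2.
case: (@arg_minnP _ i1 xpredT (fun i => tnth d i) isT) => i0 _ imin.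
have {}imin i : (tnth d i0 <= tnth d i)%N by apply: imin.
have [r [ev [evI evd ev_onto]]] := enum_fiber (tnth d) i0.
have [chi [C [H [Cn hH Hchi GH H0]]]] :=
  lowest_block fm m0 mu0 hG indep stab evI evd ev_onto imin.
have chi0 a : chi a != 0.
  by rewrite -(Hchi a (mlead (H a))) ?mleadc_eq0 //; apply: wt_neq0.
have rc : (r.+1 <= c)%N by have := leq_card ev evI; rewrite !card_ord.
have [e3|e2] := leqP 3 (tnth d i0).
  apply: (special_first_block evI evd hG Cn hH Hchi GH).
  have -> : tnth d i0 = (tnth d i0 - 3).+3 by lia.
  by apply: block_cubic => //; lia.
have {e2}eE : tnth d i0 = 2%N by apply/eqP; rewrite eqn_leq -ltnS e2 hd2.
rewrite eE in evd ev_onto hH imin.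
have special_chi : (ncomm f + ncomm chi < \sum_a nwt f 2 (chi a))%N -> special d f G.
  move=> lt; apply: (special_first_block evI evd hG Cn hH Hchi GH); exact: lt.
have [r3|r3] := leqP 3 r.+1; first by apply/special_chi/block_many => //; lia.
have Gconst w : (forall a, chi a = w) ->
    (forall a m', (G (ev a))@_m' != 0 -> wt f m' = w) /\ forall a, G (ev a) != 0.
  move=> cw; have GHa a : G (ev a) = H a.
    rewrite GH (bigD1 a) //= Cn // eqxx scale1r big1 ?addr0 // => b ba.
    by rewrite Cn ?cw // eq_sym (negbTE ba) scale0r.
  by split=> a; rewrite GHa // => m' /Hchi ->.
case: r => [|r'] in ev evI evd ev_onto chi C H Cn hH Hchi GH H0 chi0 rc special_chi r3 Gconst *.
  have [|h1 h2] := Gconst (chi ord0); first by move=> a; rewrite ord1.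
  exact: special_one_quadric evI evd ev_onto h1 h2 erefl.
have {}rE : r' = 0%N by lia.
rewrite {r' r3}rE in ev evI evd ev_onto chi C H Cn hH Hchi GH H0 chi0 rc special_chi Gconst *.
have [/forallP h|] := boolP [forall a, (chi a == chi ord0) && [forall i, f i * f i == chi ord0]].
  have inv i : f i * f i = chi ord0 by have /andP[_ /forallP/(_ i)/eqP] := h ord0.
  have [|h1 h2] := Gconst (chi ord0); first by move=> a; have /andP[/eqP] := h a.
  exact: special_involution evI evd ev_onto h1 h2 erefl inv.
move=> h; apply/special_chi/block_pencil => //.
  have [j j2] := higher_degree evI ev_onto (leqnn 1).
  by have := card_levels evI evd j2; have := card_level_pos d j; set s := #|_|; lia.
move=> w cw; have [/existsP[i]|] := boolP [exists i, f i * f i != w]; first by exists i.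
rewrite negb_exists => /forallP h'; case/forallP: h => a; rewrite !cw eqxx /=.
by apply/forallP => i; have := h' i; rewrite negbK.
Qed.

End SpecialOfDiagonal.

(** * Linear automorphisms of smooth complete intersections *)

Lemma natr_prime_to (k : fieldType) p m :
  has_char k p -> prime_to p m -> (0 < m)%N -> m%:R != 0 :> k.
Proof.
move=> hp pm m0; case: hp pm => [[_ /pcharf0P -> _]|pk [p0|cop]].
- by rewrite -lt0n.
- by have := pcharf_prime pk; rewrite p0.
rewrite -(dvdn_pcharf pk); apply/negP => pm; have := pcharf_prime pk.
by move: cop; rewrite /coprime (gcdn_idPr pm) => /eqP ->.
Qed.

Lemma trmx_power (R : comNzRingType) N (A : 'M[R]_N.+1) m : (A ^+ m)^T = A^T ^+ m.
Proof.
elim: m => [|m ih]; first by rewrite !expr0 trmx1.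
by rewrite exprS exprSr -ih; apply: trmx_mul.
Qed.

Section Automorphism.
Variables (k : closedFieldType) (n c : nat) (d : c.-tuple nat).
Hypotheses (hd2 : forall i, (2 <= tnth d i)%N) (c2 : (2 <= c)%N) (cn : (c < n)%N).
Hypothesis hd22 : tval d <> [:: 2; 2]%N.
Variable F : 'I_c -> {mpoly k[n.+1]}.
Hypothesis sF : smooth_ci d F.

Lemma lin_aut_ideal h i : lin_aut (zeros F) h -> generated_by F (lsub h (F i)).
Proof.
have [[_ _ hI] _] := sF.
move=> [_ hX]; apply/hI => x Xx; rewrite lsub_meval.
by have [_ ->] := (hX x).2 Xx.
Qed.

(** Since h ^ m is scalar, h is diagonal in suitable coordinates, with a
    normalized matrix P of coordinates, and the equations G of X in these
    coordinates generate an ideal stable under the diagonal matrix. *)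
Lemma trivial_or_small_type h m : lin_aut (zeros F) h -> m%:R != 0 :> k ->
  trivial_on (zeros F) (h ^+ m) -> trivial_on (zeros F) h \/ small_type d F.
Proof.
move=> hX m0 tm; have [CI _] := sF; have [hF _ _] := CI; have [uh _] := hX.
have [mu hm] := trivial_on_scalar hd2 cn CI tm.
have mu0 : mu != 0.
  have : h ^+ m \is a GRing.unit by apply: GRing.unitrX.
  by rewrite hm; apply: contraTneq => ->; rewrite raddf0 unitr0.
have [|f [C [uC hC Cn]]] := @power_eigenbasis k n h^T m mu _ m0 mu0.
  by rewrite -trmx_power hm tr_scalar_mx.
pose P := C^T; pose D := diag_mx (\row_i f i).
have uP : P \in unitmx by rewrite unitmx_tr.
have Ph : P *m h = D *m P by have := congr1 trmx hC; rewrite !trmx_mul trmxK tr_diag_mx.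
have Pn i j : f i = f j -> P i j = (i == j)%:R.
  by move=> fij; rewrite mxE Cn // eq_sym.
have fm i : f i ^+ m = mu.
  have PhE l : P *m h ^+ l = diag_mx (\row_i f i ^+ l) *m P.
    elim: l => [|l ih].
      rewrite expr0 mulmx1 (_ : \row_i _ = const_mx 1) ?diag_const_mx ?mul1mx //.
      by apply/rowP => j; rewrite !mxE expr0.
    rewrite exprSr [_ * h](_ : _ = h ^+ l *m h) // mulmxA ih -mulmxA Ph.
    by apply/matrixP => a b; rewrite !mul_diag_mx !mxE exprSr mulrA.
  have := congr1 (fun M : 'M_n.+1 => M i i) (PhE m).
  by rewrite hm mul_mx_scalar mul_diag_mx !mxE Cn // eqxx !mulr1.
have f0 i : f i != 0.
  apply: contraNneq mu0 => fi; rewrite -(fm i) fi expr0n.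
  by case: (m) m0 => // /eqP.
have [/existsP[i /existsP[j fij]]|] := boolP [exists i, [exists j, f i != f j]]; last first.
  rewrite negb_exists => /forallP fc; left => x _; exists (f 0).
  have fE i : f i = f 0.
    by have := fc i; rewrite negb_exists => /forallP/(_ 0); rewrite negbK => /eqP.
  suff -> : h = (f 0)%:M by rewrite mul_scalar_mx.
  apply: (can_inj (mulKmx uP)); rewrite Ph mul_mx_scalar.
  by apply/matrixP => a b; rewrite mul_diag_mx !mxE fE.
right; pose G l := lsub (invmx P) (F l).
have FG l : F l = lsub P (G l) by rewrite /G lsub_comp mulVmx // lsub1.
have hG : forms d G by move=> l; apply: lsub_homog.
apply: (small_type_of_special (f := f) (P := P) (G := G)) => //.
apply: (special_of_diagonal fm m0 mu0 f0) => //; first by exists i, j.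
  move=> g l a rel gl; apply: (smooth_const_relation (g := fun l => lsub P (g l)) (j := l) sF).
    have /(congr1 (lsub P)) := rel; rewrite lsub0 lsub_sum => h0; rewrite -[RHS]h0.
    by apply: eq_bigr => l' _; rewrite lsubM -FG.
  by rewrite gl lsubC.
move=> l; have -> : dsub f (G l) = lsub (invmx P) (lsub h (F l)).
  rewrite /dsub /G !lsub_comp -/D; congr lsub.
  by apply: (can_inj (mulKmx uP)); rewrite !mulmxA mulmxV // mul1mx Ph mulmxK.
have [g ->] := lin_aut_ideal l hX; rewrite lsub_sum.
by exists (fun l' => lsub (invmx P) (g l')); apply: eq_bigr => l' _; rewrite lsubM.
Qed.

End Automorphism.

Lemma generic_open (k : closedFieldType) n c (d : c.-tuple nat)
    (Q : ('I_c -> {mpoly k[n.+1]}) -> Prop) : generic d Q ->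
  exists U : ('I_c -> {mpoly k[n.+1]}) -> Prop,
    [/\ zariski_open d U, exists2 F, forms d F & U F
      & forall F, forms d F -> U F -> Q F].
Proof.
move=> [f [[P fP] [v fv] fQ]].
exists (fun F => f (fun s => cf F s) != 0); split => //.
  exists (fun P' => P' = P) => F _; rewrite fP; split=> [h|[_ -> //]].
  by exists P.
exists (form_of v); first exact: form_of_forms.
by rewrite fP; move: fv; rewrite fP; under meval_eq => i do rewrite -cf_form_of.
Qed.

Lemma generic_smooth_ci (k : closedFieldType) n c (d : c.-tuple nat) :
    (c <= n)%N -> (forall i, (1 <= tnth d i)%N) ->
  generic d (fun F : 'I_c -> {mpoly k[n.+1]} => smooth_ci d F /\ ~ small_type d F).
Proof.
move=> cn d1; have [f [fP fv fQ]] := generic_and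
  (generic_complete_intersection k cn d1) (generic_not_thin (thin_small_type k n d)).
exists f; split => // F hF /(fQ F hF)[CI nsm]; split => //; split => // x Xx.
apply/eqP/negPn/negP => rk.
exact: (nsm (singular_small_type d1 hF Xx rk)).
Qed.

Local Close Scope ring_scope.

Theorem theorem1p3 (k : closedFieldType) (p : nat) (hp : has_char k p)
    (n c : nat) (d : c.-tuple nat)
    (hd2 : forall i : 'I_c, (2 <= tnth d i)%N)
    (hd_sorted : sorted leq d)
    (hc : (2 <= c)%N) (hn : (c + 1 <= n)%N)
    (hd22 : tval d <> [:: 2; 2]) :
  exists U : ('I_c -> {mpoly k[n.+1]}) -> Prop,
    [/\ zariski_open d U,
        exists2 F, forms d F & U F
      & forall F, forms d F -> U F ->
          smooth_ci d F /\
          forall (h : 'M[k]_n.+1) (m : nat),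
            lin_aut (zeros F) h -> aut_order (zeros F) h m -> prime_to p m ->
            trivial_on (zeros F) h].
Proof.
have cn : (c < n)%N by rewrite -addn1.
have [|U [oU U0 UQ]] := generic_open (generic_smooth_ci k (ltnW cn) (d := d) _).
  by move=> i; apply: ltnW.
exists U; split=> // F hF /(UQ F hF)[sF nsm]; split=> // h m hX [m0 tm _] pm.
by have [//|] := trivial_or_small_type hd2 hc cn hd22 sF hX (natr_prime_to hp pm m0) tm.
Qed.
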